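(* Let $m\ge1$ and let $\mathcal{P}=(d_{i_1},d_{i_2},\dots,d_{i_m})$ be a pattern where each $d_{i_j}\in\{d_1,\dots,d_\nu\}$ and each $d_i$ occurs exactly $r_i$ times in $\mathcal{P}$, with $r_1+\cdots+r_\nu=m$. Modify the $N\times N$ real symmetric period $m$-block circulant matrices ($m\mid N$) by replacing the pattern $(d_1,d_2,\dots,d_m)$ with $\mathcal{P}$. Then for any $\mathcal{P}$, as $N\to\infty$ the limiting spectral measure exists. The resulting measure does not depend solely on the frequencies of the letters in the pattern but also on their locations; in particular, the fourth moments of the limiting measures associated to $(d_1,d_2,d_1,d_2)$ and $(d_1,d_1,d_2,d_2)$ are equal (indeed the fourth moment for any pattern depends only on the frequencies of the letters), but their sixth moments differ.
   Context: Let $p$ be a probability density on $\mathbb{R}$ with mean $0$, variance $1$ and finite moments of all orders. **Ensemble with pattern $\mathcal P$.** In an $N\times N$ symmetric $m$-block circulant matrix each wrapped (toroidal) diagonal is periodic with a repeating block of $m$ independent random variables; this is the pattern $(d_1,\dots,d_m)$ of distinct letters. For a general pattern $\mathcal P$, letters in the period are forced to be equal according to $\mathcal P$, with fresh independent variables for each wrapped diagonal. Explicitly, extend $\mathcal P$ to a function $\mathcal P(s)\in\{d_1,\dots,d_\nu\}$ of $s\bmod m$ (so $\mathcal P(s)=d_{i_s}$ for $1\le s\le m$). For $1\le i,j\le N$: if $0\le j-i<N/2$ or $i-j\ge N/2$, put $\delta(i,j)=(j-i)\bmod N$ and slot $s(i,j)=i$; if $0\le i-j<N/2$ or $j-i\ge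 N/2$, put $\delta(i,j)=(i-j)\bmod N$ and slot $s(i,j)=j$. Thus $0\le\delta(i,j)\le N/2$. Let $x_{\delta,d}$ ($0\le\delta\le N/2$, $d\in\{d_1,\dots,d_\nu\}$) be i.i.d. with density $p$ and set $a_{ij}=x_{\delta(i,j),\,\mathcal P(s(i,j))}$. (When $N$ is even, symmetry may force further equalities among the entries with $|i-j|=N/2$; these affect only lower order terms and do not influence the limit.) **Moments and limiting spectral measure.** For such a random matrix $A_N$ with eigenvalues $\lambda_1,\dots,\lambda_N$, let $\mu_{A_N}=\frac1N\sum_{i}\delta_{\lambda_i/\sqrt N}$ and let $M_k(N)=\mathbb E\big[\int x^k\,d\mu_{A_N}(x)\big]$. The ensemble has limiting spectral measure $\mu$ if, as $N\to\infty$ through multiples of $m$, $M_k(N)$ converges for every $k\ge0$ to the $k$-th moment of $\mu$, where $\mu$ is a probability measure uniquely determined by its moments. *)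

(* Defs.v *)
From HB Require Import structures.
From mathcomp Require Import all_boot all_order all_algebra.
From mathcomp Require Import all_classical all_reals all_analysis.
From mathcomp Require Import zify.

Set Implicit Arguments.
Unset Strict Implicit.
Unset Printing Implicit Defensive.

Import Order.TTheory GRing.Theory Num.Theory.
Import numFieldNormedType.Exports.

Local Open Scope classical_set_scope.
Local Open Scope ring_scope.

Section Moments.
Context {R : realType}.

Definition moment (mu : {measure set (measurableTypeR R) -> \bar R}) (k : nat)
    : \bar R :=
  (\int[mu]_x (x ^+ k)%:E)%E.

Definition finite_moments
    (mu : {measure set (measurableTypeR R) -> \bar R}) : Prop :=
  forall k, mu.-integrable setT (fun x : R => (x ^+ k)%:E).

Definition determined_by_moments (mu : probability (measurableTypeR R) R)
    : Prop :=
  forall mu' : probability (measurableTypeR R) R,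
    finite_moments mu' ->
    (forall k, moment mu' k = moment mu k) ->
    forall B : set (measurableTypeR R), measurable B -> mu' B = mu B.

Record standard_density (p : R -> R) : Prop := StandardDensity {
  density_measurable : measurable_fun setT p;
  density_ge0 : forall x, 0 <= p x;
  density_mass : (\int[lebesgue_measure]_x (p x)%:E = 1)%E;
  density_mean : (\int[lebesgue_measure]_x (x * p x)%:E = 0)%E;
  density_variance : (\int[lebesgue_measure]_x (x ^+ 2 * p x)%:E = 1)%E;
  density_moments : forall k,
    lebesgue_measure.-integrable setT (fun x : R => (x ^+ k * p x)%:E)
}.

End Moments.

Section IndependentEntries.
Context {R : realType}.

Definition has_density d (T : measurableType d) (Pr : probability T R)
    (X : {RV Pr >-> R}) (p : R -> R) : Prop :=
  forall B : set R, measurable B ->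
    distribution Pr X B = (\int[lebesgue_measure]_(x in B) (p x)%:E)%E.

Definition mutually_independent d (T : measurableType d)
    (Pr : probability T R) (I : finType) (X : I -> {RV Pr >-> R}) : Prop :=
  forall (J : {set I}) (B : I -> set R), (forall i, measurable (B i)) ->
    Pr (\bigcap_(i in [set j | j \in J]) (X i @^-1` B i)) =
    (\prod_(i in J) Pr (X i @^-1` B i))%E.

(* A probability space carrying the i.i.d. variables x_{delta, d} from which
   the N x N matrix is built, with 0 <= delta <= N/2 and d one of nu letters. *)
Record entries (p : R -> R) (N nu : nat) := Entries {
  entries_disp : measure_display;
  entries_space : measurableType entries_disp;
  entries_prob : probability entries_space R;
  entry : 'I_(N./2).+1 * 'I_nu -> {RV entries_prob >-> R};
  entry_density : forall i, has_density (entry i) p;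
  entry_indep : mutually_independent entry
}.

End IndependentEntries.

(* Rows and columns are numbered from 0, so the slot i here is the slot i + 1
   of the usual numbering, and the pattern is extended by s |-> s mod m with
   its first letter at s = 0. The period m is written m.+1.
   For i, j < N, [upper N i j] is  0 <= j - i < N/2  or  i - j >= N/2; its
   negation is contained in  0 <= i - j < N/2  or  j - i >= N/2, the two
   alternatives overlapping only on i = j, where they agree. *)
Definition upper (N i j : nat) : bool :=
  (((i <= j) && ((j - i).*2 < N)) || ((j <= i) && (N <= (i - j).*2)))%N.

Definition delta (N i j : nat) : nat :=
  (if upper N i j then (j + N - i) %% N else (i + N - j) %% N)%N.

Definition slot (N i j : nat) : nat := if upper N i j then i else j.

Lemma delta_le (N i j : nat) : (i < N)%N -> (j < N)%N ->
  (delta N i j <= N./2)%N.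
Proof.
move=> iN jN; rewrite /delta /upper.
have modE a b : (a < N)%N -> (b < N)%N ->
    ((b + N - a) %% N = if a <= b then b - a else b + N - a)%N.
  move=> aN bN; case: leqP => [ab|ba]; last by rewrite modn_small //; lia.
  by rewrite addnC -addnBA // modnDl modn_small //; lia.
by rewrite !modE //; case: ifP; case: (leqP i j); case: (leqP j i); lia.
Qed.

Lemma delta_sym (N i j : nat) : (i < N)%N -> (j < N)%N ->
  delta N i j = delta N j i.
Proof.
move=> iN jN; rewrite /delta; case: (ltngtP i j) => [ij|ji|->] //.
- rewrite (_ : upper N j i = ~~ upper N i j); first by case: (upper N i j).
  by rewrite /upper; lia.
- rewrite (_ : upper N j i = ~~ upper N i j); first by case: (upper N i j).
  by rewrite /upper; lia.
Qed.

Lemma slot_sym (N i j : nat) : slot N i j = slot N j i.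
Proof.
rewrite /slot; case: (ltngtP i j) => [ij|ji|-> //].
- rewrite (_ : upper N j i = ~~ upper N i j); first by case: (upper N i j).
  by rewrite /upper; lia.
- rewrite (_ : upper N j i = ~~ upper N i j); first by case: (upper N i j).
  by rewrite /upper; lia.
Qed.

Definition letter (m nu : nat) (P : m.+1.-tuple 'I_nu) (s : nat) : 'I_nu :=
  tnth P (inZp s).

Section Ensemble.
Context {R : realType}.

Definition block_circulant (p : R -> R) (m nu N : nat)
    (P : m.+1.-tuple 'I_nu) (x : entries p N nu) (w : entries_space x)
    : 'M[R]_N :=
  \matrix_(i < N, j < N)
    entry x (inord (delta N i j), letter P (slot N i j)) w.

Lemma block_circulant_sym (p : R -> R) (m nu N : nat)
    (P : m.+1.-tuple 'I_nu) (x : entries p N nu) (w : entries_space x) :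
  (block_circulant P w)^T = block_circulant P w.
Proof. by apply/matrixP => i j; rewrite !mxE delta_sym // slot_sym. Qed.

(* The eigenvalues of A with multiplicity, in an arbitrary order; such a
   sequence exists whenever A is symmetric, and is then unique up to order. *)
Definition eigenvalues (N : nat) (A : 'M[R]_N) : seq R :=
  xget [::] [set s : seq R | char_poly A = \prod_(l <- s) ('X - l%:P)].

Definition spectral_measure (N : nat) (A : 'M[R]_N)
    : {measure set (measurableTypeR R) -> \bar R} :=
  mscale (N%:R^-1 : R)%:nng
    (msum (fun i => dirac ((eigenvalues A)`_i / Num.sqrt N%:R
                             : measurableTypeR R)) N).

Definition expected_moment (p : R -> R) (m nu N : nat)
    (P : m.+1.-tuple 'I_nu) (x : entries p N nu) (k : nat) : \bar R :=
  ('E_(entries_prob x)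
     [fun w => fine (moment (spectral_measure (block_circulant P w)) k)])%E.

Definition limiting_spectral_measure (p : R -> R) (m nu : nat)
    (P : m.+1.-tuple 'I_nu) (mu : probability (measurableTypeR R) R) : Prop :=
  [/\ finite_moments mu,
      determined_by_moments mu
    & forall (x : forall N, entries p N nu) (k : nat),
        expected_moment P (x (n * m.+1)%N) k @[n --> \oo] --> moment mu k].

End Ensemble.

Definition frequencies (m nu : nat) (P : m.+1.-tuple 'I_nu) : seq nat :=
  [seq count_mem d P | d <- enum 'I_nu].

(* (d_1, d_2, d_1, d_2) and (d_1, d_1, d_2, d_2), with d_1 = ord0 and
   d_2 = ord_max in 'I_2. *)
Definition pattern1212 : 4.-tuple 'I_2 :=
  [tuple ord0; ord_max; ord0; ord_max].
Definition pattern1122 : 4.-tuple 'I_2 :=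
  [tuple ord0; ord0; ord_max; ord_max].

(* Main.v *)
(** Expanding the trace, the k-th moment is a sum over closed walks on Z/N of
    products of entries. Up to O(N^-1/2), only walks whose steps are paired off
    with opposite signs contribute, and a pairing contributes 1 or 0 according
    to whether the letters seen by the two steps of every pair agree. Those
    letters depend only on the residues of the steps mod m and on the half of
    the circle containing them, which equidistribute; hence the limit moment is
    a finite count over pairings of [k]. There are at most 32^q q! pairings of
    [2q], so a measure with these moments integrates exp(c x^2) for some c > 0
    and is determined by them.
    The limit moments involve the density only through its moments 0, 1, 2, so
    they are also the limits for matrices of independent signs. Averaging over
    the signs gives finitely supported spectra, and Helly's selection theorem,
    applied to their quantile functions on [0, 1], produces the measure.
    The fourth moment is a function of the sum of the cubes of the frequencies;
    the sixth moments of the two patterns are compared by exact counting. *)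
Require Import Defs.
From HB Require Import structures.
From mathcomp Require Import all_boot all_order all_algebra.
From mathcomp Require Import all_classical all_reals all_analysis.
From mathcomp Require Import measurable_realfun.
From mathcomp Require Import zify ring lra.
Set Implicit Arguments.
Unset Strict Implicit.
Unset Printing Implicit Defensive.
Import Order.TTheory GRing.Theory Num.Theory.
Import numFieldNormedType.Exports.
Local Open Scope ring_scope.

(** * Walks, pairings and slots *)

(** A walk is recorded by its start and its steps, not by its vertices: a step determines its
    wrapped diagonal up to sign, so two factors of a product can involve the same variable only if
    their steps agree up to sign. What must be excluded is pairs of equal rather than opposite
    steps, larger classes and, for even N, the step N/2, which is its own opposite. All three force
    a repeated value, so it suffices to separate injective step sequences from the rest. A paired
    closed walk with a repeated value has at most floor((k-1)/2) free steps: a class of three or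
    more wastes one, and in a class of two equal steps the vanishing sum determines the double of
    the step. Against the normalization N^(k/2) this costs a factor 1/N for even k but only N^(-1/2)
    for odd k, whence the error rate. On injective sequences the expansion is exact, and the only
    other error is in the frequencies of the step types, each within 1/N of 1/(2m) when m denotes
    the period. *)

Definition walk_pos (V : zmodType) k (i : V) (s : {ffun 'I_k -> V}) (l : nat) : V :=
  i + \sum_(j < k | (j < l)%N) s j.

Lemma walk_pos0 (V : zmodType) k (i : V) (s : {ffun 'I_k -> V}) :
  walk_pos i s 0 = i.
Proof. by rewrite /walk_pos big_pred0 ?addr0. Qed.

Lemma walk_posS (V : zmodType) k (i : V) (s : {ffun 'I_k -> V}) (l : 'I_k) :
  walk_pos i s l.+1 = walk_pos i s l + s l.
Proof.
rewrite /walk_pos -addrA; congr (_ + _); rewrite (bigD1 l) //= addrC.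
by congr (_ + _); apply: eq_bigl => j; rewrite -val_eqE /=; lia.
Qed.

(** The wrapped diagonal of [A] at offset [t]. [A] is the sum of these matrices, so distributivity
    expands its powers over step sequences, and each product has at most one nonzero entry in every
    row. *)
Definition step_mx (R : comNzRingType) n (A : 'M[R]_n.+1) (t : 'I_n.+1) :
    'M[R]_n.+1 :=
  \matrix_(a, b) (A a b *+ (b == a + t)).

Lemma mul_step_mx (R : comNzRingType) n (A X : 'M[R]_n.+1) (c : R) i i0 t j :
  (forall h, X i h = c *+ (h == i0)) ->
  (X * step_mx A t) i j = (c * A i0 (i0 + t)) *+ (j == i0 + t).
Proof.
move=> XE; rewrite -[_ * _]/(_ *m _) mxE (bigD1 i0) //= big1 ?addr0 => [|h nh].
  rewrite XE eqxx mulr1n mxE mulrnAr.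
  by case: eqP => [->|]; rewrite ?mulr0n.
by rewrite XE (negPf nh) mulr0n mul0r.
Qed.

Lemma prod_step_mx (R : comNzRingType) n (A : 'M[R]_n.+1) (g : nat -> 'I_n.+1)
    k i j :
  (\prod_(l < k) step_mx A (g l)) i j =
  (\prod_(l < k) A (i + \sum_(h < l) g h) (i + \sum_(h < l.+1) g h))
    *+ (j == i + \sum_(h < k) g h).
Proof.
elim: k j => [|k IHk] j; first by rewrite !big_ord0 addr0 mxE eq_sym.
rewrite big_ord_recr /= (mul_step_mx A (g k) j IHk).
by rewrite !big_ord_recr /= addrA.
Qed.

Lemma mxtrace_exp_walk (R : comNzRingType) n (A : 'M[R]_n.+1) k :
  \tr (A ^+ k) = \sum_i \sum_(s : {ffun 'I_k -> 'I_n.+1} | \sum_l s l == 0)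
     \prod_(l < k) A (walk_pos i s l) (walk_pos i s l.+1).
Proof.
have AE : A = \sum_(t : 'I_n.+1) step_mx A t.
  apply/matrixP => a b; rewrite summxE (bigD1 (b - a)) //= big1 ?addr0.
    by rewrite mxE addrC subrK eqxx.
  move=> t nt; rewrite mxE; case: eqP => // bE.
  by rewrite bE addrC addKr eqxx in nt.
rewrite /mxtrace; apply: eq_bigr => i _.
rewrite -[in LHS](card_ord k) -prodr_const [in LHS]AE bigA_distr_bigA /= summxE.
rewrite [RHS]big_mkcond /=; apply: eq_bigr => s _.
(* Extended by 0 beyond k, because [prod_step_mx] proceeds by induction on the number of factors. *)
pose g (h : nat) := oapp s 0 (insub h : option 'I_k).
have gE (l : 'I_k) : g l = s l by rewrite /g valK.
rewrite (eq_bigr (fun l : 'I_k => step_mx A (g l))).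
  rewrite prod_step_mx; under [in RHS]eq_bigr => l _ do rewrite -gE.
  rewrite -subr_eq0 opprD addrA subrr add0r oppr_eq0.
  case: eqP => // _; rewrite mulr1n; apply: eq_bigr => l _; rewrite /walk_pos.
  have sumE h : (h <= k)%N -> \sum_(j < h) g j = \sum_(j < k | (j < h)%N) s j.
    move=> hk; rewrite (big_ord_widen _ g hk); apply: eq_bigr => t _.
    by rewrite gE.
  by rewrite !sumE // ltnW.
by move=> l _; rewrite gE.
Qed.

Definition pairing k (sg : {ffun 'I_k -> 'I_k}) : bool :=
  [forall l, (sg (sg l) == l) && (sg l != l)].

Lemma pairingK k (sg : {ffun 'I_k -> 'I_k}) : pairing sg -> involutive sg.
Proof. by move=> /forallP h l; have /andP[/eqP] := h l. Qed.

Lemma pairing_neq k (sg : {ffun 'I_k -> 'I_k}) l : pairing sg -> sg l != l.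
Proof. by move=> /forallP h; have /andP[] := h l. Qed.

Definition closers k (sg : {ffun 'I_k -> 'I_k}) : {set 'I_k} :=
  [set l | (sg l < l)%N].

Lemma card_closers k (sg : {ffun 'I_k -> 'I_k}) :
  pairing sg -> (#|closers sg|.*2 = k)%N.
Proof.
move=> pg; rewrite -addnn; transitivity #|'I_k|; last exact: card_ord.
rewrite -(cardsC (closers sg)).
congr (_ + _)%N; rewrite -(card_imset _ (inv_inj (pairingK pg))).
apply: eq_card => l; rewrite !inE; apply/imsetP/idP => [[h + ->]|].
  by rewrite inE pairingK //; lia.
move=> nl; exists (sg l); rewrite ?pairingK // inE pairingK //.
by have := pairing_neq l pg; rewrite -val_eqE /=; lia.
Qed.

(* Overwrites the closing step of each pair by the reverse of the opening one. *)
Definition pair_up (D : Type) (op : D -> D) k (sg : {ffun 'I_k -> 'I_k})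
    (y : {ffun 'I_k -> D}) : {ffun 'I_k -> D} :=
  [ffun l : 'I_k => if (l < sg l)%N then y l else op (y (sg l))].

Lemma pair_up_fixed (D : finType) (op : D -> D) k (sg : {ffun 'I_k -> 'I_k})
    (y : {ffun 'I_k -> D}) : involutive op -> pairing sg ->
  (pair_up op sg y == y) = [forall l, y (sg l) == op (y l)].
Proof.
move=> opK pg; apply/eqP/forallP => [<- l|h]; last first.
  apply/ffunP => l; rewrite ffunE; case: ifP => // _.
  by rewrite (eqP (h l)) opK.
rewrite !ffunE pairingK //; case: ltngtP; rewrite ?opK // => /val_inj e.
by case/eqP: (pairing_neq l pg).
Qed.

(** [pair_up] is a projection onto the sequences compatible with [sg], and its fibres leave the k/2
    closing entries free. It serves both for steps in Z/N and for step types. *)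
Lemma sum_pair_up (R : nzRingType) (D : finType) (op : D -> D) k
    (sg : {ffun 'I_k -> 'I_k}) (H : {ffun 'I_k -> D} -> R) :
    involutive op -> pairing sg ->
  \sum_y H (pair_up op sg y) =
  (#|D| ^ k./2)%:R * \sum_(y | pair_up op sg y == y) H y.
Proof.
move=> opK pg.
have ppE z : pair_up op sg (pair_up op sg z) = pair_up op sg z.
  apply/eqP; rewrite pair_up_fixed //; apply/forallP => l.
  rewrite !ffunE pairingK //; case: ltngtP; rewrite ?opK // => /val_inj e.
  by case/eqP: (pairing_neq l pg).
rewrite (partition_big (pair_up op sg) (fun y => pair_up op sg y == y)) /=;
  last by move=> z _; rewrite ppE.
rewrite mulr_sumr; apply: eq_bigr => y /eqP yfix.
rewrite (eq_bigr (fun=> H y)) => [|z /eqP -> //].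
rewrite sumr_const mulr_natl; congr (_ *+ _).
pose F (l : 'I_k) : {set D} := if (l < sg l)%N then [set y l] else [set: D].
have -> : #|[pred z | pair_up op sg z == y]| = #|family F|.
  apply: eq_card => z; rewrite [LHS]inE; apply/eqP/familyP => [e l|h].
    by rewrite /F; case: (ltnP l (sg l)) => lt; rewrite ?in_setT // -e ffunE lt set11.
  rewrite -yfix; apply/ffunP => l; rewrite !ffunE.
  case: (ltnP l (sg l)) => [lt|ge]; first by have := h l; rewrite /F lt => /set1P.
  have := h (sg l); rewrite /F pairingK //.
  have := pairing_neq l pg; rewrite -val_eqE /= => ne.
  by rewrite ifT; [move=> /set1P -> | lia].
rewrite card_family foldrE big_map big_enum /=.
rewrite (bigID (mem (closers sg))) /= [X in (_ * X)%N]big1 => [|l]; last first.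
  rewrite inE /F => nlt; rewrite ifT ?cards1 //.
  by have := pairing_neq l pg; rewrite -val_eqE /=; lia.
rewrite muln1 (eq_bigr (fun=> #|D|)) => [|l]; last first.
  by rewrite inE /F => lt; rewrite ifF ?cardsT //; lia.
rewrite prod_nat_const; congr (_ ^ _)%N.
by rewrite -[LHS]doubleK; congr _./2; exact: card_closers.
Qed.

(** Counting degrees of freedom: an element of [B] is determined by its code together with at most
    [d] of its values, at positions that the code names. *)
Lemma card_coded (I S T : finType) (x0 : S) (B : {set {ffun I -> S}})
    (code : {ffun I -> S} -> T) (D : T -> {set I}) d :
    (forall s, s \in B -> (#|D (code s)| <= d)%N) ->
    (forall s s', s \in B -> s' \in B -> code s = code s' ->
       {in D (code s), s =1 s'} -> s = s') ->
  (#|B| <= #|T| * #|S| ^ d)%N.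
Proof.
move=> cardD codeP; rewrite -sum1_card (partition_big code xpredT) //=.
rewrite -sum_nat_const; apply: leq_sum => t _; rewrite sum1_card.
have S0 : (0 < #|S|)%N by apply/card_gt0P; exists x0.
pose Bt := [set s in B | code s == t].
have -> : #|[pred s | (s \in B) && (code s == t)]| = #|Bt|.
  by apply: eq_card => s; rewrite !inE.
have [->|[s]] := finset.set_0Vmem Bt; first by rewrite cards0.
rewrite inE => /andP[sB /eqP st].
apply: (@leq_trans (#|S| ^ #|D t|)); last first.
  by apply: leq_pexp2l => //; rewrite -st cardD.
rewrite -cardsT -(card_pffun_on x0 (D t) [set: S]).
pose restr (s : {ffun I -> S}) := [ffun i => if i \in D t then s i else x0].
rewrite -(@card_in_imset _ _ restr) => [|s1 s2]; last first.
  rewrite !inE => /andP[s1B /eqP s1t] /andP[s2B /eqP s2t] /ffunP e.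
  apply: codeP => //; first by rewrite s1t s2t.
  by move=> i; rewrite s1t => iD; have := e i; rewrite !ffunE iD.
apply: subset_leq_card; apply/fintype.subsetP => _ /imsetP[s' _ ->].
apply/pffun_onP; split => [|y _]; last by rewrite inE.
by apply/fintype.subsetP => i; rewrite inE ffunE; case: ifP => //; rewrite eqxx.
Qed.

(** * Counting closed walks with a repeated step *)

Section ReversalClasses.
Variables (n k : nat).
Implicit Type s : {ffun 'I_k -> 'I_n.+1}.

(** By [arc_eq] this says that the two steps lie on the same diagonal of the symmetric matrix. *)
Definition eqpm (x y : 'I_n.+1) := (x == y) || (x == - y).

Lemma eqpm_refl x : eqpm x x. Proof. by rewrite /eqpm eqxx. Qed.

Lemma eqpm_sym x y : eqpm x y = eqpm y x.
Proof. by rewrite /eqpm eq_sym -eqr_oppLR [- x == y]eq_sym. Qed.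

Lemma eqpm_trans y x z : eqpm x y -> eqpm y z -> eqpm x z.
Proof.
by move=> /orP[]/eqP-> /orP[]/eqP->; rewrite /eqpm ?opprK ?eqxx ?orbT.
Qed.

(* The closed walks, negligible in number, on which pairing the steps by value
   is not one-to-one: some value occurs twice. *)
Definition irregular : {set {ffun 'I_k -> 'I_n.+1}} :=
  [set s : {ffun 'I_k -> 'I_n.+1} | [&& \sum_l s l == 0, ~~ injectiveb s &
    [forall l, [exists l', (l' != l) && eqpm (s l') (s l)]]]].

(** [pick] depends only on the class of [s l] as a set, so all members of a class get the same
    representative. *)
Definition rep s (l : 'I_k) : 'I_k := odflt l [pick l' | eqpm (s l') (s l)].

Lemma eqpm_rep s l : eqpm (s (rep s l)) (s l).
Proof.
rewrite /rep; case: pickP => [l' //|/(_ l)]; by rewrite eqpm_refl.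
Qed.

Lemma rep_eq s l l' : (rep s l == rep s l') = eqpm (s l) (s l').
Proof.
apply/eqP/idP => [e|ll'].
  apply: (@eqpm_trans (s (rep s l))); first by rewrite eqpm_sym eqpm_rep.
  by rewrite e eqpm_rep.
rewrite /rep (@eq_pick _ _ (fun j => eqpm (s j) (s l'))); last first.
  move=> j /=; apply/idP/idP => /eqpm_trans; first exact.
  by apply; rewrite eqpm_sym.
by case: pickP => // /(_ l'); rewrite eqpm_refl.
Qed.

(* A class of exactly two equal steps is recovered from the other steps, since
   the sum vanishes; together with classes of size at least 3 this saves one
   degree of freedom. *)
Definition crowded s (l : 'I_k) : bool :=
  [exists l', (l' != l) && (s l' == s l)] &&
  (#|[set j | eqpm (s j) (s l)]| <= 2)%N.

(* The third component makes halving in Z/(n+1) unambiguous. *)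
Definition irregular_code s :
    {ffun 'I_k -> 'I_k} * {ffun 'I_k -> bool} * {ffun 'I_k -> bool}
    * option 'I_k :=
  ([ffun l => rep s l], [ffun l => s l == s (rep s l)],
   [ffun l => (s l).*2 < n.+1]%N, [pick l | crowded s l]).

(** One position per class, except the class of the crowded step, whose value is solved from the
    vanishing sum. *)
Definition free_steps (c : {ffun 'I_k -> 'I_k} * {ffun 'I_k -> bool} *
    {ffun 'I_k -> bool} * option 'I_k) : {set 'I_k} :=
  let r := c.1.1.1 in
  [set r l | l in 'I_k] :\: (if c.2 is Some l then [set r l] else finset.set0).

(** The fibres other than that of [l0] have at least two elements each and, together with it, fill
    the k positions. *)
Lemma card_image_ge2 (r : {ffun 'I_k -> 'I_k}) (l0 : 'I_k) :
    (forall l, (2 <= #|[set j | r j == r l]|)%N) ->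
  (#|[set r l | l in 'I_k]|.*2 + #|[set j | r j == r l0]| <= k + 2)%N.
Proof.
move=> h; set Im := [set r l | l in 'I_k].
have inIm l : r l \in Im by apply/imsetP; exists l.
have fiber i : (\sum_(j : 'I_k | r j == i) 1 = #|[set j | r j == i]|)%N.
  by rewrite sum1_card; apply: eq_card => j; rewrite !inE.
have kE : (k = #|[set j | r j == r l0]| +
    \sum_(i in Im | i != r l0) #|[set j | r j == i]|)%N.
  transitivity (\sum_(i in Im) #|[set j | r j == i]|)%N; last first.
    by rewrite (bigD1 (r l0)).
  rewrite -[LHS]card_ord -sum1_card (partition_big r (mem Im)) //=.
  by apply: eq_bigr => i _; exact: fiber.
have imE : (#|Im| = (\sum_(i in Im | i != r l0) 1).+1)%N.
  by rewrite -sum1_card (bigD1 (r l0)).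
have le2 : (\sum_(i in Im | i != r l0) 2 <=
    \sum_(i in Im | i != r l0) #|[set j | r j == i]|)%N.
  by apply: leq_sum => i /andP[/imsetP[l _ ->] _]; exact: h.
have sum2 : (\sum_(i in Im | i != r l0) 2 = (\sum_(i in Im | i != r l0) 1).*2)%N.
  by rewrite -muln2 big_distrl.
move: le2 kE; rewrite sum2 imE.
by move: (\sum_(i in Im | i != r l0) 1)%N (\sum_(i in Im | _) _)%N; lia.
Qed.

(** For even n+1 the elements x and x + (n+1)/2 have the same double, but they lie in different
    halves. *)
Lemma double_half_inj (x y : 'I_n.+1) : x + x = y + y ->
  (x.*2 < n.+1)%N = (y.*2 < n.+1)%N -> x = y.
Proof.
move=> /(congr1 val) /= e h; apply: val_inj => /=.
have := ltn_ord x; have := ltn_ord y; move: e h.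
case: (ltnP (x + x) n.+1) => hx; case: (ltnP (y + y) n.+1) => hy.
- by rewrite !modn_small //; lia.
- by lia.
- by lia.
rewrite -[(x + x)%N](subnK hx) -[(y + y)%N](subnK hy) !modnDr.
by move=> + _ ? ?; rewrite !modn_small; lia.
Qed.

Lemma card_irregular :
  (#|irregular| <=
   #|{: {ffun 'I_k -> 'I_k} * {ffun 'I_k -> bool} * {ffun 'I_k -> bool}
        * option 'I_k}| * n.+1 ^ k.-1./2)%N.
Proof.
have -> : (n.+1 ^ k.-1./2 = #|'I_n.+1| ^ k.-1./2)%N by rewrite card_ord.
have rE s l : (irregular_code s).1.1.1 l = rep s l by rewrite ffunE.
have cl s l : [set j | (irregular_code s).1.1.1 j == (irregular_code s).1.1.1 l]
    = [set j | eqpm (s j) (s l)].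
  by apply/setP => j; rewrite !inE !rE rep_eq.
apply: (@card_coded _ _ _ 0 _ irregular_code free_steps) => [s|s s'].
  rewrite inE => /and3P[_ ninj /forallP pm].
  have h2 l : (2 <= #|[set j | (irregular_code s).1.1.1 j ==
                               (irregular_code s).1.1.1 l]|)%N.
    rewrite cl; have /existsP[l' /andP[ll' e]] := pm l.
    rewrite (cardD1 l) (cardD1 l') !inE eqpm_refl ll' e //.
  (* Of at most k/2 classes, a crowded one is not free. If none is crowded, the repeated value lies
     in a class of at least three, so there are at most (k-1)/2 classes. *)
  rewrite /free_steps; case E: (irregular_code s).2 => [l0|].
    have := card_image_ge2 l0 h2; have := h2 l0.
    rewrite [X in _ -> _ -> (X <= _)%N](_ : _ =
      #|[set (irregular_code s).1.1.1 l | l in 'I_k]|.-1)%N; first by lia.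
    have := cardsD1 ((irregular_code s).1.1.1 l0)
      [set (irregular_code s).1.1.1 l | l in 'I_k].
    by rewrite imset_f // => ->.
  rewrite finset.setD0; move: ninj => /injectivePn[l0 [l1 ne e]].
  have arith a b : (a.*2 + b <= k + 2 -> 2 < b -> a <= k.-1./2)%N by lia.
  apply: arith (card_image_ge2 l0 h2) _; rewrite cl.
  rewrite ltnNge; apply/negP => small; move: E; rewrite /irregular_code /=.
  case: pickP => // /(_ l0) /negP[]; rewrite /crowded small andbT.
  by apply/existsP; exists l1; rewrite eq_sym ne e eqxx.
rewrite !inE => /and3P[/eqP s0 _ _] /and3P[/eqP s'0 _ _] e.
have rr l : rep s' l = rep s l by rewrite -!rE e.
have gg l : (s l == s (rep s l)) = (s' l == s' (rep s' l)).
  have : (irregular_code s).1.1.2 l = (irregular_code s').1.1.2 l by rewrite e.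
  by rewrite !ffunE.
have hh l : ((s l).*2 < n.+1 = ((s' l).*2 < n.+1))%N.
  have : (irregular_code s).1.2 l = (irregular_code s').1.2 l by rewrite e.
  by rewrite !ffunE.
move=> agree.
(* The second component of the code tells whether a step equals its representative or is the
   opposite of it. *)
have agree_class j : rep s j \in free_steps (irregular_code s) -> s j = s' j.
  move=> /agree er; have := gg j; rewrite rr -er.
  have := eqpm_rep s j; have := eqpm_rep s' j; rewrite rr -er eqpm_sym => hs'.
  rewrite eqpm_sym => hs.
  case: eqP hs hs' => [-> _|ne]; first by move=> _ /esym/eqP ->.
  rewrite /eqpm => /orP[/eqP//|/eqP->] /orP[-> //|/eqP->] //.
have inD j : ((irregular_code s).2 = None) \/
   (exists2 l, (irregular_code s).2 = Some l & ~~ eqpm (s j) (s l)) ->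
   rep s j \in free_steps (irregular_code s).
  rewrite /free_steps finset.in_setD -(rE s j) imset_f // andbT => -[->|[l ->]].
    by rewrite finset.in_set0.
  by rewrite finset.in_set1 !rE rep_eq.
case E: (irregular_code s).2 => [l|]; last first.
  by apply/ffunP => j; apply: agree_class; apply: inD; left.
have E' : (irregular_code s').2 = Some l by rewrite -e.
have crowd t : (irregular_code t).2 = Some l -> crowded t l.
  by rewrite /=; case: pickP => // x cx [<-].
have /andP[/existsP[l' /andP[ne /eqP e1]] c1] := crowd _ E.
have /andP[/existsP[l2 /andP[ne2 /eqP e2]] c2] := crowd _ E'.
have two j : eqpm (s j) (s l) -> j != l -> j = l'.
  move=> ej nj; apply/eqP/negPn/negP => nj'; move: c1; apply/negP.
  rewrite -ltnNge (cardD1 l) (cardD1 l') (cardD1 j) !inE eqpm_refl ne e1.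
  by rewrite eqpm_refl nj nj' ej.
have l2E : l2 = l'.
  by apply: two => //; rewrite -rep_eq -!rr rep_eq e2 eqpm_refl.
rewrite {}l2E in ne2 e2.
have out j : j != l -> j != l' -> s j = s' j.
  move=> jl jl'; apply: agree_class; apply: inD; right; exists l => //.
  by apply/negP => /two /(_ jl) jE; rewrite jE eqxx in jl'.
(* The two equal steps of the crowded class contribute twice their value to the vanishing sum. *)
have sum2 t : t l' = t l -> \sum_i t i = 0 ->
    t l + t l = - \sum_(i | (i != l) && (i != l')) t i :> 'I_n.+1.
  move=> te; rewrite (bigD1 l) //= (bigD1 l') //= te addrA => /eqP.
  by rewrite addr_eq0 => /eqP.
have ll : s l = s' l.
  apply: double_half_inj (hh l); rewrite !sum2 //; congr (- _).
  by apply: eq_bigr => i /andP[]; exact: out.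
apply/ffunP => j; have [->//|jl] := eqVneq j l.
by have [->|jl'] := eqVneq j l'; rewrite ?e1 ?e2 // out.
Qed.

End ReversalClasses.

(** * Step types and the limit moments *)

Section Model.
Variables (m nu : nat) (P : m.+1.-tuple 'I_nu).

(** The effect of negating a step on its type. Negation swaps the halves of the circle, except at
    steps equal to their opposite; see [step_typeN]. *)
Definition rev_step (x : 'I_m.+1 * bool) : 'I_m.+1 * bool := (- x.1, ~~ x.2).

Lemma rev_stepK : involutive rev_step.
Proof. by case=> r u; rewrite /rev_step /= opprK negbK. Qed.

(* The Boolean of a step tells whether it lies in the first half of the circle,
   in which case the slot is the start of the step, and otherwise its end. *)
Definition model_slot k (a : 'I_m.+1) (y : {ffun 'I_k -> 'I_m.+1 * bool})
    (l : 'I_k) : 'I_m.+1 :=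
  walk_pos a [ffun j => (y j).1] (if (y l).2 then l : nat else l.+1).

Definition letters_match k (sg : {ffun 'I_k -> 'I_k}) (a : 'I_m.+1)
    (y : {ffun 'I_k -> 'I_m.+1 * bool}) : bool :=
  [forall l, tnth P (model_slot a y (sg l)) == tnth P (model_slot a y l)].

(* The steps of a walk enter only through their residues mod the period and
   through which half of the circle they belong to; both equidistribute. *)
Definition limit_moment (R : realFieldType) k : R :=
  \sum_(sg : {ffun 'I_k -> 'I_k} | pairing sg)
    (\sum_a \sum_y (letters_match sg a (pair_up rev_step sg y))%:R) /
    (m.+1 * (m.+1).*2 ^ k)%:R.

End Model.

Section Walks.
Variables (m nu : nat) (P : m.+1.-tuple 'I_nu) (n : nat).

Definition edge_var (i j : 'I_n.+1) : 'I_(n.+1./2).+1 * 'I_nu :=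
  (inord (delta n.+1 i j), letter P (slot n.+1 i j)).

Definition walk_var k (i : 'I_n.+1) (s : {ffun 'I_k -> 'I_n.+1}) (l : 'I_k) :=
  edge_var (walk_pos i s l) (walk_pos i s l.+1).

(** The distance from 0 on the circle Z/(n+1). *)
Definition arc (x : 'I_n.+1) : nat := if (x.*2 < n.+1)%N then x : nat else (n.+1 - x)%N.

Lemma val_sub_ord (i j : 'I_n.+1) :
  nat_of_ord (j - i) = (if i <= j then j - i else j + n.+1 - i)%N.
Proof.
rewrite /= modnDmr addnBA ?(ltnW (ltn_ord i)) //.
have := ltn_ord i; have := ltn_ord j; move: (val i) (val j) => a b hb ha.
case: leqP => [ab|ba]; last by rewrite modn_small //; lia.
by rewrite addnC -addnBA // modnDl modn_small //; lia.
Qed.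

Lemma val_opp_ord (x : 'I_n.+1) :
  nat_of_ord (- x) = if x == 0 then 0%N else (n.+1 - x)%N.
Proof.
rewrite -[- x]add0r val_sub_ord -val_eqE /= leqn0 add0n.
by case: ifP => // /eqP ->.
Qed.

Lemma eq_nat_of_ord (x y : 'I_n.+1) : (x == y) = (nat_of_ord x == nat_of_ord y).
Proof. by []. Qed.

Lemma delta_arc (i j : 'I_n.+1) : delta n.+1 i j = arc (j - i).
Proof.
have modE (a b : 'I_n.+1) : ((b + n.+1 - a) %% n.+1 = nat_of_ord (b - a)%R)%N.
  by rewrite /= modnDmr addnBA // ltnW.
rewrite /delta /arc !modE !val_sub_ord /upper.
have := ltn_ord i; have := ltn_ord j; move: (val i) (val j) => a b.
by case: (leqP a b); case: (leqP b a); repeat case: ifP; lia.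
Qed.

Lemma arc_eq (x y : 'I_n.+1) : (arc x == arc y) = eqpm x y.
Proof.
rewrite /eqpm !eq_nat_of_ord val_opp_ord /arc eq_nat_of_ord /=.
have := ltn_ord x; have := ltn_ord y; move: (val x) (val y) => a b.
by repeat case: ifP; lia.
Qed.

(** The hypothesis excludes the differences 0 and (n+1)/2. At the latter, [upper] depends on the
    order of [i] and [j] and not on the difference alone. *)
Lemma upper_half (i j : 'I_n.+1) : j - i != - (j - i) ->
  upper n.+1 i j = ((nat_of_ord (j - i)%R).*2 < n.+1)%N.
Proof.
rewrite eq_nat_of_ord val_opp_ord eq_nat_of_ord val_sub_ord /upper [nat_of_ord 0]/=.
have := ltn_ord i; have := ltn_ord j; move: (val i) (val j) => a b.
by case: (leqP a b); case: (leqP b a); repeat case: ifP; lia.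
Qed.

Lemma edge_var1_eq (i j i' j' : 'I_n.+1) :
  ((edge_var i j).1 == (edge_var i' j').1) = eqpm (j - i) (j' - i').
Proof.
by rewrite -arc_eq -!delta_arc -val_eqE /= !inordK // ltnS delta_le.
Qed.

Definition residue (x : 'I_n.+1) : 'I_m.+1 := inZp x.

Lemma walk_var1_eq k i (s : {ffun 'I_k -> 'I_n.+1}) l l' :
  ((walk_var i s l).1 == (walk_var i s l').1) = eqpm (s l) (s l').
Proof. by rewrite edge_var1_eq !walk_posS ![_ + s _]addrC !addrK. Qed.

Hypothesis dvd_m : (m.+1 %| n.+1)%N.

Lemma residueD : {morph residue : x y / x + y}.
Proof.
move=> x y; apply: val_inj => /=.
by rewrite modn_dvdm // modnDm.
Qed.

Lemma residue0 : residue 0 = 0.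
Proof. by apply: val_inj; rewrite /= mod0n. Qed.

Lemma residueN : {morph residue : x / - x}.
Proof.
by move=> x; apply/eqP; rewrite -addr_eq0 -residueD addNr residue0.
Qed.

Lemma residue_walk k (i : 'I_n.+1) (s : {ffun 'I_k -> 'I_n.+1}) l :
  residue (walk_pos i s l) = walk_pos (residue i) [ffun j => residue (s j)] l.
Proof.
rewrite /walk_pos residueD (big_morph _ residueD residue0).
by congr (_ + _); apply: eq_bigr => j _; rewrite ffunE.
Qed.

Definition step_type (x : 'I_n.+1) : 'I_m.+1 * bool :=
  (residue x, (x.*2 < n.+1)%N).

Definition step_types k (s : {ffun 'I_k -> 'I_n.+1}) :
  {ffun 'I_k -> 'I_m.+1 * bool} := [ffun l => step_type (s l)].

Lemma step_typeN x : x != - x -> step_type (- x) = rev_step (step_type x).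
Proof.
move=> xN; rewrite /step_type residueN val_opp_ord; congr (_, _).
move: xN; rewrite [x == - x]eq_nat_of_ord val_opp_ord.
rewrite eq_nat_of_ord [nat_of_ord 0]/=.
rewrite /=; move: (ltn_ord x); move: (nat_of_ord x) => a ha.
by case: ifP; lia.
Qed.

Lemma walk_var2E k i (s : {ffun 'I_k -> 'I_n.+1}) l : s l != - s l ->
  (walk_var i s l).2 = tnth P (model_slot (residue i) (step_types s) l).
Proof.
move=> sN.
transitivity (letter P (slot n.+1 (walk_pos i s l) (walk_pos i s l.+1))) => //.
have dE : walk_pos i s l.+1 - walk_pos i s l = s l.
  by rewrite walk_posS [_ + s l]addrC addrK.
rewrite /letter /slot upper_half dE //; congr (tnth P _).
rewrite /model_slot ffunE [(step_type _).2]/=.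
have -> : [ffun j => (step_types s j).1] = [ffun j => residue (s j)].
  by apply/ffunP => j; rewrite !ffunE.
by case: ifP => _; rewrite -residue_walk.
Qed.

End Walks.

(** * Expected products of entries for an abstract moment sequence *)

Section Weights.
Variables (R : realFieldType) (al : nat -> R).
Hypotheses (al0 : al 0 = 1) (al1 : al 1 = 0) (al2 : al 2 = 1).

Definition mult (I V : finType) (v : I -> V) (x : V) := #|[set l | v l == x]|.

(** The expectation of a product of independent variables, the one of index [v l] for each [l], when
    they have moments [al]. It is used with the moments of the density and with those of a random
    sign. *)
Definition weight (I V : finType) (v : I -> V) : R := \prod_x al (mult v x).

Lemma sum_mult (I V : finType) (v : I -> V) : (\sum_x mult v x = #|I|)%N.
Proof.
rewrite -sum1_card (partition_big v xpredT) //=; apply: eq_bigr => x _.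
by rewrite /mult -sum1_card; apply: eq_bigl => l; rewrite inE.
Qed.

(** The base is at least 1 and bounds every |al j| that occurs, so a value of multiplicity j > 0
    costs at most its j-th power; the multiplicities add up to |I|. *)
Lemma weight_bound (I V : finType) (v : I -> V) :
  `|weight v| <= (1 + \sum_(j < #|I|.+1) `|al j|) ^+ #|I|.
Proof.
set B := 1 + _.
have B1 : 1 <= B by rewrite lerDl sumr_ge0.
rewrite /weight normr_prod -[X in _ ^+ X](sum_mult v).
rewrite (big_morph (fun j => B ^+ j) (id1 := 1) (op1 := *%R)) //=; last first.
  by move=> a b; rewrite exprD.
apply: ler_prod => x _; rewrite normr_ge0 /=.
have mI : (mult v x <= #|I|)%N by rewrite max_card.
case: (posnP (mult v x)) => [->|m0]; first by rewrite al0 normr1.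
apply: (@le_trans _ _ B); last by rewrite -{1}(expr1 B) ler_weXn2l.
rewrite /B (bigD1 (Ordinal (mI : mult v x < #|I|.+1)%N)) //= addrCA lerDl.
by rewrite addr_ge0 // sumr_ge0.
Qed.

Lemma weight_single (I V : finType) (v : I -> V) l :
  (forall l', v l' = v l -> l' = l) -> weight v = 0.
Proof.
move=> h; rewrite /weight (bigD1 (v l)) //= [mult _ _](_ : _ = 1%N).
  by rewrite al1 mul0r.
rewrite /mult -(cards1 l); congr #|pred_of_set _|; apply/setP => l'.
by rewrite !inE; apply/eqP/eqP => [/h //|->].
Qed.

Lemma weight_paired (I V : finType) (v : I -> V) (sg : I -> I) :
    (forall l, sg l != l) -> (forall l l', (v l' == v l) = (l' == l) || (l' == sg l)) ->
  weight v = 1.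
Proof.
move=> sgn h; rewrite /weight big1 // => x _.
case: (pickP [pred l | v l == x]) => [l /eqP <-|no].
  rewrite (_ : mult _ _ = 2%N) // /mult -[RHS](_ : #|[set l; sg l]| = 2%N).
    by congr #|pred_of_set _|; apply/setP => l'; rewrite !inE h.
  by rewrite cards2 eq_sym sgn.
rewrite (_ : mult _ _ = 0%N) // /mult; apply: eq_card0 => l.
by rewrite inE; have /= := no l.
Qed.

Variables (m nu : nat) (P : m.+1.-tuple 'I_nu) (n : nat).
Hypothesis dvd_m : (m.+1 %| n.+1)%N.
Variable k : nat.
Implicit Type s : {ffun 'I_k -> 'I_n.+1}.

(** A substitute for the weight which sums over all pairings that oppose steps of [s]. Being a sum,
    it can later be exchanged with the sum over walks, so that the pairing is fixed first. *)
Definition match_count (i : 'I_n.+1) s : R :=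
  \sum_(sg : {ffun 'I_k -> 'I_k} | pairing sg && [forall l, s (sg l) == - s l])
   (letters_match P sg (residue m i)
      (pair_up (@rev_step m) sg (step_types m s)))%:R.

Definition paired s := [forall l, [exists l', (l' != l) && eqpm (s l') (s l)]].

Lemma weight_unpaired i s : ~~ paired s -> weight (walk_var P i s) = 0.
Proof.
rewrite negb_forall => /existsP[l /existsPn h]; apply: (@weight_single _ _ _ l).
move=> l' /(congr1 fst)/eqP; rewrite walk_var1_eq => e.
by have := h l'; rewrite e andbT negbK => /eqP.
Qed.

Lemma match_count_unpaired i s : ~~ paired s -> match_count i s = 0.
Proof.
move=> ns; rewrite /match_count big_pred0 // => sg; apply: contraNF ns.
move=> /andP[pg /forallP h]; apply/forallP => l; apply/existsP; exists (sg l).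
by rewrite pairing_neq //= /eqpm (eqP (h l)) eqxx orbT.
Qed.

(** As no value repeats, the partner of a step carries the opposite value and is unique. Hence at
    most one pairing exists, and every variable occurs exactly twice or, when some letters disagree,
    one of them occurs once and has mean 0. *)
Lemma weight_regular i s : injective s -> weight (walk_var P i s) = match_count i s.
Proof.
move=> sinj; case: (boolP (paired s)) => [ps|ns]; last first.
  by rewrite weight_unpaired // match_count_unpaired.
have ex l : exists l', (l' != l) && (s l' == - s l).
  have /existsP[l' /andP[ne /orP[/eqP/sinj e|e]]] := forallP ps l.
    by rewrite e eqxx in ne.
  by exists l'; rewrite ne.
have [sg sgP] : exists sg : {ffun 'I_k -> 'I_k},
    forall l, (sg l != l) && (s (sg l) == - s l).
  by exists [ffun l => xchoose (ex l)] => l; rewrite ffunE; exact: (xchooseP (ex l)).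
have sgs l : s (sg l) = - s l by have /andP[_ /eqP] := sgP l.
have sgn l : sg l != l by have /andP[] := sgP l.
have pg : pairing sg.
  by apply/forallP => l; rewrite sgn andbT; apply/eqP/sinj; rewrite !sgs opprK.
(* A step equal to its opposite would share its value with its partner, against injectivity. *)
have sN l : s l != - s l.
  by rewrite -sgs; apply: contraNneq (sgn l) => /sinj e; rewrite -e.
rewrite /match_count (big_pred1 sg) => [|tau]; last first.
  apply/andP/eqP => [[_ /forallP h]|->]; last first.
    by split=> //; apply/forallP => l; rewrite sgs.
  by apply/ffunP => l; apply: sinj; rewrite (eqP (h l)) sgs.
have -> : pair_up (@rev_step m) sg (step_types m s) = step_types m s.
  apply/eqP; rewrite pair_up_fixed //; last exact: rev_stepK.
  by apply/forallP => l; rewrite !ffunE sgs step_typeN.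
have vE l l' : (walk_var P i s l' == walk_var P i s l) =
    (l' == l) || (l' == sg l) && ((walk_var P i s l').2 == (walk_var P i s l).2).
  rewrite -pair_eqE /pair_eq walk_var1_eq /eqpm -sgs !(inj_eq sinj).
  by case: (eqVneq l' l) => [->|]; rewrite //= eqxx.
case: (boolP (letters_match _ _ _ _)) => [/forallP mt|].
  apply: (@weight_paired _ _ _ sg) => // l l'.
  rewrite vE; case: (eqVneq l' (sg l)) => [->|_]; last by rewrite andFb.
  by rewrite andTb !walk_var2E // mt.
rewrite negb_forall => /existsP[l nl]; apply: (@weight_single _ _ _ l) => l' /eqP.
rewrite vE => /orP[/eqP //|/andP[/eqP -> ]].
by rewrite !walk_var2E // (negPf nl).
Qed.

Lemma match_count_bound i s : `|match_count i s| <= #|{: {ffun 'I_k -> 'I_k}}|%:R.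
Proof.
rewrite /match_count big_mkcond /= (le_trans (ler_norm_sum _ _ _)) //.
rewrite -sumr_const ler_sum // => sg _; case: ifP => _; rewrite ?normr0 //.
by case: letters_match; rewrite ?normr1 ?normr0.
Qed.

Lemma weight_match_diff i s : \sum_l s l = 0 ->
  `|weight (walk_var P i s) - match_count i s| <=
  ((1 + \sum_(j < k.+1) `|al j|) ^+ k + #|{: {ffun 'I_k -> 'I_k}}|%:R)
    *+ (s \in irregular n k).
Proof.
move=> s0; rewrite inE s0 eqxx /= -/(paired s).
case: injectiveP => [sinj|_] /=; first by rewrite weight_regular // subrr normr0.
case: (boolP (paired s)) => [ps|ns]; last first.
  by rewrite weight_unpaired // match_count_unpaired // subrr normr0.
rewrite mulr1n (le_trans (ler_normB _ _)) // lerD // ?match_count_bound //.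
by have := weight_bound (walk_var P i s); rewrite card_ord.
Qed.

End Weights.

(** * Equidistribution of residues and halves *)

Lemma sum_nat_blocks (F : nat -> nat) t d :
  (\sum_(x < t * d) F x = \sum_(q < t) \sum_(r < d) F (q * d + r))%N.
Proof.
elim: t => [|t IHt]; first by rewrite mul0n !big_ord0.
by rewrite mulSnr big_split_ord big_ord_recr /= -IHt.
Qed.

Lemma sum_nat_lt t c : (\sum_(q < t) (q < c) = minn c t)%N.
Proof. by elim: t => [|t IHt]; rewrite ?big_ord0 ?big_ord_recr /= ?IHt; lia. Qed.

Section Equidistribution.
Variables (m n : nat).
Hypothesis dvd_m : (m.+1 %| n.+1)%N.

Lemma card_step_type (r : 'I_m.+1) (u : bool) (t : nat) : n.+1 = (t * m.+1)%N ->
  #|[set z : 'I_n.+1 | step_type m z == (r, u)]| =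
  (\sum_(q < t) (((q * m.+1 + r).*2 < n.+1) == u))%N.
Proof.
move=> nE; rewrite -sum1_card.
transitivity (\sum_(z < n.+1) ((z %% m.+1 == r) && ((z.*2 < n.+1) == u)))%N.
  rewrite big_mkcond /=; apply: eq_bigr => z _.
  by rewrite inE /step_type xpair_eqE -val_eqE /=; case: andP => //; case: ifP.
have nEs (F : nat -> nat) : (\sum_(z < n.+1) F z = \sum_(z < t * m.+1) F z)%N.
  by rewrite nE.
rewrite (nEs (fun z => (z %% m.+1 == r) && ((z.*2 < n.+1) == u) : nat)%N).
rewrite (sum_nat_blocks (fun z => (z %% m.+1 == r) && ((z.*2 < n.+1) == u) : nat)%N).
apply: eq_bigr => q _; rewrite (bigD1 r) //= big1 ?addn0 => [|x xr].
  by rewrite modnMDl modn_small // eqxx.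
by rewrite modnMDl modn_small // (negPf (_ : x != r :> nat)).
Qed.

Lemma card_residue (r : 'I_m.+1) (t : nat) : n.+1 = (t * m.+1)%N ->
  #|[set z : 'I_n.+1 | residue m z == r]| = t.
Proof.
move=> nE; rewrite -sum1_card.
transitivity (\sum_(z < n.+1) (z %% m.+1 == r))%N.
  rewrite big_mkcond /=; apply: eq_bigr => z _.
  by rewrite inE -val_eqE /=; case: ifP.
have nEs (F : nat -> nat) : (\sum_(z < n.+1) F z = \sum_(z < t * m.+1) F z)%N.
  by rewrite nE.
rewrite (nEs (fun z => z %% m.+1 == r : nat)%N) (sum_nat_blocks (fun z => z %% m.+1 == r : nat)%N).
rewrite -[RHS]card_ord -sum1_card.
apply: eq_bigr => q _; rewrite (bigD1 r) //= big1 ?addn0 => [|x xr].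
  by rewrite modnMDl modn_small // eqxx.
by rewrite modnMDl modn_small // (negPf (_ : x != r :> nat)).
Qed.

(** With t = N/m for the period m, the element q m + r lies in the first half if q < floor(t/2) and
    in the second if q >= ceil(t/2), whatever r is; hence twice the count differs from t by at most
    1. *)
Lemma card_step_type_bounds (x : 'I_m.+1 * bool) :
  (n.+1 %/ m.+1 <= #|[set z : 'I_n.+1 | step_type m z == x]|.*2.+1)%N /\
  (#|[set z : 'I_n.+1 | step_type m z == x]|.*2 <= (n.+1 %/ m.+1).+1)%N.
Proof.
set t := (n.+1 %/ m.+1)%N; have nE : n.+1 = (t * m.+1)%N by rewrite divnK.
case: x => r u; rewrite (card_step_type r u nE).
have lo : (t./2 <= \sum_(q < t) ((q * m.+1 + r).*2 < n.+1))%N.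
  have -> : (t./2 = \sum_(q < t) (q < t./2))%N by rewrite sum_nat_lt; lia.
  apply: leq_sum => q _; case: ltnP => // qt; rewrite lt0b nE.
  have := ltn_ord r; have : (q.+1.*2 * m.+1 <= t * m.+1)%N by rewrite leq_mul2r; lia.
  by rewrite -!muln2; nia.
have hi : (\sum_(q < t) ((q * m.+1 + r).*2 < n.+1) <= uphalf t)%N.
  have -> : (uphalf t = \sum_(q < t) (q < uphalf t))%N by rewrite sum_nat_lt; lia.
  apply: leq_sum => q _; case: (ltnP q) => [|qt]; first by rewrite leq_b1.
  rewrite leqn0 eqb0 -leqNgt nE.
  have : (t * m.+1 <= q.*2 * m.+1)%N by rewrite leq_mul2r; lia.
  by rewrite -!muln2; nia.
case: u.
  have -> : (\sum_(q < t) (((q * m.+1 + r).*2 < n.+1) == true) =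
             \sum_(q < t) ((q * m.+1 + r).*2 < n.+1))%N.
    by apply: eq_bigr => q _; rewrite eqb_id.
  by move: lo hi; set S := (\sum_(q < t) _)%N; lia.
have : (\sum_(q < t) (((q * m.+1 + r).*2 < n.+1) == false) +
        \sum_(q < t) ((q * m.+1 + r).*2 < n.+1) = t)%N.
  rewrite -big_split /= -[RHS]card_ord -sum1_card.
  by apply: eq_bigr => q _; case: (_ < _)%N.
move: lo hi; set S := (\sum_(q < t) (_ < _))%N; set S' := (\sum_(q < t) _)%N.
by lia.
Qed.

Lemma step_type_freq (R : realFieldType) (x : 'I_m.+1 * bool) :
  `|#|[set z : 'I_n.+1 | step_type m z == x]|%:R / n.+1%:R
     - ((m.+1).*2)%:R^-1| <= (n.+1%:R^-1 : R).
Proof.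
have [lo hi] := card_step_type_bounds x.
move: lo hi; set c := #|_|; set t := (_ %/ _)%N.
have -> : n.+1 = (t * m.+1)%N by rewrite divnK.
move=> lo hi.
have t0 : (0 < t)%N by rewrite divn_gt0 // dvdn_leq.
have tR : (0 : R) < t%:R by rewrite ltr0n.
have dR : (0 : R) < m.+1%:R by rewrite ltr0n.
have loR : t%:R <= c%:R *+ 2 + 1 :> R.
  by rewrite -mulrnA muln2 natr1 ler_nat.
have hiR : c%:R *+ 2 <= t%:R + 1 :> R.
  by rewrite -mulrnA muln2 natr1 ler_nat.
rewrite -muln2 !natrM.
have -> : c%:R / (t%:R * m.+1%:R) - (m.+1%:R * 2)^-1 =
    (c%:R *+ 2 - t%:R) / 2 / (t%:R * m.+1%:R) :> R.
  by field; rewrite !gt_eqF.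
have TD : 0 <= (t%:R * m.+1%:R)^-1 :> R by rewrite invr_ge0 mulr_ge0 // ltW.
rewrite normrM (ger0_norm TD) -[leRHS]mul1r ler_wpM2r // ler_norml.
by apply/andP; split; lra.
Qed.

End Equidistribution.

Lemma prodr_dist (R : realFieldType) (I : Type) (r : seq I) (x : I -> R) (c e : R) :
    (forall l, 0 <= x l <= 1) -> 0 <= c <= 1 -> (forall l, `|x l - c| <= e) ->
  `|\prod_(l <- r) x l - c ^+ size r| <= e *+ size r.
Proof.
move=> x01 /andP[c0 c1] xc; elim: r => [|l r IHr].
  by rewrite big_nil expr0 subrr normr0.
rewrite big_cons /= exprS mulrS.
have -> : x l * \prod_(j <- r) x j - c * c ^+ size r =
  (x l - c) * c ^+ size r + x l * (\prod_(j <- r) x j - c ^+ size r) by ring.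
apply: le_trans (ler_normD _ _) _; rewrite !normrM; apply: lerD.
  rewrite -[leRHS]mulr1 ler_pM // ger0_norm ?exprn_ge0 //.
  by rewrite exprn_ile1.
have /andP[xl0 xl1] := x01 l.
by rewrite -[leRHS]mul1r ler_pM // ger0_norm.
Qed.

(** * Walks compatible with a fixed pairing *)

Section WalkSums.
Variables (m nu : nat) (P : m.+1.-tuple 'I_nu) (n k : nat).

(** Both sides read only the opening steps, which [pair_up] leaves alone. So steps equal to their
    opposite need no separate treatment here. *)
Lemma pair_up_step_types sg (s : {ffun 'I_k -> 'I_n.+1}) : pairing sg ->
  pair_up (@rev_step m) sg (step_types m (pair_up -%R sg s)) =
  pair_up (@rev_step m) sg (step_types m s).
Proof.
move=> pg; apply/ffunP => l; rewrite !ffunE pairingK //.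
case: ltngtP => [||/val_inj e] //.
by case/eqP: (pairing_neq l pg).
Qed.

Lemma sum_step_types (R : comNzRingType) (F : {ffun 'I_k -> 'I_m.+1 * bool} -> R) :
  \sum_(s : {ffun 'I_k -> 'I_n.+1}) F (step_types m s) =
  \sum_y F y * \prod_l #|[set z : 'I_n.+1 | step_type m z == y l]|%:R.
Proof.
rewrite (partition_big (@step_types m n k) xpredT) //=; apply: eq_bigr => y _.
rewrite (eq_bigr (fun=> F y)) => [|s /eqP -> //].
rewrite sumr_const -[in LHS]mulr_natr; congr (_ * _).
rewrite -natr_prod; congr (_%:R).
pose G l := [set z : 'I_n.+1 | step_type m z == y l].
transitivity #|family G|; last by rewrite card_family foldrE big_map big_enum.
apply: eq_card => s; transitivity (step_types m s == y) => //.
apply/eqP/familyP => [e l|h].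
  by rewrite inE -e ffunE.
by apply/ffunP => l; rewrite ffunE; have := h l; rewrite inE => /eqP.
Qed.

Lemma opp_sum_pairing sg (s : {ffun 'I_k -> 'I_n.+1}) : pairing sg ->
  [forall l, s (sg l) == - s l] -> \sum_l s l = 0.
Proof.
move=> pg /forallP h; rewrite (bigID (mem (closers sg))) /=.
rewrite [X in _ + X](reindex_inj (inv_inj (pairingK pg))) /=.
rewrite [X in _ + X](eq_bigl (mem (closers sg))) => [|l]; last first.
  rewrite !inE pairingK //=; have := pairing_neq l pg; rewrite -val_eqE /=.
  by lia.
by rewrite -big_split big1 // => l _; rewrite (eqP (h l)) /= subrr.
Qed.

Hypothesis dvd_m : (m.+1 %| n.+1)%N.

Lemma sum_residue (R : comNzRingType) (F : 'I_m.+1 -> R) :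
  \sum_(i : 'I_n.+1) F (residue m i) = (n.+1 %/ m.+1)%:R * \sum_a F a.
Proof.
rewrite (partition_big (@residue m n) xpredT) //= mulr_sumr.
apply: eq_bigr => a _; rewrite (eq_bigr (fun=> F a)) => [|s /eqP -> //].
rewrite sumr_const -[in LHS]mulr_natl; congr (_%:R * _).
rewrite -[RHS](@card_residue m n a); last by rewrite divnK.
by apply: eq_card => z; rewrite !inE.
Qed.

Variable R : realType.

(** An exact identity at finite N: compatible walks are traded for arbitrary step sequences by
    [sum_pair_up], and these for step types weighted by their frequencies, now with independent
    steps. *)
Lemma pairing_sum (sg : {ffun 'I_k -> 'I_k}) : pairing sg ->
  (\sum_(i : 'I_n.+1) \sum_(s : {ffun 'I_k -> 'I_n.+1} | [forall l, s (sg l) == - s l])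
      (letters_match P sg (residue m i)
         (pair_up (@rev_step m) sg (step_types m s)))%:R)
    / (n.+1%:R * Num.sqrt n.+1%:R ^+ k) =
  m.+1%:R^-1 * \sum_a \sum_y
    (letters_match P sg a (pair_up (@rev_step m) sg y))%:R *
    \prod_l (#|[set z : 'I_n.+1 | step_type m z == y l]|%:R / n.+1%:R) :> R.
Proof.
move=> pg; have N0 : n.+1%:R != 0 :> R by rewrite pnatr_eq0.
have ke : k = (k./2).*2 by rewrite -[in RHS](card_closers pg) doubleK card_closers.
pose H i (y : {ffun 'I_k -> 'I_m.+1 * bool}) : R :=
  (letters_match P sg i (pair_up (@rev_step m) sg y))%:R.
have inner i : \sum_(s : {ffun 'I_k -> 'I_n.+1} | [forall l, s (sg l) == - s l]) H i (step_types m s) =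
    n.+1%:R ^- k./2 * \sum_(s : {ffun 'I_k -> 'I_n.+1}) H i (step_types m s).
  have := @sum_pair_up R 'I_n.+1 -%R k sg (fun s => H i (step_types m s)) opprK pg.
  rewrite card_ord natrX; under eq_bigr => s _.
    rewrite /H pair_up_step_types //; over.
  rewrite -/(H _ _) => ->; rewrite mulKf ?expf_neq0 //.
  by apply: eq_bigl => s; rewrite pair_up_fixed //; exact: opprK.
rewrite (eq_bigr (fun i => n.+1%:R ^- k./2 * \sum_y H (residue m i) y *
   \prod_l #|[set z : 'I_n.+1 | step_type m z == y l]|%:R)); last first.
  by move=> i _; rewrite inner sum_step_types.
rewrite -mulr_sumr (sum_residue (fun a => \sum_y H a y *
   \prod_l #|[set z : 'I_n.+1 | step_type m z == y l]|%:R)).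
have -> : Num.sqrt n.+1%:R ^+ k = n.+1%:R ^+ k./2 :> R.
  by rewrite [in LHS]ke -muln2 mulnC exprM sqr_sqrtr.
have -> : (n.+1 %/ m.+1)%:R = n.+1%:R / m.+1%:R :> R by rewrite natf_div.
rewrite [LHS](_ : _ = m.+1%:R^-1 * (n.+1%:R ^- k * \sum_a \sum_y H a y *
   \prod_l #|[set z : 'I_n.+1 | step_type m z == y l]|%:R)); last first.
  have Ne : n.+1%:R ^+ k = n.+1%:R ^+ k./2 * n.+1%:R ^+ k./2 :> R.
    by rewrite -exprD addnn -ke.
  have D0 : m.+1%:R != 0 :> R by rewrite pnatr_eq0.
  have X0 : n.+1%:R ^+ k./2 != 0 :> R by rewrite expf_neq0.
  rewrite Ne; set X := n.+1%:R ^+ _ in X0 *.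
  move: D0 N0; set D := m.+1%:R; set N := n.+1%:R => D0 N0; field.
  by rewrite !nat1r X0 D0 N0.
congr (m.+1%:R^-1 * _); rewrite mulr_sumr; apply: eq_bigr => a _.
rewrite mulr_sumr; apply: eq_bigr => y _; rewrite mulrCA; congr (H a y * _).
by rewrite prodf_div prodr_const card_ord mulrC.
Qed.

End WalkSums.

Lemma irregular0 n : irregular n 0 = finset.set0.
Proof.
apply/setP => s; rewrite inE finset.in_set0; apply/negP => /and3P[_ /injectivePn].
by case=> -[].
Qed.

(** * Convergence of the normalized walk sums *)

Section Convergence.
Variables (R : realType) (al : nat -> R).
Hypotheses (al0 : al 0 = 1) (al1 : al 1 = 0) (al2 : al 2 = 1).
Variables (m nu : nat) (P : m.+1.-tuple 'I_nu) (k : nat).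

Definition walk_sum n : R :=
  \sum_i \sum_(s : {ffun 'I_k -> 'I_n.+1} | \sum_l s l == 0)
    weight al (walk_var P i s).

Let match_sum n : R :=
  \sum_i \sum_(s : {ffun 'I_k -> 'I_n.+1} | \sum_l s l == 0) match_count R P i s.

Lemma walk_match_sum : exists2 C : R, 0 <= C & forall n, (m.+1 %| n.+1)%N ->
  `|walk_sum n - match_sum n| / (n.+1%:R * Num.sqrt n.+1%:R ^+ k) <=
  C / Num.sqrt n.+1%:R.
Proof.
set C0 : R := (1 + \sum_(j < k.+1) `|al j|) ^+ k + #|{: {ffun 'I_k -> 'I_k}}|%:R.
have C0_ge0 : 0 <= C0.
  by rewrite addr_ge0 // exprn_ge0 // addr_ge0 // sumr_ge0.
set K := #|{: {ffun 'I_k -> 'I_k} * {ffun 'I_k -> bool} * {ffun 'I_k -> bool}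
        * option 'I_k}|.
exists (C0 * K%:R); first by rewrite mulr_ge0.
move=> n dvd_m.
have N0 : 0 < n.+1%:R :> R by rewrite ltr0n.
have r0 : 0 < Num.sqrt n.+1%:R :> R by rewrite sqrtr_gt0.
have r1 : 1 <= Num.sqrt n.+1%:R :> R by rewrite -[leLHS]sqrtr1 ler_wsqrtr ?ler1n.
have diff : `|walk_sum n - match_sum n| <= n.+1%:R * (C0 * #|irregular n k|%:R).
  rewrite /walk_sum /match_sum -sumrB (le_trans (ler_norm_sum _ _ _)) //.
  rewrite -[X in X%:R * _](card_ord n.+1) mulr_natl -sumr_const ler_sum // => i _.
  rewrite -sumrB (le_trans (ler_norm_sum _ _ _)) // mulr_natr -sumr_const.
  rewrite [leRHS]big_mkcond [leLHS]big_mkcond; apply: ler_sum => s _.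
  case: ifPn => [/eqP s0|_]; last by case: ifP.
  have := weight_match_diff al0 al1 al2 P dvd_m i s0; rewrite -/C0.
  by case: ifP.
rewrite ler_pdivrMr ?mulr_gt0 ?exprn_gt0 //; apply: le_trans diff _.
rewrite [leRHS]mulrCA ler_pM2l // -!mulrA ler_wpM2l //.
(* For k = 0 the general count is only a constant, with no power of N to beat it, so emptiness is
   used instead. *)
case: (posnP k) => [k0|k_gt0].
  have -> : #|irregular n k| = 0%N.
    by move: (k0); clear; case: k => // _; rewrite irregular0 cards0.
  by rewrite !mulr_ge0 ?invr_ge0 // ?ltW // exprn_gt0.
apply: le_trans (_ : (K * n.+1 ^ k.-1./2)%:R <= _).
  by rewrite ler_nat card_irregular.
(* Written in powers of sqrt N, the claim becomes 2 floor((k-1)/2) + 1 <= k, with equality for odd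
   k. *)
rewrite natrM ler_wpM2l // natrX -{1}(sqr_sqrtr (ltW N0)) -exprM.
rewrite mulrC ler_pdivlMr // -exprSr ler_weXn2l //.
by lia.
Qed.

Lemma match_sum_limit : exists2 C : R, 0 <= C & forall n, (m.+1 %| n.+1)%N ->
  `|match_sum n / (n.+1%:R * Num.sqrt n.+1%:R ^+ k) - limit_moment P R k| <=
  C / Num.sqrt n.+1%:R.
Proof.
pose Y := #|{: {ffun 'I_k -> 'I_m.+1 * bool}}|.
exists (#|{: {ffun 'I_k -> 'I_k}}|%:R * (Y%:R * k%:R)); first by rewrite !mulr_ge0.
move=> n dvd_m.
have N0 : 0 < n.+1%:R :> R by rewrite ltr0n.
have r0 : 0 < Num.sqrt n.+1%:R :> R by rewrite sqrtr_gt0.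
have r1 : 1 <= Num.sqrt n.+1%:R :> R by rewrite -[leLHS]sqrtr1 ler_wsqrtr ?ler1n.
have -> : match_sum n = \sum_(sg : {ffun 'I_k -> 'I_k} | pairing sg) \sum_(i : 'I_n.+1)
    \sum_(s : {ffun 'I_k -> 'I_n.+1} | [forall l, s (sg l) == - s l])
      (letters_match P sg (residue m i)
         (pair_up (@rev_step m) sg (step_types m s)))%:R.
  (* Opposite steps cancel in pairs, so for a fixed pairing the condition that the walk be closed
     disappears. *)
  rewrite [RHS]exchange_big /=; apply: eq_bigr => i _.
  rewrite /match_count (exchange_big_dep (@pairing k)) /=; last first.
    by move=> s sg _ /andP[].
  apply: eq_bigr => sg pg; apply: eq_bigl => s; rewrite pg /=.
  by apply/andP/idP => [[]//|h]; rewrite (opp_sum_pairing pg h).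
rewrite mulr_suml /limit_moment -sumrB (le_trans (ler_norm_sum _ _ _)) //.
rewrite -!mulrA [leRHS]mulr_natl -sumr_const big_mkcond ler_sum // => sg _.
case: ifP => [pg|_]; last by rewrite !mulr_ge0 ?invr_ge0 // ltW.
rewrite pairing_sum // natrM invfM [X in _ - X]mulrCA -mulrBr mulrC.
have -> : (m.+1.*2 ^ k)%:R^-1 = ((m.+1).*2%:R^-1) ^+ k :> R by rewrite natrX exprVn.
rewrite mulr_suml -sumrB normrM (gtr0_norm (_ : 0 < m.+1%:R^-1 :> R)) ?invr_gt0 ?ltr0n //.
rewrite ler_pdivrMr ?ltr0n // (le_trans (ler_norm_sum _ _ _)) //.
rewrite -[X in _ * X%:R](card_ord m.+1) mulr_natr -sumr_const ler_sum // => a _.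
rewrite mulr_suml -sumrB (le_trans (ler_norm_sum _ _ _)) //.
rewrite mulr_natl -sumr_const ler_sum // => y _.
rewrite -mulrBr normrM.
(* The error here is of order 1/N; it is weakened to the rate of [walk_match_sum]. *)
apply: (@le_trans _ _ (n.+1%:R^-1 *+ k)); last first.
  rewrite -[leLHS]mulr_natl ler_wpM2l // lef_pV2 ?posrE //.
  rewrite -[leRHS](sqr_sqrtr (ltW N0)) expr2 ler_peMl // ltW.
rewrite -[leRHS]mul1r ler_pM //; first by case: letters_match; rewrite ?normr1 ?normr0.
have := @prodr_dist R _ (index_enum 'I_k)
  (fun l => #|[set z : 'I_n.+1 | step_type m z == y l]|%:R / n.+1%:R)
  (m.+1.*2%:R^-1) n.+1%:R^-1.
have -> : size (index_enum 'I_k) = k by rewrite -sum1_size sum1_card card_ord.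
apply.
- move=> l; rewrite divr_ge0 //= ler_pdivrMr // mul1r ler_nat.
  by rewrite -[leqRHS]card_ord max_card.
- by rewrite invr_ge0 ler0n /= invf_le1 ?ltr0n // ler1n.
- by move=> l; exact: step_type_freq.
Qed.

Theorem walk_sum_limit : exists2 C : R, 0 <= C & forall n, (m.+1 %| n.+1)%N ->
  `|walk_sum n / (n.+1%:R * Num.sqrt n.+1%:R ^+ k) - limit_moment P R k| <=
  C / Num.sqrt n.+1%:R.
Proof.
have [C1 C1_ge0 h1] := walk_match_sum.
have [C2 C2_ge0 h2] := match_sum_limit.
exists (C1 + C2); first by rewrite addr_ge0.
move=> n dvd_m; rewrite mulrDl; apply: le_trans (lerD (h1 n dvd_m) (h2 n dvd_m)).
set D := n.+1%:R * _.
have D0 : 0 <= D by rewrite mulr_ge0 // exprn_ge0 // sqrtr_ge0.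
rewrite -[X in `|_| / X](ger0_norm D0) -normf_div mulrBl.
by apply: le_trans (ler_normD _ _); rewrite addrA subrK.
Qed.

End Convergence.

(** * The combinatorial limit moments *)

(** A pairing is determined by its set of closers and by its values on that set, which has k/2
    elements. *)
Lemma card_pairings k :
  (#|[set sg : {ffun 'I_k -> 'I_k} | pairing sg]| <= 2 ^ k * k ^ k./2)%N.
Proof.
case: k => [|k].
  by rewrite (leq_trans (max_card _)) // card_ffun !card_ord.
have {1}-> : (2 ^ k.+1 = #|{set 'I_k.+1}|)%N.
  by rewrite -cardsT -powersetT card_powerset cardsT card_ord.
have -> : (k.+1 ^ k.+1./2 = #|'I_k.+1| ^ k.+1./2)%N by rewrite card_ord.
apply: (@card_coded _ _ _ ord0 _ (@closers k.+1) id) => [s|s s'].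
  by rewrite inE => /card_closers /(congr1 half); rewrite doubleK => ->.
rewrite !inE => ps ps' e h; apply/ffunP => l.
have [lc|lc] := boolP (l \in closers s); first exact: h.
have slc : s l \in closers s.
  move: lc; rewrite !inE pairingK //; have := pairing_neq l ps.
  by rewrite -val_eqE /=; lia.
by apply: (can_inj (pairingK ps')); rewrite -(h _ slc) (pairingK ps) (pairingK ps').
Qed.

(** q^q is at most the falling factorial (2q)(2q-1)...(q+1), which is the central binomial
    coefficient times q!, and that coefficient is at most 2^(2q). *)
Lemma expnn_le q : (q ^ q <= 4 ^ q * q`!)%N.
Proof.
have le_ffact n : (n <= q -> q ^ n <= (2 * q) ^_ n)%N.
  elim: n => // n IHn nq; rewrite expnSr ffactnSr leq_mul ?IHn //; lia.
apply: leq_trans (le_ffact q (leqnn q)) _.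
rewrite -bin_ffact leq_mul2r -[4%N]/(2 ^ 2)%N -expnM; apply/orP; right.
have -> : (2 ^ (2 * q) = \sum_(i < (2 * q).+1) 'C(2 * q, i))%N.
  by rewrite -[2%N in LHS]/(1 + 1)%N expnDn; apply: eq_bigr => i _; rewrite !exp1n !muln1.
have qlt : (q < (2 * q).+1)%N by lia.
by rewrite (bigD1 (Ordinal qlt)) //= leq_addr.
Qed.

Lemma card_pairings_double q :
  (#|[set sg : {ffun 'I_q.*2 -> 'I_q.*2} | pairing sg]| <= 32 ^ q * q`!)%N.
Proof.
apply: leq_trans (card_pairings _) _; rewrite doubleK.
have -> : (2 ^ q.*2 * q.*2 ^ q = 8 ^ q * q ^ q)%N.
  by rewrite -mul2n expnM expnMn mulnA -expnMn.
rewrite -[32%N]/(8 * 4)%N [X in (_ <= X * _)%N]expnMn -mulnA leq_mul2l.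
by rewrite expnn_le orbT.
Qed.

Section MatchCount.
Variables (m nu : nat) (P : m.+1.-tuple 'I_nu) (k : nat).

(** Summing over compatible step types only lowers the exponent of the denominator from k to k/2 and
    leaves an integer small enough to compute. *)
Definition match_number (sg : {ffun 'I_k -> 'I_k}) : nat :=
  (\sum_(y : {ffun 'I_k -> 'I_m.+1 * bool} | pair_up (@rev_step m) sg y == y)
    \sum_a letters_match P sg a y)%N.

Lemma limit_momentE (R : realFieldType) : limit_moment P R k =
  (\sum_(sg : {ffun 'I_k -> 'I_k} | pairing sg) match_number sg)%:R
    / (m.+1 * (m.+1).*2 ^ k./2)%:R.
Proof.
rewrite /limit_moment natr_sum mulr_suml; apply: eq_bigr => sg pg.
rewrite exchange_big /=.
have D0 : (m.+1.*2 ^ k./2)%:R != 0 :> R by rewrite pnatr_eq0 expn_eq0.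
have M0 : m.+1%:R != 0 :> R by rewrite pnatr_eq0.
have := @sum_pair_up R _ (@rev_step m) k sg
  (fun y => \sum_a (letters_match P sg a y)%:R) (@rev_stepK m) pg.
rewrite card_prod card_ord card_bool muln2 => ->.
have ke : k = (k./2 + k./2)%N.
  by rewrite addnn -[in RHS](card_closers pg) doubleK card_closers.
rewrite /match_number natr_sum; under [in RHS]eq_bigr => y _ do rewrite natr_sum.
rewrite [in X in _ / X]ke expnD !natrM.
set X := _%:R in D0 *; set S := \sum_(_ | _) _.
by move: M0; set D := m.+1%:R => M0; field; rewrite nat1r D0 M0.
Qed.

Lemma card_pair_up_fixed (sg : {ffun 'I_k -> 'I_k}) : pairing sg ->
  #|[pred y | pair_up (@rev_step m) sg y == y]| = (m.+1.*2 ^ k./2)%N.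
Proof.
move=> pg; have := @sum_pair_up rat _ (@rev_step m) k sg (fun=> 1) (@rev_stepK m) pg.
have cY : #|{: {ffun 'I_k -> 'I_m.+1 * bool}}| = (m.+1.*2 ^ k)%N.
  by rewrite card_ffun card_prod !card_ord card_bool muln2.
rewrite !sumr_const cY card_prod card_ord card_bool muln2 -natrM.
move/eqP; rewrite eqr_nat => /eqP.
have ke : k = (k./2 + k./2)%N.
  by rewrite addnn -[in RHS](card_closers pg) doubleK card_closers.
have cancel X A B : (0 < X -> X ^ k = X ^ k./2 * A -> A = B -> B = X ^ k./2)%N.
  move=> X0 + <-; rewrite [in X in X = _]ke expnD => /eqP.
  by rewrite eqn_pmul2l ?expn_gt0 ?X0 // => /eqP.
by move/cancel; apply=> //; apply: eq_card => y; rewrite !inE.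
Qed.

Lemma match_number_le (sg : {ffun 'I_k -> 'I_k}) : pairing sg ->
  (match_number sg <= m.+1 * (m.+1).*2 ^ k./2)%N.
Proof.
move=> pg; rewrite mulnC -(card_pair_up_fixed pg) -sum_nat_const.
apply: leq_sum => y _; rewrite -[leqRHS]card_ord -sum1_card.
by apply: leq_sum => a _; rewrite leq_b1.
Qed.

Lemma limit_moment_le (R : realFieldType) :
  limit_moment P R k <= #|[set sg : {ffun 'I_k -> 'I_k} | pairing sg]|%:R.
Proof.
rewrite limit_momentE ler_pdivrMr ?ltr0n ?muln_gt0 ?expn_gt0 // -natrM ler_nat.
rewrite -sum_nat_const big_mkcond [leqRHS]big_mkcond; apply: leq_sum => sg _.
by rewrite inE; case: ifP => // /match_number_le.
Qed.

End MatchCount.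

(** * Computable enumeration of pairings and step types *)

Section Extensions.
Variable T : eqType.

(* [extensions ext n] lists the sequences of length n built by appending, at each
   stage, an element of [ext p] to the current prefix p. Sums over finite
   functions, which do not compute, are turned into sums over such lists. *)
Fixpoint extensions (ext : seq T -> seq T) n : seq (seq T) :=
  if n is n'.+1 then
    flatten [seq [seq rcons p x | x <- ext p] | p <- extensions ext n']
  else [:: [::]].

Lemma mem_extensions ext n x0 (p : seq T) : (p \in extensions ext n) =
  (size p == n) && all (fun i => nth x0 p i \in ext (take i p)) (iota 0 n).
Proof.
elim: n p => [|n IHn] p; first by rewrite inE andbT size_eq0.
have -> : iota 0 n.+1 = iota 0 n ++ [:: n] by rewrite -addn1 iotaD.
rewrite all_cat /= andbT.
apply/flatten_mapP/andP => [[q + /mapP[x xq ->]]|].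
  rewrite IHn => /andP[/eqP szq /allP h]; rewrite size_rcons szq eqxx; split=> //.
  rewrite -szq nth_rcons ltnn eqxx -cats1 take_size_cat // xq andbT.
  apply/allP => i; rewrite szq => ii; have := h i ii.
  move: ii; rewrite mem_iota /= add0n -szq => ii.
  by rewrite nth_cat ii takel_cat // ltnW.
case/lastP: p => [[]//|q x]; rewrite size_rcons eqSS => -[/eqP szq /andP[/allP h l]].
exists q; last first.
  move: l; rewrite -szq nth_rcons ltnn eqxx -cats1 take_size_cat // => xq.
  by rewrite cats1; apply/mapP; exists x.
rewrite IHn szq eqxx; apply/allP => i ii; have := h i ii.
move: ii; rewrite mem_iota /= add0n -szq => ii.
by rewrite -cats1 nth_cat ii takel_cat // ltnW.
Qed.

Lemma uniq_extensions ext n : (forall p, uniq (ext p)) -> uniq (extensions ext n).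
Proof.
move=> u; elim: n => //= n IHn; apply: allpairs_uniq_dep => //.
by move=> [p x] [q y] /= _ _ /rcons_inj [-> ->].
Qed.

(** The summation condition may be split between [ext], which prunes while prefixes grow, and
    [cond'], which is tested on completed lists. *)
Lemma sum_extensions (D : finType) (c : D -> T) (ext : seq T -> seq T) k
    (cond : pred {ffun 'I_k -> D}) (cond' : pred (seq T))
    (F : {ffun 'I_k -> D} -> nat) (F' : seq T -> nat) (x0 : T) :
    let code (f : {ffun 'I_k -> D}) := [seq c (f i) | i <- enum 'I_k] in
    injective c -> (forall p, uniq (ext p)) ->
    (forall p x, x \in ext p -> exists z, x = c z) ->
    (forall f, cond f = cond' (code f) &&
       [forall i : 'I_k, c (f i) \in ext (take i (code f))]) ->
    (forall f, cond f -> F f = F' (code f)) ->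
  (\sum_(f | cond f) F f = \sum_(p <- extensions ext k | cond' p) F' p)%N.
Proof.
move=> code cinj uext imc condE FE.
have nth_code f (i : 'I_k) : nth x0 (code f) i = c (f i).
  by rewrite (nth_map i) ?size_enum_ord // nth_ord_enum.
have size_code f : size (code f) = k by rewrite size_map size_enum_ord.
have code_inj : injective code.
  move=> f g e; apply/ffunP => i; apply: cinj.
  by rewrite -!nth_code e.
rewrite -[RHS]big_filter [RHS](perm_big (map code (enum cond))) /=; last first.
  apply: uniq_perm; rewrite ?filter_uniq ?uniq_extensions //.
    by rewrite map_inj_uniq // enum_uniq.
  move=> p; rewrite mem_filter (mem_extensions _ _ x0).
  apply/andP/mapP => [[cp /andP[/eqP szp /allP h]]|[f + ->]].
    have ex (i : 'I_k) : exists z, nth x0 p i == c z.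
      have /h/imc[z ->] : (i : nat) \in iota 0 k by rewrite mem_iota /=.
      by exists z.
    pose f : {ffun 'I_k -> D} := [ffun i => xchoose (ex i)].
    have pE : p = code f.
      apply: (@eq_from_nth _ x0); rewrite ?size_code // szp => i ik.
      rewrite -[i]/(val (Ordinal ik)) nth_code ffunE.
      exact/eqP/(xchooseP (ex (Ordinal ik))).
    exists f => //; rewrite mem_enum [_ \in _]condE -pE cp /=.
    by apply/forallP => i; rewrite -nth_code -pE h // mem_iota /=.
  rewrite mem_enum [_ \in _]condE => /andP[-> /forallP h]; split => //.
  rewrite size_code eqxx; apply/allP => i; rewrite mem_iota /= add0n => ik.
  by rewrite -[i]/(val (Ordinal ik)) nth_code h.
by rewrite big_map big_enum /=; apply: eq_bigr => f; exact: FE.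
Qed.

End Extensions.

Definition pairing_ext k (p : seq nat) : seq nat :=
  let l := size p in
  [seq j <- iota 0 k | if l \in p then j == index l p else (l < j)%N && (j \notin p)].

Definition pairing_seq k (p : seq nat) : bool :=
  all (fun i => (nth 0 p (nth 0 p i) == i) && (nth 0 p i != i))%N (iota 0 k).

Definition pairing_seqs k := [seq p <- extensions (pairing_ext k) k | pairing_seq k p].

Definition ord_code k (sg : {ffun 'I_k -> 'I_k}) : seq nat :=
  [seq val (sg i) | i <- enum 'I_k].

Lemma nth_ord_code k (sg : {ffun 'I_k -> 'I_k}) (i : 'I_k) :
  nth 0%N (ord_code sg) i = sg i.
Proof. by rewrite (nth_map i) ?size_enum_ord // nth_ord_enum. Qed.

Lemma pairing_codeE k (sg : {ffun 'I_k -> 'I_k}) :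
  pairing sg = pairing_seq k (ord_code sg) &&
    [forall i : 'I_k, val (sg i) \in pairing_ext k (take i (ord_code sg))].
Proof.
have size_code : size (ord_code sg) = k by rewrite size_map size_enum_ord.
have seqE : pairing sg = pairing_seq k (ord_code sg).
  apply/forallP/allP => [h i|h i].
    rewrite mem_iota /= => ik.
    by rewrite -[i]/(val (Ordinal ik)) !nth_ord_code !val_eqE h.
  have := h i; rewrite mem_iota /= !nth_ord_code !val_eqE; exact.
rewrite -seqE; case: (boolP (pairing sg)) => //= pg; apply/esym/forallP => i.
have injc : uniq (ord_code sg).
  by rewrite map_inj_uniq ?enum_uniq // => x y /val_inj/(can_inj (pairingK pg)).
have szt : size (take i (ord_code sg)) = i.
  by rewrite size_take_min size_code; apply/minn_idPl/ltnW.
have nt (j : 'I_k) : (j < i)%N -> nth 0%N (take i (ord_code sg)) j = sg j.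
  by move=> ji; rewrite nth_take // nth_ord_code.
rewrite /pairing_ext mem_filter szt mem_iota /= ltn_ord andbT.
case: ifPn => [|inot].
  move=> /(nthP 0%N)[j]; rewrite szt => ji.
  have jk : (j < k)%N by exact: ltn_trans ji _.
  rewrite -[j]/(val (Ordinal jk)) nt // => e.
  have se : sg i = Ordinal jk.
    by apply: (can_inj (pairingK pg)); rewrite pairingK //; apply: val_inj.
  rewrite se /= -{1}(index_uniq 0%N _ (take_uniq i injc) (i := j)) ?szt //.
  by rewrite -[j in nth _ _ j]/(val (Ordinal jk)) nt // e.
apply/andP; split.
  rewrite ltnNge; apply: contra inot => le.
  have lt : (sg i < i)%N.
    by rewrite ltn_neqAle le andbT val_eqE pairing_neq.
  apply/(nthP 0%N); exists (sg i); rewrite ?szt // nt // pairingK //.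
apply/negP => /(nthP 0%N)[j]; rewrite szt => ji.
have jk : (j < k)%N by exact: ltn_trans ji _.
rewrite -[j]/(val (Ordinal jk)) nt // => /val_inj/(can_inj (pairingK pg)) e.
by rewrite -e ltnn in ji.
Qed.

Lemma sum_pairings k (F : {ffun 'I_k -> 'I_k} -> nat) (F' : seq nat -> nat) :
  (forall sg, pairing sg -> F sg = F' (ord_code sg)) ->
  (\sum_(sg : {ffun 'I_k -> 'I_k} | pairing sg) F sg =
   \sum_(p <- pairing_seqs k) F' p)%N.
Proof.
move=> FE; rewrite big_filter.
apply: (@sum_extensions _ _ val (pairing_ext k) k _ (pairing_seq k) _ _ 0%N) => //.
- by move=> p; rewrite filter_uniq // iota_uniq.
- move=> p x; rewrite mem_filter mem_iota => /andP[_ /= xk].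
  by exists (Ordinal xk).
- exact: pairing_codeE.
Qed.

(** Only opening steps are chosen; a closing step is the reverse of its partner, which already
    stands in the prefix. *)
Definition step_ext d (sg : seq nat) (p : seq (nat * bool)) : seq (nat * bool) :=
  let l := size p in
  if (nth 0 sg l < l)%N then
    let x := nth (0%N, false) p (nth 0%N sg l) in [:: ((d - x.1) %% d, ~~ x.2)%N]
  else [seq (r, u) | r <- iota 0 d, u <- [:: true; false]].

Definition slot_code d (a : nat) (y : seq (nat * bool)) l : nat :=
  ((a + sumn [seq (nth (0, false) y j).1 |
               j <- iota 0 (if (nth (0, false) y l).2 then l else l.+1)]) %% d)%N.

Definition match_code d (L : seq nat) k (sg : seq nat) (y : seq (nat * bool)) a :=
  let letters := [seq nth 0%N L (slot_code d a y l) | l <- iota 0 k] in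
  all (fun l => nth 0 letters (nth 0 sg l) == nth 0 letters l)%N (iota 0 k).

Definition pattern_count d (L : seq nat) k : nat :=
  sumn [seq sumn [seq count (match_code d L k sg y) (iota 0 d)
                   | y <- extensions (step_ext d sg) k] | sg <- pairing_seqs k].

Section Codes.
Variables (m nu : nat) (P : m.+1.-tuple 'I_nu) (k : nat).

Definition step_code (x : 'I_m.+1 * bool) : nat * bool := (val x.1, x.2).

Definition steps_code (y : {ffun 'I_k -> 'I_m.+1 * bool}) : seq (nat * bool) :=
  [seq step_code (y i) | i <- enum 'I_k].

Lemma nth_steps_code y (i : 'I_k) :
  nth (0%N, false) (steps_code y) i = step_code (y i).
Proof. by rewrite (nth_map i) ?size_enum_ord // nth_ord_enum. Qed.

Lemma walk_pos_val (a : 'I_m.+1) (s : {ffun 'I_k -> 'I_m.+1}) l :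
  val (walk_pos a s l) = ((a + \sum_(j < k | (j < l)%N) s j) %% m.+1)%N.
Proof.
have inZpD : {morph (@inZp m) : x y / (x + y)%N >-> x + y}.
  by move=> x y; apply: val_inj; rewrite /= modnDm.
have inZp0 : @inZp m 0%N = 0 by apply: val_inj; rewrite /= mod0n.
transitivity (val (@inZp m (a + \sum_(j < k | (j < l)%N) s j)%N)) => //.
congr val; rewrite inZpD (big_morph _ inZpD inZp0) valZpK.
by congr (_ + _); apply: eq_bigr => j _; rewrite valZpK.
Qed.

Lemma model_slot_code a y (l : 'I_k) :
  val (model_slot a y l) = slot_code m.+1 a (steps_code y) l.
Proof.
rewrite walk_pos_val /slot_code nth_steps_code /=.
set h := if _ then _ else _; have hk : (h <= k)%N by rewrite /h; case: ifP => _; [exact: ltnW | exact: ltn_ord].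
congr ((_ + _) %% _)%N.
rewrite sumnE big_map -[h in iota 0 h]subn0 -/(index_iota 0 h) big_mkord.
rewrite (big_ord_widen k (fun j => (nth (0%N, false) (steps_code y) j).1) hk).
by apply: eq_bigr => j _; rewrite ffunE nth_steps_code.
Qed.

Lemma letters_match_code (sg : {ffun 'I_k -> 'I_k}) (a : 'I_m.+1) y :
  letters_match P sg a y =
  match_code m.+1 (map val P) k (ord_code sg) (steps_code y) a.
Proof.
have letE (l : 'I_k) : nth 0%N [seq nth 0%N (map val P)
      (slot_code m.+1 a (steps_code y) l) | l <- iota 0 k] l =
    val (tnth P (model_slot a y l)).
  rewrite (nth_map 0%N) ?size_iota // nth_iota // add0n -model_slot_code.
  rewrite (tnth_nth (tnth P ord0)) (nth_map (tnth P ord0)) //.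
  by rewrite size_tuple; exact: (ltn_ord (model_slot a y l)).
apply/forallP/allP => h l.
  rewrite mem_iota /= => lk; rewrite -[l]/(val (Ordinal lk)) nth_ord_code !letE.
  exact: h.
have := h (val l); rewrite mem_iota nth_ord_code !letE => h'.
exact: h' (ltn_ord l).
Qed.

Lemma match_number_code (sg : {ffun 'I_k -> 'I_k}) : pairing sg ->
  match_number P sg =
  sumn [seq count (match_code m.+1 (map val P) k (ord_code sg) y) (iota 0 m.+1)
         | y <- extensions (step_ext m.+1 (ord_code sg)) k].
Proof.
move=> pg; rewrite sumnE big_map -[RHS](big_rmcond_in xpredT) //.
apply: (@sum_extensions _ _ step_code _ k _ xpredT _ _ (0%N, false)) => //.
- by move=> [r u] [r' u'] [/val_inj -> ->].
- move=> p; rewrite /step_ext; case: ifP => // _.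
  by rewrite allpairs_uniq ?iota_uniq // => -[? ?] [? ?] _ _ [-> ->].
- move=> p x; rewrite /step_ext; case: ifP => _.
    rewrite inE => /eqP ->.
    have lt := ltn_pmod (m.+1 - (nth (0%N, false) p (nth 0%N (ord_code sg) (size p))).1) (ltn0Sn m).
    by eexists (Ordinal lt, _).
  move=> /allpairsP[[r u] [rd _ ->]].
  have {rd} : r \in iota 0 m.+1 by exact: rd.
  rewrite mem_iota => /= rd.
  by exists (Ordinal rd, u).
- move=> y /=; rewrite pair_up_fixed //; last exact: rev_stepK.
  have szt (i : 'I_k) : size (take i (steps_code y)) = i.
    rewrite size_take_min size_map size_enum_ord; apply/minn_idPl/ltnW/ltn_ord.
  have extE (i : 'I_k) : (step_code (y i) \in
      step_ext m.+1 (ord_code sg) (take i (steps_code y))) =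
      ((sg i < i)%N ==> (y i == rev_step (y (sg i)))).
    rewrite /step_ext szt nth_ord_code; case: ifP => [lt|_]; rewrite ?implyTb ?implyFb.
      rewrite nth_take // nth_steps_code mem_seq1 /step_code /rev_step.
      case: (y i) => r u; case: (y (sg i)) => r' u' /=.
      by rewrite !xpair_eqE -val_eqE.
    apply/allpairsP; exists (val (y i).1, (y i).2); split=> //.
      by rewrite mem_iota ltn_ord.
    by rewrite !inE; case: (_.2).
  apply/forallP/forallP => h i.
    rewrite extE; apply/implyP => _.
    by rewrite -{1}(pairingK pg i) (eqP (h (sg i))).
  have := pairing_neq i pg; rewrite -val_eqE /= => ne.
  case: (ltnP (sg i) i) => lt.
    have := h i; rewrite extE lt /= => /eqP ->.
    by rewrite rev_stepK.
  (* At an opening step the list carries no constraint; the one at its closing partner is used. *)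
  have := h (sg i); rewrite extE pairingK //.
  by rewrite ltn_neqAle eq_sym ne lt.
move=> y _; rewrite -sum1_count.
have -> : iota 0 m.+1 = index_iota 0 m.+1 by rewrite /index_iota subn0.
rewrite big_mkord [RHS]big_mkcond /=.
by apply: eq_bigr => a _; rewrite letters_match_code; case: match_code.
Qed.

Lemma pattern_countE :
  (\sum_(sg : {ffun 'I_k -> 'I_k} | pairing sg) match_number P sg =
   pattern_count m.+1 (map val P) k)%N.
Proof.
by rewrite /pattern_count sumnE big_map; apply: sum_pairings; exact: match_number_code.
Qed.

End Codes.

(** There are 15 pairings of six steps, 8^3 choices of opening step types for each, and 4 starting
    residues: 30720 tests per pattern. *)
Lemma pattern_count6_neq :
  pattern_count 4 [:: 0; 1; 0; 1]%N 6 != pattern_count 4 [:: 0; 0; 1; 1]%N 6.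
Proof. by vm_compute. Qed.

Lemma limit_moment6_neq (R : realFieldType) :
  limit_moment pattern1212 R 6 != limit_moment pattern1122 R 6.
Proof.
rewrite !limit_momentE !pattern_countE -subr_eq0 -mulrBl mulf_neq0 //.
  by rewrite subr_eq0 eqr_nat pattern_count6_neq.
Qed.

(** * The fourth moment *)

Section FourthMoment.
Variables (m nu : nat) (P : m.+1.-tuple 'I_nu).

(** The number of triples of slots with a common letter. It is what the crossing pairing of four
    steps counts, and it equals the sum of the cubes of the frequencies. *)
Definition letter_triples : nat :=
  (\sum_(a : 'I_m.+1) \sum_(b : 'I_m.+1) \sum_(c : 'I_m.+1)
     ((tnth P a == tnth P b) && (tnth P a == tnth P c)))%N.

Lemma count_mem_tuple (v : 'I_nu) : count_mem v P = (\sum_a (tnth P a == v))%N.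
Proof.
rewrite -sum1_count big_mkcond /= big_tuple; apply: eq_bigr => a _.
by case: eqP.
Qed.

Lemma sum_letter_triples : letter_triples = (\sum_(r : 'I_m.+1) \sum_(t : 'I_m.+1)
  \sum_(a : 'I_m.+1)
    ((tnth P a == tnth P (a + r)%R) && (tnth P a == tnth P (a + t)%R)))%N.
Proof.
under [RHS]eq_bigr do rewrite exchange_big /=.
rewrite exchange_big /=; apply: eq_bigr => a _.
rewrite (reindex_inj (addrI a)); apply: eq_bigr => r _.
by rewrite (reindex_inj (addrI a)).
Qed.

Lemma letter_triplesE : letter_triples = (\sum_(f <- frequencies P) f ^ 3)%N.
Proof.
rewrite /frequencies big_map big_enum /=.
transitivity (\sum_(v : 'I_nu) \sum_a (tnth P a == v) * count_mem v P ^ 2)%N; last first.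
  by apply: eq_bigr => v _; rewrite -big_distrl /= -count_mem_tuple -expnS.
rewrite exchange_big /=; apply: eq_bigr => a _.
rewrite (bigD1 (tnth P a)) //= eqxx mul1n [X in (_ + X)%N]big1 ?addn0; last first.
  by move=> v; rewrite eq_sym => /negPf ->; rewrite mul0n.
rewrite expnS expn1 [X in (X * _)%N]count_mem_tuple big_distrl /=.
apply: eq_bigr => b _; rewrite count_mem_tuple big_distrr /=.
by apply: eq_bigr => c _; rewrite mulnb ![tnth P a == _]eq_sym.
Qed.

Let o0 : 'I_4 := @Ordinal 4 0 isT.
Let o1 : 'I_4 := @Ordinal 4 1 isT.
Let o2 : 'I_4 := @Ordinal 4 2 isT.
Let o3 : 'I_4 := @Ordinal 4 3 isT.

Lemma forall_ord4 (Q : pred 'I_4) :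
  [forall l, Q l] = [&& Q o0, Q o1, Q o2 & Q o3].
Proof.
apply/forallP/and4P => [h|[h0 h1 h2 h3] [[|[|[|[|//]]]] lt]]; first by split.
- by rewrite (_ : Ordinal lt = o0) //; exact: val_inj.
- by rewrite (_ : Ordinal lt = o1) //; exact: val_inj.
- by rewrite (_ : Ordinal lt = o2) //; exact: val_inj.
- by rewrite (_ : Ordinal lt = o3) //; exact: val_inj.
Qed.

Definition ord_decode (p : seq nat) : {ffun 'I_4 -> 'I_4} :=
  [ffun i : 'I_4 => inord (nth 0%N p i)].

Lemma ord_codeK (sg : {ffun 'I_4 -> 'I_4}) : ord_decode (ord_code sg) = sg.
Proof.
by apply/ffunP => i; rewrite ffunE nth_ord_code inord_val.
Qed.

Lemma sum_pairings4 (F : {ffun 'I_4 -> 'I_4} -> nat) :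
  (\sum_(sg : {ffun 'I_4 -> 'I_4} | pairing sg) F sg =
   F (ord_decode [:: 1; 0; 3; 2]) + F (ord_decode [:: 2; 3; 0; 1])
   + F (ord_decode [:: 3; 2; 1; 0]))%N.
Proof.
rewrite (sum_pairings (F' := fun p => F (ord_decode p))); last first.
  by move=> sg _; rewrite ord_codeK.
have -> : pairing_seqs 4 = [:: [:: 1; 0; 3; 2]; [:: 2; 3; 0; 1]; [:: 3; 2; 1; 0]]%N.
  by vm_compute.
by rewrite !big_cons big_nil addn0 addnA.
Qed.

Lemma model_slot4 a (y : {ffun 'I_4 -> 'I_m.+1 * bool}) :
  [/\ model_slot a y o0 = if (y o0).2 then a else a + (y o0).1,
      model_slot a y o1 = if (y o1).2 then a + (y o0).1
        else a + (y o0).1 + (y o1).1,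
      model_slot a y o2 = if (y o2).2 then a + (y o0).1 + (y o1).1
        else a + (y o0).1 + (y o1).1 + (y o2).1 &
      model_slot a y o3 = if (y o3).2 then a + (y o0).1 + (y o1).1 + (y o2).1
        else a + (y o0).1 + (y o1).1 + (y o2).1 + (y o3).1].
Proof.
have p0 : walk_pos a [ffun j => (y j).1] 0 = a by rewrite walk_pos0.
have p1 : walk_pos a [ffun j => (y j).1] 1 = a + (y o0).1.
  by rewrite (walk_posS a _ o0) p0 ffunE.
have p2 : walk_pos a [ffun j => (y j).1] 2 = a + (y o0).1 + (y o1).1.
  by rewrite (walk_posS a _ o1) p1 ffunE.
have p3 : walk_pos a [ffun j => (y j).1] 3 = a + (y o0).1 + (y o1).1 + (y o2).1.
  by rewrite (walk_posS a _ o2) p2 ffunE.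
have p4 : walk_pos a [ffun j => (y j).1] 4 =
    a + (y o0).1 + (y o1).1 + (y o2).1 + (y o3).1.
  by rewrite (walk_posS a _ o3) p3 ffunE.
by split; rewrite /model_slot; case: ifP.
Qed.

Lemma pairing_decode p : p \in pairing_seqs 4 -> pairing (ord_decode p).
Proof.
have -> : pairing_seqs 4 = [:: [:: 1; 0; 3; 2]; [:: 2; 3; 0; 1]; [:: 3; 2; 1; 0]]%N.
  by vm_compute.
rewrite !inE => /or3P[]/eqP->; rewrite /pairing forall_ord4 !ffunE /=;
  by rewrite -!val_eqE /= !inordK.
Qed.

Lemma decode_fixed i0 i1 i2 i3 (y : {ffun 'I_4 -> 'I_m.+1 * bool}) :
    (i0 < 4)%N -> (i1 < 4)%N -> (i2 < 4)%N -> (i3 < 4)%N ->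
    [:: i0; i1; i2; i3] \in pairing_seqs 4 ->
  (pair_up (@rev_step m) (ord_decode [:: i0; i1; i2; i3]) y == y) =
  [&& y (inord i0) == rev_step (y o0), y (inord i1) == rev_step (y o1),
      y (inord i2) == rev_step (y o2) & y (inord i3) == rev_step (y o3)].
Proof.
move=> h0 h1 h2 h3 /pairing_decode pg.
by rewrite pair_up_fixed ?forall_ord4 ?ffunE //; exact: rev_stepK.
Qed.

Lemma inord4 : [/\ inord 0 = o0, inord 1 = o1, inord 2 = o2 & inord 3 = o3].
Proof. by split; apply: val_inj; rewrite /= inordK. Qed.

Lemma letters_match4 i0 i1 i2 i3 a (y : {ffun 'I_4 -> 'I_m.+1 * bool}) :
  letters_match P (ord_decode [:: i0; i1; i2; i3]) a y =
  [&& tnth P (model_slot a y (inord i0)) == tnth P (model_slot a y o0),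
      tnth P (model_slot a y (inord i1)) == tnth P (model_slot a y o1),
      tnth P (model_slot a y (inord i2)) == tnth P (model_slot a y o2) &
      tnth P (model_slot a y (inord i3)) == tnth P (model_slot a y o3)].
Proof. by rewrite /letters_match forall_ord4 !ffunE. Qed.

Lemma always_match_number (sg : {ffun 'I_4 -> 'I_4}) : pairing sg ->
    (forall a y, pair_up (@rev_step m) sg y == y -> letters_match P sg a y) ->
  match_number P sg = (m.+1 * (m.+1).*2 ^ 2)%N.
Proof.
move=> pg h; rewrite /match_number mulnC -(card_pair_up_fixed m pg) -sum_nat_const.
apply: eq_bigr => y yfix; rewrite (eq_bigr (fun=> 1%N)) ?sum1_card ?card_ord //.
by move=> a _; rewrite h.
Qed.

(** Each second step retraces the edge just used. Reversal swaps the ends and also the half, so the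
    slot is the same and the letters always agree. *)
Lemma match_number_1032 :
  match_number P (ord_decode [:: 1; 0; 3; 2]%N) = (m.+1 * (m.+1).*2 ^ 2)%N.
Proof.
have [i0 i1 i2 i3] := inord4; have pin : [:: 1; 0; 3; 2]%N \in pairing_seqs 4.
  by vm_compute.
apply: always_match_number => [|a y]; first exact: pairing_decode.
rewrite decode_fixed // letters_match4 i0 i1 i2 i3 => /and4P[/eqP y1 _ /eqP y3 _].
have [-> -> -> ->] := model_slot4 a y; rewrite {}y1 {}y3 /rev_step /=.
by case: (y o0).2; case: (y o2).2; rewrite /= ?addrK !eqxx.
Qed.

(** The inner pair returns to its starting point, so the outer pair also traverses one edge in both
    directions. *)
Lemma match_number_3210 :
  match_number P (ord_decode [:: 3; 2; 1; 0]%N) = (m.+1 * (m.+1).*2 ^ 2)%N.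
Proof.
have [i0 i1 i2 i3] := inord4; have pin : [:: 3; 2; 1; 0]%N \in pairing_seqs 4.
  by vm_compute.
apply: always_match_number => [|a y]; first exact: pairing_decode.
rewrite decode_fixed // letters_match4 i0 i1 i2 i3 => /and4P[/eqP y3 /eqP y2 _ _].
have [-> -> -> ->] := model_slot4 a y; rewrite {}y2 {}y3 /rev_step /=.
by case: (y o0).2; case: (y o1).2; rewrite /= ?addrK !eqxx.
Qed.

Lemma match_number_2301 :
  match_number P (ord_decode [:: 2; 3; 0; 1]%N) = (4 * letter_triples)%N.
Proof.
have [i0 i1 i2 i3] := inord4; have pin : [:: 2; 3; 0; 1]%N \in pairing_seqs 4.
  by vm_compute.
have sym4 (A B C E : 'I_nu) :
    [&& C == A, E == B, A == C & B == E] = (C == A) && (E == B).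
  by rewrite [A == C]eq_sym [B == E]eq_sym; do 2 case: (_ == _).
pose D := ('I_m.+1 * bool)%type.
(* A compatible sequence is determined by its two opening types. Its walk runs around the
   parallelogram a, a+r, a+r+t, a+t. *)
pose cross (xz : D * D) : {ffun 'I_4 -> D} :=
  [ffun i : 'I_4 => nth xz.1 [:: xz.1; xz.2; rev_step xz.1; rev_step xz.2] i].
pose F (x z : D) (a : 'I_m.+1) : bool :=
  (tnth P (if x.2 then a + z.1 else a + x.1 + z.1)
     == tnth P (if x.2 then a else a + x.1)) &&
  (tnth P (if z.2 then a else a + z.1)
     == tnth P (if z.2 then a + x.1 else a + x.1 + z.1)).
have -> : match_number P (ord_decode [:: 2; 3; 0; 1]%N) =
    (\sum_(xz : D * D) \sum_a F xz.1 xz.2 a)%N.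
  rewrite /match_number (reindex_onto cross (fun y => (y o0, y o1))) /=.
    apply: eq_big => [[x z]|[x z] _].
      by rewrite decode_fixed // i0 i1 i2 i3 !ffunE /= !rev_stepK !eqxx.
    apply: eq_bigr => a _; rewrite letters_match4 i0 i1 i2 i3.
    have [-> -> -> ->] := model_slot4 a (cross (x, z)).
    rewrite /F !ffunE /=; case: x => r u; case: z => t w /=.
    have e1 : a + r + t - r = a + t by rewrite addrAC addrK.
    rewrite e1 addrK sym4; congr nat_of_bool.
    by case: u; case: w.
  move=> y; rewrite decode_fixed // i0 i1 i2 i3 => /and4P[/eqP y2 /eqP y3 _ _].
  apply/ffunP => l; rewrite ffunE.
  by case: l => [[|[|[|[|//]]]] lt] /=; rewrite -?y2 -?y3; congr (y _); exact: val_inj.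
rewrite -(pair_bigA _ (fun x z => \sum_a F x z a)%N) /=.
rewrite -(pair_bigA _ (fun r u => \sum_z \sum_a F (r, u) z a)%N) /=.
under eq_bigr => r _.
  rewrite big_bool -!(pair_bigA _ (fun t w => \sum_a F (r, _) (t, w) a)%N) /=.
  rewrite -big_split /=.
  under eq_bigr do rewrite !big_bool.
  over.
rewrite /F /=.
under eq_bigr do rewrite !big_split /=.
rewrite !big_split /= !mulSn mul0n addn0 -addnA.
have shift h (f : 'I_m.+1 -> nat) : (\sum_a f a = \sum_a f (a - h)%R)%N.
  by rewrite (reindex_inj (addIr (- h))).
have opp (f : 'I_m.+1 -> nat) : (\sum_a f a = \sum_a f (- a)%R)%N.
  by rewrite (reindex_inj oppr_inj).
(* Each choice of the two halves compares letters along two sides of the parallelogram that share a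
   corner; translating this corner to [a] and changing the signs of [r] and [t] gives the same
   triples in all four cases. *)
rewrite sum_letter_triples; congr (_ + (_ + (_ + _)))%N.
- by apply: eq_bigr => r _; apply: eq_bigr => t _; apply: eq_bigr => a _;
    rewrite andbC; congr (_ && _ : nat); rewrite eq_sym.
- apply: eq_bigr => r _; rewrite opp; apply: eq_bigr => t _.
  rewrite (shift (- t)); apply: eq_bigr => a _; rewrite !opprK.
  by rewrite andbC addrK [_ + t + r]addrAC addrK.
- rewrite opp; apply: eq_bigr => r _; apply: eq_bigr => t _.
  rewrite (shift (- r)); apply: eq_bigr => a _; rewrite !opprK.
  rewrite andbC addrK; congr (_ && _ : nat); by rewrite eq_sym.
rewrite opp; apply: eq_bigr => r _; rewrite opp; apply: eq_bigr => t _.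
rewrite (shift (- r - t)); apply: eq_bigr => a _.
have -> : a - (- r - t) = a + r + t by rewrite opprD !opprK addrA.
have -> : a + r + t - r = a + t by rewrite addrAC addrK.
by rewrite !addrK andbC [tnth P (a + r) == _]eq_sym.
Qed.

(** In lowest terms, 2 plus the sum of the cubes of the relative frequencies: 1 for each noncrossing
    pairing, the rest from the crossing one. *)
Lemma limit_moment4 (R : realFieldType) : limit_moment P R 4 =
  (2 * (m.+1 * (m.+1).*2 ^ 2) + 4 * \sum_(f <- frequencies P) f ^ 3)%:R /
  (m.+1 * (m.+1).*2 ^ 2)%:R.
Proof.
rewrite limit_momentE sum_pairings4 match_number_1032 match_number_2301.
by rewrite match_number_3210 letter_triplesE addnAC addnn -mul2n.
Qed.

End FourthMoment.

Lemma limit_moment4_perm (R : realFieldType) m nu (P P' : m.+1.-tuple 'I_nu) :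
  perm_eq (frequencies P) (frequencies P') ->
  limit_moment P R 4 = limit_moment P' R 4.
Proof. by move=> pe; rewrite !limit_moment4 (perm_big _ pe). Qed.

(** * Eigenvalues of real symmetric matrices *)

From mathcomp Require Import complex.

Section RealSpectral.
Variable (R : realType).
Local Notation C := R[i].

Lemma char_poly_similar (F : fieldType) n (P D : 'M[F]_n) : P \in unitmx ->
  char_poly (invmx P *m D *m P) = char_poly D.
Proof.
move=> Pu; rewrite /char_poly.
have -> : char_poly_mx (invmx P *m D *m P) =
    map_mx polyC (invmx P) *m char_poly_mx D *m map_mx polyC P.
  rewrite /char_poly_mx mulmxBr mulmxBl -!map_mxM; congr (_ - _).
  by rewrite scalar_mxC -mulmxA -map_mxM mulVmx // map_mx1 mulmx1.
rewrite !det_mulmx mulrAC -det_mulmx -map_mxM mulVmx // map_mx1 det1 mul1r //.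
Qed.

Lemma exp_similar (F : fieldType) n (P D : 'M[F]_n.+1) k : P \in unitmx ->
  (invmx P *m D *m P) ^+ k = invmx P *m D ^+ k *m P.
Proof.
move=> Pu; elim: k => [|k IHk]; first by rewrite !expr0 mulmx1 mulVmx.
rewrite !exprS IHk -[_ * _]/(_ *m _) -[D * _]/(_ *m _) !mulmxA; congr (_ *m _ *m _).
by rewrite -!mulmxA mulmxV // mulmx1.
Qed.

Lemma exp_diag_mx (F : fieldType) n (d : 'rV[F]_n.+1) k :
  diag_mx d ^+ k = diag_mx (map_mx (fun x => x ^+ k) d).
Proof.
elim: k => [|k IHk].
  rewrite expr0; apply/matrixP => i j; rewrite !mxE expr0.
  by case: eqP.
rewrite exprS IHk -[_ * _]/(_ *m _) mulmx_diag; congr diag_mx.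
by apply/rowP => i; rewrite !mxE exprS.
Qed.

(** Over the complex numbers the matrix is hermitian, hence diagonalizable with a real diagonal. The
    factorization descends to the reals because the embedding of polynomials is injective. *)
Lemma symmetric_char_poly n (A : 'M[R]_n) : A^T = A ->
  exists2 d : 'rV[R]_n, char_poly A = \prod_i ('X - (d 0 i)%:P)
    & exists2 P : 'M[C]_n, P \in unitmx
      & map_mx (real_complex R) A =
        invmx P *m map_mx (real_complex R) (diag_mx d) *m P.
Proof.
move=> As; pose Ac := map_mx (real_complex R) A.
have Asym : Ac \is symmetricmx.
  apply/is_hermitianmxP; rewrite expr0 scale1r map_mx_id //.
  by rewrite /Ac map_trmx As.
have Areal : Ac \is a realmx.
  by apply/mxOverP => i j; rewrite mxE realE !lecE /= eqxx -realE num_real.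
have Aherm := realsym_hermsym Asym Areal.
have /orthomx_spectralP AE := hermitian_normalmx Aherm.
have Punit := spectral_unit Ac.
have Dreal := hermitian_spectral_diag_real Aherm.
pose d : 'rV[R]_n := map_mx (@complex.Re R) (spectral_diag Ac).
have dE : spectral_diag Ac = map_mx (real_complex R) d.
  apply/rowP => i; rewrite !mxE; by have /mxOverP/(_ 0 i)/RRe_real/esym := Dreal.
have AE' : Ac = invmx (spectralmx Ac) *m map_mx (real_complex R) (diag_mx d)
    *m spectralmx Ac.
  by rewrite map_diag_mx -dE.
exists d; last by exists (spectralmx Ac).
apply: (map_poly_inj (real_complex R)); rewrite map_char_poly /= -/Ac AE'.
rewrite char_poly_similar // -map_char_poly; congr map_poly.
rewrite char_poly_trig ?diag_mx_is_trig //.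
by apply: eq_bigr => i _; rewrite mxE eqxx.
Qed.

Lemma eigenvaluesP n (A : 'M[R]_n) : A^T = A ->
  char_poly A = \prod_(l <- eigenvalues A) ('X - l%:P).
Proof.
move=> /symmetric_char_poly[d dE _].
have ex : [set s : seq R | char_poly A = \prod_(l <- s) ('X - l%:P)]%classic
    [seq d 0 i | i <- enum 'I_n].
  by rewrite /= dE big_map big_enum.
exact: (xgetI [::] ex).
Qed.

Lemma size_eigenvalues n (A : 'M[R]_n) : A^T = A -> size (eigenvalues A) = n.
Proof.
move=> /eigenvaluesP e; have := size_char_poly A.
by rewrite e size_prod_XsubC => -[].
Qed.

Lemma sum_eigenvalues_exp n (A : 'M[R]_n.+1) k : A^T = A ->
  \sum_(l <- eigenvalues A) l ^+ k = \tr (A ^+ k).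
Proof.
move=> As; have [d dE [P Pu AE]] := symmetric_char_poly As.
(* The roots of a split polynomial are unique up to order, so the arbitrary choice inside
   [eigenvalues] is harmless. *)
have pe : perm_eq (eigenvalues A) [seq d 0 i | i <- enum 'I_n.+1].
  by apply: prod_XsubC_eq; rewrite -eigenvaluesP // dE big_map big_enum.
rewrite (perm_big _ pe) big_map big_enum /=; apply: (@complexI R).
rewrite -[RHS](trace_map_mx (real_complex R)) rmorphXn /= AE exp_similar //.
rewrite mxtrace_mulC mulmxA mulmxV // mul1mx map_diag_mx exp_diag_mx mxtrace_diag.
by rewrite rmorph_sum; apply: eq_bigr => i _; rewrite !mxE rmorphXn.
Qed.

End RealSpectral.

(** * Independence and expected moments *)

Local Open Scope classical_set_scope.

Import HBNNSimple.

Section WeightedLaw.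
Context (R : realType).

Lemma integral_mul_nnsfun d (T : measurableType d)
    (mu : {measure set T -> \bar R}) (Z : {mfun T >-> R}) (Y : T -> R) (h : {nnsfun R >-> R}) :
    measurable_fun setT Y -> (forall w, 0 <= Y w) ->
  (\int[mu]_w (Y w * h (Z w))%:E =
   \sum_(v \in range h) (v%:E * \int[mu]_w (Y w * \1_(h @^-1` [set v]) (Z w))%:E))%E.
Proof.
move=> mY Y0.
have mind v : measurable_fun setT (fun w => \1_(h @^-1` [set v]) (Z w) : R).
  exact: measurableT_comp.
under eq_integral => w _.
  rewrite fimfunE mulr_fsumr -?fsumEFin//; over.
rewrite /= ge0_integral_fsum//; first last.
- move=> v w _; rewrite lee_fin mulr_ge0// -lee_fin EFinM.
  exact: nnfun_muleindic_ge0.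
- move=> v; apply/measurable_EFinP; apply: measurable_funM => //.
  exact: measurable_funM.
apply: eq_fsbigr => v; rewrite inE => -[/= t _ <-{v}].
under eq_integral => w _ do rewrite mulrCA EFinM.
rewrite ge0_integralZl//.
- by apply/measurable_EFinP; exact: measurable_funM.
- by move=> w _; rewrite lee_fin mulr_ge0.
- by rewrite lee_fin.
Qed.

(** From indicators to nonnegative functions, through simple functions and monotone convergence. The
    weight [Y] allows two uses: [Y] is the remaining product of factors in the proof of
    independence, and the density against Lebesgue measure. *)
Lemma integral_mul_ge0 d d' (T : measurableType d) (T' : measurableType d')
    (mu : {measure set T -> \bar R}) (Pr : probability T' R)
    (Z : {mfun T >-> R}) (Z' : {mfun T' >-> R}) (Y : T -> R) (c : R) :
    measurable_fun setT Y -> (forall w, 0 <= Y w) -> 0 <= c ->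
    (forall B, measurable B ->
      (\int[mu]_w (Y w * \1_B (Z w))%:E = c%:E * Pr (Z' @^-1` B))%E) ->
  forall f : R -> R, measurable_fun setT f -> (forall x, 0 <= f x) ->
  (\int[mu]_w (Y w * f (Z w))%:E = c%:E * \int[Pr]_w (f (Z' w))%:E)%E.
Proof.
move=> mY Y0 c0 YB f mf f0.
have mF : measurable_fun setT (EFin \o f) by exact/measurable_EFinP.
pose h n := nnsfun_approx measurableT mF n.
have hf x : EFin \o (fun n => h n x) @ \oo --> (f x)%:E.
  by apply: (@cvg_nnsfun_approx _ _ _ _ measurableT _ mF) => // y _; rewrite lee_fin.
have hnd x : {homo (fun n => h n x) : m n / (m <= n)%N >-> m <= n}.
  by move=> m n mn; have /lefP := nd_nnsfun_approx measurableT mF mn; exact.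
have cvgY d0 (T0 : measurableType d0) (nu : {measure set T0 -> \bar R})
    (W : {mfun T0 >-> R}) (Y' : T0 -> R) :
    measurable_fun setT Y' -> (forall w, 0 <= Y' w) ->
    (\int[nu]_w (Y' w * h n (W w))%:E)%E @[n --> \oo] -->
    (\int[nu]_w (Y' w * f (W w))%:E)%E.
  move=> mY' Y'0.
  have -> : (\int[nu]_w (Y' w * f (W w))%:E =
      \int[nu]_w limn (fun n => (Y' w * h n (W w))%:E))%E.
    apply: eq_integral => w _; apply/esym/cvg_lim => //.
    rewrite EFinM; under eq_fun do rewrite EFinM.
    by apply: cvgeZl => //; exact: hf.
  apply: cvg_monotone_convergence => //.
  - move=> n; apply/measurable_EFinP; apply: measurable_funM => //.
    exact: measurableT_comp.
  - by move=> n w _; rewrite lee_fin mulr_ge0.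
  - by move=> w _ m n mn; rewrite lee_fin ler_wpM2l// hnd.
have hS n : (\int[mu]_w (Y w * h n (Z w))%:E =
    c%:E * \int[Pr]_w (cst 1 w * h n (Z' w))%:E)%E.
  rewrite integral_mul_nnsfun// (integral_mul_nnsfun Pr Z' (Y := cst 1))//.
  rewrite ge0_mule_fsumr; last first.
    move=> v; have [v0|v0] := leP 0 v.
      by rewrite mule_ge0 ?lee_fin// integral_ge0// => w _; rewrite lee_fin mul1r.
    rewrite integral0_eq ?mule0// => w _; rewrite preimage_nnfun0// indic0.
    by rewrite mulr0.
  apply: eq_fsbigr => v _; rewrite YB//.
  rewrite muleCA; congr (_ * (_ * _))%E.
  under eq_integral => w _ do rewrite mul1r.
  rewrite -[RHS]/(\int[Pr]_w (\1_(Z' @^-1` (h n @^-1` [set v])) w)%:E)%E.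
  rewrite integral_indic//= ?setIT// -[X in measurable X]setTI.
  apply: measurable_funPT => //; apply: measurable_funPTI; exact: measurable_set1.
have oneE : (\int[Pr]_w (f (Z' w))%:E = \int[Pr]_w (cst 1 w * f (Z' w))%:E)%E.
  by apply: eq_integral => w _; rewrite mul1r.
have cY := cvgY _ _ mu Z Y mY Y0.
have cY' : (\int[mu]_w (Y w * h n (Z w))%:E)%E @[n --> \oo] -->
    (c%:E * \int[Pr]_w (cst 1 w * f (Z' w))%:E)%E.
  by under eq_fun do rewrite hS; apply: cvgeZl => //; exact: cvgY.
by rewrite oneE; exact: (cvg_unique _ cY cY').
Qed.

End WeightedLaw.

Section Independence.
Context d (T : measurableType d) (R : realType) (Pr : probability T R).
Variables (I : finType) (X : I -> {RV Pr >-> R}).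
Hypothesis indepX : mutually_independent X.

Lemma prod_EFin (Q : pred I) (F : I -> R) :
  (\prod_(i | Q i) (F i)%:E = (\prod_(i | Q i) F i)%:E)%E.
Proof. by elim/big_rec2: _ => // i x y _ ->; rewrite EFinM. Qed.

Lemma prod_indic (A : I -> set T) (J : {pred I}) w :
  \prod_(i in J) \1_(A i) w = \1_(\bigcap_(i in [set j | j \in J]) A i) w :> R.
Proof.
rewrite [RHS]indicE; case: (boolP (w \in _)) => [|].
  by rewrite inE => h; rewrite big1// => i iJ; rewrite indicE mem_set//; exact: h.
rewrite notin_setE => /existsNP[i /not_implyP[iJ nA]].
by rewrite (bigD1 i)//= indicE memNset// mul0r.
Qed.

(** Independence is the case of indicators; the indicators are replaced by the functions [f i] one
    index at a time. *)
Lemma integral_prod_ge0 (f : I -> R -> R) (c : I -> R) :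
    (forall i, measurable_fun setT (f i)) -> (forall i x, 0 <= f i x) ->
    (forall i, \int[Pr]_w (f i (X i w))%:E = (c i)%:E)%E ->
  (\int[Pr]_w (\prod_i f i (X i w))%:E = (\prod_i c i)%:E)%E.
Proof.
move=> mf f0 fc.
have c0 i : 0 <= c i.
  by rewrite -lee_fin -fc integral_ge0// => w _; rewrite lee_fin.
have mfX i : measurable_fun setT (fun w => f i (X i w)) by exact: measurableT_comp.
(* Indices in [r] already carry their function, the others still carry an indicator. *)
have key (r : seq I) : uniq r -> forall B : I -> set R, (forall i, measurable (B i)) ->
    (\int[Pr]_w ((\prod_(i <- r) f i (X i w)) *
        \prod_(i | i \notin r) \1_(B i) (X i w))%:E =
    ((\prod_(i <- r) c i) * \prod_(i | i \notin r) fine (Pr (X i @^-1` B i)))%:E)%E.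
  elim: r => [_ B mB|j r IHr /= /andP[jr ur] B mB].
    under eq_integral => w _.
      rewrite big_nil mul1r (eq_bigl (fun i => i \in [set: I])%SET); last by move=> i; rewrite !inE.
      rewrite (prod_indic (fun i => X i @^-1` B i)); over.
    rewrite integral_indic//; last first.
      by apply: fin_bigcap_measurable => [|i _]; [exact: finite_finset|exact: measurable_funPTI].
    rewrite setIT big_nil mul1r -prod_EFin.
    transitivity (\prod_(i in [set: I]%SET) Pr (X i @^-1` B i))%E.
      exact: indepX.
    apply: eq_big => [i|i _]; first by rewrite !inE.
    by rewrite fineK// fin_num_measure//; exact: measurable_funPTI.
  pose Y w := (\prod_(i <- r) f i (X i w)) * \prod_(i | i \notin j :: r) \1_(B i) (X i w).
  pose cY := (\prod_(i <- r) c i) * \prod_(i | i \notin j :: r) fine (Pr (X i @^-1` B i)).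
  have mY : measurable_fun setT Y.
    apply: measurable_funM; first by apply: measurable_prod => i _; exact: mfX.
    under eq_fun do rewrite -big_filter.
    by apply: measurable_prod => i _; exact: measurableT_comp.
  have Y0 w : 0 <= Y w by rewrite mulr_ge0// prodr_ge0.
  have cY0 : 0 <= cY by rewrite mulr_ge0// prodr_ge0// => i _; rewrite fine_ge0.
  have notin_cons (F : I -> R) : \prod_(i | i \notin r) F i =
      F j * \prod_(i | i \notin j :: r) F i.
    rewrite (bigD1 j)//=; congr (_ * _); apply: eq_bigl => i.
    by rewrite inE negb_or andbC.
  have YB C : measurable C ->
      (\int[Pr]_w (Y w * \1_C (X j w))%:E = cY%:E * Pr (X j @^-1` C))%E.
    (* The induction hypothesis still has an indicator at [j]; its set is specialized to [C]. *)
    move=> mC; pose B' i := if i == j then C else B i.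
    have B'j : B' j = C by rewrite /B' eqxx.
    have B'E i : i \notin j :: r -> B' i = B i.
      by rewrite inE negb_or /B' => /andP[/negPf -> _].
    transitivity (\int[Pr]_w ((\prod_(i <- r) f i (X i w)) *
        \prod_(i | i \notin r) \1_(B' i) (X i w))%:E)%E.
      apply: eq_integral => w _; rewrite notin_cons B'j /Y -mulrA; congr (_ * _)%:E.
      by rewrite mulrC; congr (_ * _); apply: eq_bigr => i /B'E ->.
    rewrite IHr// => [|i]; last by rewrite /B'; case: ifP.
    rewrite notin_cons B'j -[Pr (X j @^-1` C)]fineK; last first.
      by rewrite fin_num_measure//; exact: measurable_funPTI.
    rewrite -EFinM /cY -mulrA; congr (_ * _)%:E.
    by rewrite mulrC; congr (_ * _); apply: eq_bigr => i /B'E ->.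
  transitivity (\int[Pr]_w (Y w * f j (X j w))%:E)%E.
    by apply: eq_integral => w _; rewrite big_cons /Y -mulrA mulrC.
  rewrite (integral_mul_ge0 mY Y0 cY0 YB)// fc -EFinM; congr EFin.
  by rewrite /cY big_cons -[RHS]mulrA mulrC.
have := key (index_enum I) (index_enum_uniq I) (fun=> setT) (fun=> measurableT).
rewrite [X in (_ * X)%:E]big_pred0 ?mulr1 => [<-|i]; last by rewrite mem_index_enum.
apply: eq_integral => w _; rewrite [X in _ * X]big_pred0 ?mulr1// => i.
by rewrite mem_index_enum.
Qed.

(** Each factor is split into positive and negative parts, and the product is expanded over all
    choices of part; every term falls under the nonnegative case. *)
Lemma integral_prod (f : I -> R -> R) :
    (forall i, measurable_fun setT (f i)) ->
    (forall i, Pr.-integrable setT (EFin \o (f i \o X i))) ->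
  Pr.-integrable setT (EFin \o (fun w => \prod_i f i (X i w))) /\
  (\int[Pr]_w (\prod_i f i (X i w))%:E =
    (\prod_i fine (\int[Pr]_w (f i (X i w))%:E))%:E)%E.
Proof.
move=> mf fint.
pose p i (b : bool) x : R := Order.max (if b then f i x else - f i x) 0.
have p0 i b x : 0 <= p i b x by rewrite le_max lexx orbT.
have mp i b : measurable_fun setT (p i b).
  apply: measurable_maxr => //; case: b => //.
  exact: measurableT_comp.
have pint i b : Pr.-integrable setT (EFin \o (p i b \o X i)).
  apply: le_integrable (fint i) => //.
    by apply/measurable_EFinP; apply: measurableT_comp => //; exact: measurableT_comp.
  move=> w _ /=; rewrite lee_fin ger0_norm ?p0// /p ge_max normr_ge0 andbT.
  by case: b; rewrite ?ler_norm// -normrN ler_norm.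
have fE i x : f i x = p i true x - p i false x.
  rewrite /p; case: (boolP (0 <= f i x)) => [f0|].
    by rewrite max_l// max_r ?oppr_le0// subr0.
  rewrite -ltNge => /ltW f0.
  by rewrite max_r// max_l ?oppr_ge0// sub0r opprK.
pose c i b := fine (\int[Pr]_w (p i b (X i w))%:E)%E.
have cE i b : (\int[Pr]_w (p i b (X i w))%:E = (c i b)%:E)%E.
  by rewrite fineK//; exact: integrable_fin_num (pint i b).
have fcE i : fine (\int[Pr]_w (f i (X i w))%:E)%E = c i true - c i false.
  have -> : (\int[Pr]_w (f i (X i w))%:E =
      \int[Pr]_w ((p i true (X i w))%:E - (p i false (X i w))%:E))%E.
    by apply: eq_integral => w _; rewrite fE EFinB.
  by rewrite (integralB_EFin measurableT (pint i true) (pint i false)) !cE.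
pose sgn (h : {ffun I -> bool}) : R := \prod_i (if h i then 1 else -1).
have expand (u : I -> bool -> R) : \prod_i (u i true - u i false) =
    \sum_(h : {ffun I -> bool}) sgn h * \prod_i u i (h i).
  rewrite (eq_bigr (fun i => \sum_b (if b then 1 else -1) * u i b)).
    by rewrite bigA_distr_bigA; apply: eq_bigr => h _; rewrite -big_split.
  by move=> i _; rewrite big_bool mul1r mulN1r.
have prodE h : (\int[Pr]_w (\prod_i p i (h i) (X i w))%:E =
    (\prod_i c i (h i))%:E)%E.
  exact: (integral_prod_ge0 (f := fun i => p i (h i))).
have mprod h : measurable_fun setT (fun w => \prod_i p i (h i) (X i w)).
  by apply: measurable_prod => i _; exact: measurableT_comp.
have iprod (h : {ffun I -> bool}) :
    Pr.-integrable setT (fun w => (sgn h * \prod_i p i (h i) (X i w))%:E).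
  under eq_fun do rewrite EFinM; apply: integrableZl => //.
  apply/integrableP; split; first exact/measurable_EFinP.
  under eq_integral => w _ do rewrite gee0_abs ?lee_fin ?prodr_ge0//.
  by rewrite prodE ltry.
have fw w : (\prod_i f i (X i w))%:E =
    (\sum_(h : {ffun I -> bool}) (sgn h * \prod_i p i (h i) (X i w))%:E)%E.
  rewrite sumEFin -(expand (fun i b => p i b (X i w))); congr EFin.
  by apply: eq_bigr => i _; rewrite fE.
split.
  apply: eq_integrable (integrable_sum _ _ (fun h _ => iprod h)) => //.
    by move=> w _; rewrite /= fw.
under eq_integral => w _ do rewrite fw.
rewrite integral_sum//.
transitivity (\sum_(h : {ffun I -> bool}) (sgn h * \prod_i c i (h i))%:E)%E.
  apply: eq_bigr => h _.
  transitivity (\int[Pr]_w ((sgn h)%:E * (\prod_i p i (h i) (X i w))%:E))%E.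
    by apply: eq_integral => w _; rewrite EFinM.
  rewrite integralZl ?prodE//.
  apply/integrableP; split; first exact/measurable_EFinP.
  under eq_integral => w _ do rewrite gee0_abs ?lee_fin ?prodr_ge0//.
  by rewrite prodE ltry.
rewrite sumEFin -(expand c); congr EFin.
by apply: eq_bigr => i _; rewrite fcE.
Qed.

End Independence.

Section EntryMoments.
Context (R : realType) (p : R -> R) (hp : standard_density p).

Definition density_moment (j : nat) : R :=
  fine (\int[lebesgue_measure]_x (x ^+ j * p x)%:E)%E.

Lemma density_momentE j :
  (\int[lebesgue_measure]_x (x ^+ j * p x)%:E = (density_moment j)%:E)%E.
Proof.
by rewrite fineK//; apply: integrable_fin_num => //; exact: density_moments.
Qed.

Lemma density_moment0 : density_moment 0 = 1.
Proof.
apply: EFin_inj; rewrite -density_momentE -(density_mass hp).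
by apply: eq_integral => x _; rewrite expr0 mul1r.
Qed.

Lemma density_moment1 : density_moment 1 = 0.
Proof. by apply: EFin_inj; rewrite -density_momentE; exact: density_mean. Qed.

Lemma density_moment2 : density_moment 2 = 1.
Proof. by apply: EFin_inj; rewrite -density_momentE; exact: density_variance. Qed.

Context d (T : measurableType d) (Pr : probability T R) (X : {RV Pr >-> R}).
Hypothesis Xp : has_density X p.

Let idR : measurableTypeR R -> R := idfun.

#[local] HB.instance Definition _ :=
  @isMeasurableFun.Build _ _ _ _ idR (@measurable_id _ _ setT).

Lemma integral_density_ge0 (g : R -> R) :
    measurable_fun setT g -> (forall x, 0 <= g x) ->
  (\int[Pr]_w (g (X w))%:E = \int[lebesgue_measure]_x (p x * g x)%:E)%E.
Proof.
move=> mg g0; rewrite -[LHS]mul1e; apply/esym.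
have YB (B : set R) : measurable B ->
    (\int[lebesgue_measure]_x (p x * \1_B (idR x))%:E
      = 1%:E * Pr (X @^-1` B))%E.
  move=> mB; rewrite mul1e -[RHS]/(distribution Pr X B) Xp// [RHS]integral_mkcond.
  apply: eq_integral => x _; rewrite /patch indicE.
  by case: ifP; rewrite ?mulr1 ?mulr0.
exact: (integral_mul_ge0 (Z := (idR : {mfun measurableTypeR R >-> R}))
  (density_measurable hp) (density_ge0 hp) ler01 YB).
Qed.

Lemma entry_moment j :
  Pr.-integrable setT (EFin \o (fun w => X w ^+ j)) /\
  (\int[Pr]_w (X w ^+ j)%:E = (density_moment j)%:E)%E.
Proof.
pose g (b : bool) (x : R) : R := Order.max (if b then x ^+ j else - x ^+ j) 0.
have g0 b x : 0 <= g b x by rewrite le_max lexx orbT.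
have mg b : measurable_fun setT (g b).
  apply: measurable_maxr => //; case: b => //.
  exact: measurableT_comp.
have gE x : x ^+ j = g true x - g false x.
  rewrite /g; case: (boolP (0 <= x ^+ j)) => [f0|].
    by rewrite max_l// max_r ?oppr_le0// subr0.
  rewrite -ltNge => /ltW f0.
  by rewrite max_r// max_l ?oppr_ge0// sub0r opprK.
have gint b : lebesgue_measure.-integrable setT (fun x => (p x * g b x)%:E).
  apply: le_integrable (density_moments hp j) => //.
    apply/measurable_EFinP; apply: measurable_funM => //.
      exact: density_measurable.
    exact: mg.
  move=> x _ /=; rewrite lee_fin !normrM mulrC ler_wpM2r// ger0_norm ?g0//.
  by rewrite /g ge_max normr_ge0 andbT; case: b; rewrite ?ler_norm// -normrN ler_norm.
have gX b : Pr.-integrable setT (EFin \o (fun w => g b (X w))).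
  apply/integrableP; split.
    by apply/measurable_EFinP; exact: measurableT_comp.
  under eq_integral => w _ do rewrite gee0_abs ?lee_fin//.
  rewrite integral_density_ge0//.
  by rewrite -ge0_fin_numE ?integrable_fin_num ?integral_ge0// => x _;
    rewrite lee_fin mulr_ge0// density_ge0.
have XE w : (X w ^+ j)%:E = ((g true (X w))%:E - (g false (X w))%:E)%E.
  by rewrite gE EFinB.
split.
  by apply: eq_integrable (integrableB _ (gX true) (gX false)) => // w _ /=.
under eq_integral => w _ do rewrite XE.
rewrite (integralB_EFin measurableT (gX true) (gX false)) !integral_density_ge0//.
rewrite -density_momentE -(integralB_EFin measurableT (gint true) (gint false)).
by apply: eq_integral => x _; rewrite -EFinB -mulrBr -gE mulrC.
Qed.

End EntryMoments.

Section ExpectedMoment.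
Context (R : realType).

Lemma moment_atomic (N : nat) (c : {nonneg R}) (a : nat -> R) k :
  moment (mscale c (msum (fun i => dirac (a i : measurableTypeR R)) N)) k =
  (c%:num * \sum_(i < N) a i ^+ k)%:E.
Proof.
have mk : measurable_fun setT (fun x : measurableTypeR R => (x ^+ k)%:E).
  by apply/measurable_EFinP; exact: exprn_measurable.
have ge0 (g : R -> R) : measurable_fun setT g -> (forall x, 0 <= g x) ->
    (\int[mscale c (msum (fun i => dirac (a i : measurableTypeR R)) N)]_x (g x)%:E
     = (c%:num * \sum_(i < N) g (a i))%:E)%E.
  move=> mg g0; have mG : measurable_fun setT (EFin \o g) by exact/measurable_EFinP.
  rewrite ge0_integral_mscale//; last by move=> x _; rewrite lee_fin.
  rewrite ge0_integral_measure_sum//; last by move=> x _; rewrite lee_fin.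
  rewrite EFinM -sumEFin; congr (_ * _)%E; apply: eq_bigr => i _.
  by rewrite integral_dirac// diracT mul1e.
rewrite /moment integralE.
have posE x : ((fun x : R => (x ^+ k)%:E)^\+ x = (Order.max (x ^+ k) 0)%:E)%E.
  by rewrite funeposE -EFin_max.
have negE x : ((fun x : R => (x ^+ k)%:E)^\- x = (Order.max (- x ^+ k) 0)%:E)%E.
  by rewrite funenegE -EFinN -EFin_max.
under eq_integral => x _ do rewrite posE.
under [X in (_ - X)%E]eq_integral => x _ do rewrite negE.
rewrite (ge0 (fun x => Order.max (x ^+ k) 0)); last 2 first.
- by apply: measurable_maxr => //; exact: exprn_measurable.
- by move=> x; rewrite le_max lexx orbT.
rewrite (ge0 (fun x => Order.max (- x ^+ k) 0)); last 2 first.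
- by apply: measurable_maxr => //; apply: measurableT_comp => //; exact: exprn_measurable.
- by move=> x; rewrite le_max lexx orbT.
rewrite -EFinB -mulrBr -sumrB; congr (_ * _)%:E; apply: eq_bigr => i _.
case: (boolP (0 <= a i ^+ k)) => [f0|].
  by rewrite max_l// max_r ?oppr_le0// subr0.
rewrite -ltNge => /ltW f0.
by rewrite max_r// max_l ?oppr_ge0// sub0r opprK.
Qed.

Lemma moment_spectral_measure n (A : 'M[R]_n.+1) k : A^T = A ->
  moment (spectral_measure A) k =
  (\tr (A ^+ k) / (n.+1%:R * Num.sqrt n.+1%:R ^+ k))%:E.
Proof.
move=> As; rewrite /spectral_measure (moment_atomic _ _ (fun i => (eigenvalues A)`_i / Num.sqrt n.+1%:R)) /=.
congr EFin; under eq_bigr => i _ do rewrite expr_div_n.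
rewrite -mulr_suml -(sum_eigenvalues_exp k As) [X in _ = X / _](big_nth 0).
by rewrite big_mkord size_eigenvalues// invfM mulrCA.
Qed.

End ExpectedMoment.

Section PatternMatrix.
Variables (R : comNzRingType) (m nu n : nat) (P : m.+1.-tuple 'I_nu).

(** Takes arbitrary values of the variables, so that one trace formula serves the random entries and
    the matrices of signs. *)
Definition pattern_mx (f : 'I_(n.+1./2).+1 * 'I_nu -> R) : 'M[R]_n.+1 :=
  \matrix_(i, j) f (edge_var P i j).

Lemma prod_mult (I V : finType) (v : I -> V) (f : V -> R) :
  \prod_l f (v l) = \prod_x f x ^+ mult v x.
Proof.
rewrite (partition_big v xpredT) //=; apply: eq_bigr => x _.
rewrite (eq_bigr (fun=> f x)) => [|l /eqP -> //].
by rewrite prodr_const /mult; congr (_ ^+ _); apply: eq_card => l; rewrite !inE.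
Qed.

Lemma trace_pattern_mx f k : \tr (pattern_mx f ^+ k) =
  \sum_(w0 : 'I_n.+1 * {ffun 'I_k -> 'I_n.+1} | \sum_l w0.2 l == 0)
    \prod_x f x ^+ mult (walk_var P w0.1 w0.2) x.
Proof.
rewrite mxtrace_exp_walk (pair_big_dep xpredT) /=; apply: eq_big => // -[i s] _ /=.
by rewrite -prod_mult; apply: eq_bigr => l _; rewrite mxE.
Qed.

End PatternMatrix.

Lemma walk_sumE (R : realType) (al : nat -> R) m nu n (P : m.+1.-tuple 'I_nu) k :
  walk_sum al P k n =
  \sum_(w0 : 'I_n.+1 * {ffun 'I_k -> 'I_n.+1} | \sum_l w0.2 l == 0)
    weight al (walk_var P w0.1 w0.2).
Proof. by rewrite /walk_sum (pair_big_dep xpredT) /=; apply: eq_big => // -[i s]. Qed.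

Section ExpectedMoment.
Context (R : realType) (p : R -> R) (hp : standard_density p).
Variables (m nu n : nat) (P : m.+1.-tuple 'I_nu) (x : entries p n.+1 nu).

Lemma expected_momentE k : expected_moment P x k =
  (walk_sum (density_moment p) P k n / (n.+1%:R * Num.sqrt n.+1%:R ^+ k))%:E.
Proof.
rewrite /expected_moment unlock.
have wint (v : 'I_k -> 'I_(n.+1./2).+1 * 'I_nu) :=
  integral_prod (entry_indep x)
    (fun i => exprn_measurable (mult v i) : measurable_fun setT (fun y : R => y ^+ mult v i))
    (fun i => (entry_moment hp (entry_density x i) (mult v i)).1).
have wE (v : 'I_k -> 'I_(n.+1./2).+1 * 'I_nu) :
    (\int[entries_prob x]_w (\prod_i entry x i w ^+ mult v i)%:E =
     (weight (density_moment p) v)%:E)%E.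
  rewrite (wint v).2; congr EFin; apply: eq_bigr => i _.
  by rewrite (entry_moment hp (entry_density x i) (mult v i)).2.
set c := n.+1%:R * _.
transitivity (\int[entries_prob x]_w
  (c^-1%:E * \sum_(w0 : 'I_n.+1 * {ffun 'I_k -> 'I_n.+1} | (\sum_l w0.2 l == 0)%R)
    (\prod_i entry x i w ^+ mult (walk_var P w0.1 w0.2) i)%:E))%E.
  apply: eq_integral => w _; rewrite moment_spectral_measure ?block_circulant_sym//=.
  rewrite (trace_pattern_mx P (fun i => entry x i w)) -/c mulrC EFinM.
  by rewrite sumEFin.
rewrite (integralZl measurableT); last by apply: (integrable_sum measurableT) => w0 _; exact: (wint _).1.
rewrite (integral_sum measurableT); last by move=> w0; exact: (wint _).1.
under eq_bigr => w0 _ do rewrite wE.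
by rewrite sumEFin -EFinM mulrC -walk_sumE.
Qed.

End ExpectedMoment.

(** * Moment determinacy *)

Section ExpSeries.
Context (R : realType).
Implicit Types y : R.

Lemma cvg_exp_series y : series (exp_coeff y) n @[n --> \oo] --> expR y.
Proof. exact: is_cvg_series_exp_coeff. Qed.

Lemma exp_series_le y n : 0 <= y -> series (exp_coeff y) n <= expR y.
Proof.
move=> y0; apply: (nondecreasing_cvgn_le _ (@is_cvg_series_exp_coeff _ y)).
by apply: nondecreasing_series => i _ _; exact: exp_coeff_ge0.
Qed.

Lemma norm_exp_series_le y n : `|series (exp_coeff y) n| <= expR `|y|.
Proof.
apply: le_trans (exp_series_le n (normr_ge0 y)).
rewrite /series /= (le_trans (ler_norm_sum _ _ _))//.
by apply: ler_sum => i _; rewrite /exp_coeff /= normrM normrX [X in _ * X]ger0_norm.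
Qed.

Lemma exprn_le_expR y n : 0 <= y -> y ^+ n <= n`!%:R * expR y.
Proof.
move=> y0; rewrite mulrC -ler_pdivrMr ?ltr0n ?fact_gt0//.
case: n => [|n]; last by rewrite (le_trans _ (expR_ge1Dxn n y0))// lerDr.
by rewrite expr0 divr1 (le_trans _ (expR_ge1Dx y))// lerDl.
Qed.

End ExpSeries.

Section Matched.
Context (R : realType).
Local Notation T := (measurableTypeR R).
Variables (m1 m2 : probability T R).

(** The functions on which two measures agree form a linear space closed under dominated limits. It
    is enlarged from polynomials to Gaussians and then to indicators of intervals. *)
Definition matched (f : R -> R) : Prop :=
  [/\ m1.-integrable setT (EFin \o f), m2.-integrable setT (EFin \o f) &
      (\int[m1]_x (f x)%:E = \int[m2]_x (f x)%:E)%E].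

Lemma matched_lim (f_ : nat -> R -> R) (f g : R -> R) :
    (forall n, matched (f_ n)) -> (forall x, f_ n x @[n --> \oo] --> f x) ->
    (forall n x, `|f_ n x| <= g x) ->
    m1.-integrable setT (EFin \o g) -> m2.-integrable setT (EFin \o g) ->
  matched f.
Proof.
move=> mf_ ff fg g1 g2.
have meas n : measurable_fun setT (EFin \o f_ n) by have [/measurable_int] := mf_ n.
have mf : measurable_fun setT (EFin \o f).
  apply: (emeasurable_fun_cvg _ _ meas) => x _.
  by apply: cvg_EFin; [exact: nearW|exact: ff].
have dom (m : probability T R) : m.-integrable setT (EFin \o g) ->
    [/\ m.-integrable setT (EFin \o f),
     [sequence (\int[m]_x `|(f_ n x)%:E - (f x)%:E|)%E]_n @ \oo --> 0%E &
     [sequence (\int[m]_x (f_ n x)%:E)%E]_n @ \oo --> (\int[m]_x (f x)%:E)%E].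
  move=> mg; apply: (@dominated_convergence _ _ _ m _ measurableT _ _ _ meas mf _ mg).
    by apply: aeW => x _; apply: cvg_EFin; [exact: nearW|exact: ff].
  by apply: aeW => x n _; rewrite lee_fin fg.
have [i1 _ c1] := dom m1 g1; have [i2 _ c2] := dom m2 g2.
split=> //; apply: (cvg_unique _ c1) => //.
by rewrite (_ : [sequence _]_n = [sequence (\int[m2]_x (f_ n x)%:E)%E]_n)//;
  apply/funext => n /=; have [] := mf_ n.
Qed.

Lemma matchedZ (c : R) f : matched f -> matched (fun x => c * f x).
Proof.
move=> [i1 i2 e].
have Z (m : probability T R) : m.-integrable setT (EFin \o f) ->
    m.-integrable setT (EFin \o (fun x => c * f x)) /\
    (\int[m]_x (c * f x)%:E = c%:E * \int[m]_x (f x)%:E)%E.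
  move=> i; split; last by rewrite -integralZl.
  exact: (integrableZl measurableT c i).
by have [? e1] := Z _ i1; have [? e2] := Z _ i2; split; rewrite ?e1 ?e2 ?e.
Qed.

Lemma matched_sum (F : nat -> R -> R) n : (forall i, matched (F i)) ->
  matched (fun x => \sum_(0 <= i < n) F i x).
Proof.
move=> mF.
have S (m : probability T R) : (forall i, m.-integrable setT (EFin \o F i)) ->
    m.-integrable setT (EFin \o (fun x => \sum_(0 <= i < n) F i x)) /\
    (\int[m]_x (\sum_(0 <= i < n) F i x)%:E =
      \sum_(0 <= i < n) \int[m]_x (F i x)%:E)%E.
  move=> i; rewrite -integral_sum//; split.
    apply: eq_integrable (integrable_sum measurableT (index_iota 0 n) (P := xpredT)
      (fun j _ => i j)) => //.
    by move=> x _; rewrite /= sumEFin.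
  by apply: eq_integral => x _; rewrite sumEFin.
have [? e1] := S _ (fun i => let: And3 h _ _ := mF i in h).
have [? e2] := S _ (fun i => let: And3 _ h _ := mF i in h).
split=> //; rewrite e1 e2; apply: eq_bigr => i _.
by have [] := mF i.
Qed.

Lemma eq_matched f g : f =1 g -> matched f -> matched g.
Proof. by move=> /funext ->. Qed.

Lemma matched_lim_bounded (f_ : nat -> R -> R) (f : R -> R) (C : R) :
    (forall n, matched (f_ n)) -> (forall x, f_ n x @[n --> \oo] --> f x) ->
    (forall n x, `|f_ n x| <= C) -> matched f.
Proof.
move=> mf ff fC; apply: (matched_lim mf ff (g := cst C)) => //.
- exact: finite_measure_integrable_cst.
- exact: finite_measure_integrable_cst.
Qed.

End Matched.

Section Gaussian.
Context (R : realType).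
Local Notation T := (measurableTypeR R).

Lemma measurable_expR_quadratic (a b c : R) :
  measurable_fun setT (fun x : R => expR (a * x ^+ 2 + b * x + c)).
Proof.
apply: measurableT_comp => //.
apply: measurable_funD => //; apply: measurable_funD => //.
- by apply: measurable_funM => //; exact: exprn_measurable.
Qed.

(** Integrating the exponential series term by term cancels the factorials and leaves a geometric
    series of ratio at most 1/2, hence the bound 2 below. *)
Lemma gauss_integrable (m : probability T R) (K t : R) :
    finite_moments m -> (forall q, (moment m q.*2 <= (K ^+ q * q`!%:R)%:E)%E) ->
    0 <= K -> 0 <= t -> t * K <= 2^-1 ->
  m.-integrable setT (EFin \o (fun x => expR (t * x ^+ 2))).
Proof.
move=> fm mom K0 t0 tK.
have tx0 x : 0 <= t * x ^+ 2 by rewrite mulr_ge0// sqr_ge0.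
have mexp : measurable_fun setT (fun x : R => expR (t * x ^+ 2)).
  have := measurable_expR_quadratic t 0 0.
  by under eq_fun do rewrite mul0r !addr0.
have mser n : measurable_fun setT (fun x : R => series (exp_coeff (t * x ^+ 2)) n).
  rewrite /series /=; apply: measurable_sum => i; rewrite /exp_coeff /=.
  apply: measurable_funM => //; apply: measurable_funX.
  by apply: measurable_funM => //; exact: exprn_measurable.
apply/integrableP; split; first exact/measurable_EFinP.
under eq_integral => x _ do rewrite /= ger0_norm ?expR_ge0//.
have limE : (\int[m]_x (expR (t * x ^+ 2))%:E =
    \int[m]_x limn (fun n => (series (exp_coeff (t * x ^+ 2)) n)%:E))%E.
  apply: eq_integral => x _; apply/esym/cvg_lim => //.
  by apply: cvg_EFin; [exact: nearW|exact: cvg_exp_series].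
have cvgI : (\int[m]_x (series (exp_coeff (t * x ^+ 2)) n)%:E)%E @[n --> \oo] -->
    (\int[m]_x limn (fun n => (series (exp_coeff (t * x ^+ 2)) n)%:E))%E.
  apply: cvg_monotone_convergence => //.
  - by move=> n; apply/measurable_EFinP; exact: mser.
  - move=> n x _; rewrite lee_fin sumr_ge0// => i _; exact: exp_coeff_ge0.
  - move=> x _ n1 n2 n12; rewrite lee_fin.
    by apply: nondecreasing_series n12 => i _ _; exact: exp_coeff_ge0.
rewrite limE; apply: (@le_lt_trans _ _ 2%:E); last exact: ltry.
rewrite -(cvg_lim _ cvgI)//; apply: lime_le; first by apply/cvg_ex; eexists; exact: cvgI.
apply: nearW => n.
have serE x : (series (exp_coeff (t * x ^+ 2)) n)%:E =
    (\sum_(0 <= i < n) (t ^+ i / i`!%:R)%:E * (x ^+ i.*2)%:E)%E.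
  rewrite /series /= -sumEFin; apply: eq_bigr => i _.
  by rewrite /exp_coeff /= -EFinM exprMn -exprM mul2n mulrAC.
under eq_integral => x _ do rewrite serE.
rewrite integral_sum//; last by move=> i; exact: (integrableZl measurableT _ (fm i.*2)).
apply: (@le_trans _ _ (\sum_(0 <= i < n) (2^-1 ^+ i)%:E)%E).
  apply: lee_sum => i _; rewrite integralZl//.
  apply: (@le_trans _ _ ((t ^+ i / i`!%:R)%:E * (K ^+ i * i`!%:R)%:E)%E).
    by apply: lee_wpmul2l; [rewrite lee_fin divr_ge0// exprn_ge0|exact: mom].
  rewrite -EFinM lee_fin mulrACA mulVf ?pnatr_eq0 -?lt0n ?fact_gt0// mulr1 -exprMn.
  by rewrite lerXn2r// ?nnegrE ?mulr_ge0.
rewrite sumEFin lee_fin.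
have := @geometric_seriesE R 1 2^-1.
rewrite lt_eqF ?invf_lt1 ?ltr1n// => /(_ isT) => gs.
have -> : \sum_(0 <= i < n) 2^-1 ^+ i = series (geometric 1 (2^-1 : R)) n.
  by rewrite /series /=; apply: eq_bigr => i _; rewrite mul1r.
rewrite gs /= mul1r ler_pdivrMr; last by rewrite subr_gt0 invf_lt1 ?ltr1n.
have -> : 2 * (1 - 2^-1) = 1 :> R by field.
by rewrite lerBlDr lerDl exprn_ge0// invr_ge0.
Qed.

End Gaussian.

Section Determinacy.
Context (R : realType).
Local Notation T := (measurableTypeR R).
Variables (m1 m2 : probability T R) (s : R).
Hypothesis s0 : 0 < s.
Hypotheses (f1 : finite_moments m1) (f2 : finite_moments m2).
Hypothesis m12 : forall k, moment m1 k = moment m2 k.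
Hypothesis g1 : m1.-integrable setT (EFin \o (fun x => expR (2 * s * x ^+ 2))).
Hypothesis g2 : m2.-integrable setT (EFin \o (fun x => expR (2 * s * x ^+ 2))).

(* Induction on n: multiplying by one more factor exp(-s x^2) and expanding it in
   powers of x^2 is legitimate thanks to the domination by exp(2 s x^2). *)
Lemma matched_exprn_gauss n j :
  matched m1 m2 (fun x => x ^+ j * expR (- (n%:R * s) * x ^+ 2)).
Proof.
elim: n j => [|n IHn] j.
  apply: (@eq_matched _ _ _ (fun x => x ^+ j)).
    by move=> x; rewrite mul0r oppr0 mul0r expR0 mulr1.
  by split; [exact: f1|exact: f2|exact: m12].
(* From |x|^j <= 1 + x^(2j) and (s x^2)^j <= j! exp(s x^2). The second exp(s x^2) in the dominating
   function absorbs the partial sums of the series. *)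
pose c : R := 1 + j`!%:R / s ^+ j.
have c0 : 0 <= c by rewrite addr_ge0// divr_ge0// exprn_ge0// ltW.
have bnd (x : R) : `|x| ^+ j * expR (s * x ^+ 2) <= c * expR (2 * s * x ^+ 2).
  have sx0 : 0 <= s * x ^+ 2 by rewrite mulr_ge0 ?sqr_ge0// ltW.
  have -> : 2 * s * x ^+ 2 = s * x ^+ 2 + s * x ^+ 2 by ring.
  rewrite expRD mulrA ler_wpM2r ?expR_ge0//.
  have e1 : 1 <= expR (s * x ^+ 2) by rewrite -expR0 ler_expR.
  apply: (@le_trans _ _ (1 + (x ^+ 2) ^+ j)).
    rewrite -exprM mulnC exprM -[x ^+ j ^+ 2]real_normK ?num_real// normrX.
    set y := `|x| ^+ j; have y0 : 0 <= y by rewrite exprn_ge0.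
    by nra.
  rewrite /c mulrDl mul1r lerD// mulrAC ler_pdivlMr ?exprn_gt0//.
  by rewrite mulrC -exprMn exprn_le_expR.
apply: (@matched_lim _ _ _ (fun N x => series (exp_coeff (- (s * x ^+ 2))) N *
    (x ^+ j * expR (- (n%:R * s) * x ^+ 2))) _ (fun x => c * expR (2 * s * x ^+ 2))).
- move=> N; apply: (@eq_matched _ _ _ (fun x => \sum_(0 <= i < N)
      ((- s) ^+ i / i`!%:R) * (x ^+ (i.*2 + j) * expR (- (n%:R * s) * x ^+ 2)))).
    move=> x; rewrite /series /= mulr_suml; apply: eq_bigr => i _.
    by rewrite /exp_coeff /= -[- (s * x ^+ 2)]mulNr exprMn -exprM mul2n exprD; ring.
  by apply: matched_sum => i; apply: matchedZ; exact: IHn.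
- move=> x; rewrite [X in _ --> X](_ : _ = expR (- (s * x ^+ 2)) *
    (x ^+ j * expR (- (n%:R * s) * x ^+ 2))).
    by apply: cvgMr_tmp; exact: cvg_exp_series.
  rewrite [RHS]mulrCA -expRD; congr (_ * expR _); rewrite -natr1; ring.
- move=> N x; apply: le_trans (bnd x); rewrite !normrM normrX mulrCA ler_wpM2l//.
  rewrite -[leRHS]mulr1 ler_pM//.
    by apply: le_trans (norm_exp_series_le _ _) _; rewrite normrN ger0_norm// mulr_ge0 ?sqr_ge0// ltW.
  rewrite ger0_norm ?expR_ge0// -[leRHS]expR0 ler_expR mulNr oppr_le0.
  by rewrite mulr_ge0 ?sqr_ge0// mulr_ge0// ltW.
- exact: (integrableZl measurableT c g1).
- exact: (integrableZl measurableT c g2).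
Qed.

(* The cross term exp(2bax) is expanded into a power series; the Gaussian factor
   dominates its partial sums by completing the square. *)
Lemma matched_gauss n a : matched m1 m2 (fun x => expR (- (n%:R * s) * (x - a) ^+ 2)).
Proof.
set b := n%:R * s; have b0 : 0 <= b by rewrite mulr_ge0// ltW.
apply: (@matched_lim_bounded _ _ _ (fun N x => expR (- (b * a ^+ 2)) *
  (series (exp_coeff (2 * b * a * x)) N * expR (- b * x ^+ 2))) _ 1).
- move=> N; apply: matchedZ; apply: (@eq_matched _ _ _ (fun x =>
      \sum_(0 <= j < N) ((2 * b * a) ^+ j / j`!%:R) * (x ^+ j * expR (- b * x ^+ 2)))).
    move=> x; rewrite /series /= mulr_suml; apply: eq_bigr => j _.
    by rewrite /exp_coeff /= [(2 * b * a * x) ^+ j]exprMn; ring.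
  by apply: matched_sum => j; apply: matchedZ; exact: matched_exprn_gauss.
- move=> x; rewrite [X in _ --> X](_ : _ = expR (- (b * a ^+ 2)) *
    (expR (2 * b * a * x) * expR (- b * x ^+ 2))).
    by apply: cvgMl_tmp; apply: cvgMr_tmp; exact: cvg_exp_series.
  by rewrite -!expRD; congr expR; ring.
- move=> N x; clearbody b; rewrite !normrM ![`|expR _|]ger0_norm ?expR_ge0//.
  have le1 := norm_exp_series_le (2 * b * a * x) N.
  apply: (@le_trans _ _ (expR (- (b * a ^+ 2)) *
      (expR `|2 * b * a * x| * expR (- b * x ^+ 2)))).
    by rewrite ler_wpM2l ?expR_ge0// ler_wpM2r ?expR_ge0.
  rewrite -!expRD -[leRHS]expR0 ler_expR !normrM (ger0_norm b0) normr_nat.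
  rewrite -[a ^+ 2]real_normK ?num_real// -[x ^+ 2]real_normK ?num_real//.
  rewrite [leLHS](_ : _ = - (b * (`|a| - `|x|) ^+ 2)); last by ring.
  by rewrite oppr_le0 mulr_ge0// sqr_ge0.
Qed.

(* The powers of h(a, .) are again Gaussian, hence so are, up to limits, the
   functions exp(-(h/t)^n), which tend to the indicator of {h < t} except on
   the level set {h = t}; {h < t} is the complement of a closed interval. *)
Let h a x : R := expR (- s * (x - a) ^+ 2).

Let h_gt0 a x : 0 < h a x. Proof. exact: expR_gt0. Qed.

Let h_le1 a x : h a x <= 1.
Proof.
by rewrite -expR0 ler_expR mulNr oppr_le0 mulr_ge0 ?sqr_ge0// ltW.
Qed.

Lemma matched_exp_gauss a (t : R) n : 0 < t ->
  matched m1 m2 (fun x => expR (- (h a x / t) ^+ n)).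
Proof.
move=> t0; have t1 : 0 <= t^-1 by rewrite invr_ge0 ltW.
apply: (@matched_lim_bounded _ _ _
  (fun N x => series (exp_coeff (- (h a x / t) ^+ n)) N) _ (expR (t^-1 ^+ n))).
- move=> N; apply: (@eq_matched _ _ _ (fun x => \sum_(0 <= j < N)
      ((-1) ^+ j * t^-1 ^+ n ^+ j / j`!%:R) *
      expR (- ((n * j)%N%:R * s) * (x - a) ^+ 2))).
    move=> x; rewrite /series /=; apply: eq_bigr => j _.
    have -> : expR (- ((n * j)%N%:R * s) * (x - a) ^+ 2) = (h a x ^+ n) ^+ j.
      by rewrite -exprM /h -expRM_natl; congr expR; ring.
    have powE (y z : R) : (- (y * z) ^+ n) ^+ j = (-1) ^+ j * ((y ^+ n) ^+ j * (z ^+ n) ^+ j).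
        by rewrite [LHS]exprNn; congr (_ * _); rewrite [(y * z) ^+ n]exprMn exprMn.
    by rewrite /exp_coeff /= powE; ring.
  by apply: matched_sum => j; apply: matchedZ; exact: matched_gauss.
- by move=> x; exact: cvg_exp_series.
- move=> N x; apply: le_trans (norm_exp_series_le _ _) _.
  rewrite ler_expR normrN ger0_norm; last first.
    by rewrite exprn_ge0// divr_ge0// ltW.
  have le_t : h a x / t <= t^-1 by rewrite ler_piMl.
  by apply: lerXn2r le_t; rewrite nnegrE// divr_ge0// ltW.
Qed.

Let step_limit (y : R) : R := if y < 1 then 1 else if y == 1 then expR (-1) else 0.

Let cvg_step (y : R) : 0 <= y -> expR (- y ^+ n) @[n --> \oo] --> step_limit y.
Proof.
move=> y0; rewrite /step_limit; case: ltP => [y1|].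
  rewrite -expR0 -oppr0; apply: continuous_cvg; first exact: continuous_expR.
  by apply: cvgN; apply: cvg_expr; rewrite ger0_norm.
rewrite le_eqVlt => /orP[/eqP <-|y1].
  by rewrite eqxx; under eq_fun do rewrite expr1n; exact: cvg_cst.
rewrite gt_eqF//; have yp : 0 < y by exact: lt_trans y1.
apply: (@squeeze_cvgr _ _ _ _ (cst 0) (fun n => y^-1 ^+ n)); last 2 first.
- exact: cvg_cst.
- by apply: cvg_expr; rewrite ger0_norm ?invr_ge0// invf_lt1.
apply: nearW => n; rewrite expR_ge0/= expRN exprVn lef_pV2 ?posrE ?expR_gt0 ?exprn_gt0//.
by rewrite (le_trans _ (expR_ge1Dx _))// lerDr.
Qed.

Lemma matched_step_limit a t : 0 < t ->
  matched m1 m2 (fun x => step_limit (h a x / t)).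
Proof.
move=> t0; apply: (@matched_lim_bounded _ _ _ (fun n x => expR (- (h a x / t) ^+ n)) _ 1).
- by move=> n; exact: matched_exp_gauss.
- by move=> x; apply: cvg_step; rewrite divr_ge0// ltW.
- move=> n x; rewrite ger0_norm ?expR_ge0// -[leRHS]expR0 ler_expR oppr_le0.
  by rewrite exprn_ge0// divr_ge0// ltW.
Qed.

Lemma matched_lt_gauss a t : 0 < t ->
  matched m1 m2 (fun x => (h a x < t)%R%:R).
Proof.
(* Levels strictly below [t] put the set {h = t} where the step limit is 0, which removes the value
   exp(-1). The shift by 2 keeps every level positive. *)
move=> t0; pose t_ n : R := t * (1 - n.+2%:R^-1).
have t_0 n : 0 < t_ n by rewrite mulr_gt0// subr_gt0 invf_lt1 ?ltr1n.
apply: (@matched_lim_bounded _ _ _ (fun n x => step_limit (h a x / t_ n)) _ 1).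
- by move=> n; exact: matched_step_limit.
- move=> x; apply: cvg_near_cst; case: (ltP (h a x) t) => [hx|hx]; last first.
    apply: nearW => n; have tn : t_ n < t.
      by rewrite /t_ gtr_pMr// ltrBlDr ltrDl invr_gt0.
    have h1 : 1 < h a x / t_ n.
      by rewrite ltr_pdivlMr// mul1r (lt_le_trans tn).
    by rewrite /step_limit ltNge (ltW h1) /= gt_eqF.
  have e0 : 0 < 1 - h a x / t by rewrite subr_gt0 ltr_pdivrMr// mul1r.
  near=> n; rewrite /step_limit ltr_pdivrMr// mul1r ifT//.
  rewrite /t_ mulrC -ltr_pdivrMr// ltrBrDr addrC -ltrBrDr.
  apply: le_lt_trans (_ : n.+1%:R^-1 < _).
    by rewrite lef_pV2 ?posrE// ler_nat.
  near: n; exact: (near_infty_natSinv_lt (PosNum e0)).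
- move=> n x; rewrite /step_limit; case: ifP => _; first by rewrite normr1.
  case: ifP => _; rewrite ?normr0// ger0_norm ?expR_ge0//.
Unshelve. all: by end_near. Qed.

Lemma closed_itv_eq u v : m1 `[u, v]%classic = m2 `[u, v]%classic.
Proof.
case: (leP u v) => [uv|vu]; last by rewrite set_itv_ge ?measure0// bnd_simp -ltNge.
pose a := (u + v) / 2; pose r := (v - u) / 2.
have r0 : 0 <= r by rewrite divr_ge0// subr_ge0.
(* The value of h(a, .) at the endpoints [u] and [v], both at distance [r] from [a]. *)
pose t := expR (- s * r ^+ 2).
have hE x : (h a x < t) = ~~ (u <= x <= v).
  rewrite ltr_expR !mulNr ltrN2 ltr_pM2l//.
  rewrite -[(x - a) ^+ 2]real_normK ?num_real// ltr_pXn2r ?nnegrE//.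
  rewrite ltNge ler_distl; congr (~~ (_ && _)).
    by congr (_ <= _); rewrite /a /r; lra.
  by congr (_ <= _); rewrite /a /r; lra.
have [_ _] := matched_lt_gauss a (expR_gt0 (- s * r ^+ 2)).
have indE (m : probability T R) :
    (\int[m]_x (h a x < expR (- s * r ^+ 2))%R%:R%:E = m (~` `[u, v]%classic))%E.
  rewrite -[X in _ = m X]setIT -integral_indic//; last exact: measurableC.
  by apply: eq_integral => x _; rewrite hE indicE in_setC mem_setE in_itv.
rewrite !indE !probability_setC// => e.
have fin (m : probability T R) : m `[u, v]%classic \is a fin_num.
  exact: fin_num_measure.
move: e; rewrite -(fineK (fin m1)) -(fineK (fin m2)) -!EFinB => -[].
by move=> /addrI/oppr_inj ->.
Qed.

Lemma eq_measure_of_moments (B : set T) : measurable B -> m1 B = m2 B.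
Proof.
apply: (@measure_unique _ R T (@RGenCInfty.G R) (fun n : nat => `[- n%:R, +oo[%classic) _ _ _ _ m1 m2).
- exact: RGenCInfty.measurableE.
- move=> _ _ [x ->] [y ->]; exists (Order.max x y).
  by apply/seteqP; split => z; rewrite /= !in_itv/= !andbT ge_max => /andP.
- by move=> n; exists (- n%:R).
- apply/seteqP; split => // x _; exists (Num.truncn `|x|).+1 => //=.
  rewrite in_itv/= andbT lerNl; apply/ltW/(le_lt_trans (ler_norm _)).
  by rewrite normrN truncnS_gt.
- move=> _ [x ->].
  (* Rays form a generating class stable under intersection and are increasing unions of closed
     intervals. *)
  have itvE : `[x, +oo[%classic = \bigcup_n `[x, x + n%:R]%classic.
    apply/seteqP; split => [y|y [n _]]; rewrite /= !in_itv/= ?andbT; last by case/andP.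
    move=> xy; exists (Num.truncn (y - x)).+1 => //=; rewrite in_itv/= xy -lerBlDl.
    exact/ltW/truncnS_gt.
  have cvgm (m : probability T R) :
      (m \o (fun n => `[x, x + n%:R]%classic)) n @[n --> \oo] --> m `[x, +oo[%classic.
    rewrite itvE; apply: nondecreasing_cvg_mu.
    - by move=> n; exact: measurable_itv.
    - by rewrite -itvE; exact: measurable_itv.
    - move=> i j ij; apply/subsetPset => y; rewrite /= !in_itv/= => /andP[-> yi].
      by rewrite (le_trans yi)// lerD2l ler_nat.
  apply: (cvg_unique _ (cvgm m1)) => //.
  rewrite (_ : m1 \o _ = m2 \o (fun n => `[x, x + n%:R]%classic)); first exact: cvgm.
  by apply/funext => n /=; exact: closed_itv_eq.
- by move=> n; rewrite (le_lt_trans (probability_le1 _ _))// ?ltry//; exact: measurable_itv.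
Qed.

End Determinacy.

Lemma determined_of_growth (R : realType) (mu : probability (measurableTypeR R) R)
    (K : R) : 0 < K -> finite_moments mu ->
    (forall q, (moment mu q.*2 <= (K ^+ q * q`!%:R)%:E)%E) ->
  determined_by_moments mu.
Proof.
move=> K0 fmu grow mu' fmu' e.
(* Makes 2 s K equal to 1/2, the threshold of [gauss_integrable]. *)
pose s : R := (4 * K)^-1.
have s0 : 0 < s by rewrite invr_gt0 mulr_gt0.
have sK : 2 * s * K <= 2^-1.
  by rewrite le_eqVlt; apply/orP; left; apply/eqP; rewrite /s; field; rewrite gt_eqF.
have s2 : 0 <= 2 * s by rewrite mulr_ge0// ltW.
apply: (@eq_measure_of_moments R mu' mu s s0 fmu' fmu e).
- by apply: (gauss_integrable fmu' _ (ltW K0) s2 sK) => q; rewrite e.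
- exact: (gauss_integrable fmu grow (ltW K0) s2 sK).
Qed.

(** * Existence of a measure with the limit moments *)

Section FatouLimits.
Context d (T : measurableType d) (R : realType) (P : probability T R).

Lemma fatou_cvg (h_ : nat -> T -> R) (h : T -> R) (b_ : nat -> R) (b : R) :
    (forall n, measurable_fun setT (h_ n)) -> (forall n x, 0 <= h_ n x) ->
    (forall x, h_ n x @[n --> \oo] --> h x) ->
    (forall n, (\int[P]_x (h_ n x)%:E <= (b_ n)%:E)%E) -> b_ n @[n --> \oo] --> b ->
  (\int[P]_x (h x)%:E <= b%:E)%E.
Proof.
move=> mh h0 hh hb bb.
have lE (u : nat -> \bar R) (l : \bar R) : u n @[n --> \oo] --> l -> limn_einf u = l.
  by move=> ul; rewrite is_cvg_limn_einfE ?(cvg_lim _ ul)//; apply/cvg_ex; exists l.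
have hE x : (h x)%:E = limn_einf (fun n => (h_ n x)%:E).
  by apply/esym/lE; apply: cvg_EFin; [exact: nearW|exact: hh].
under eq_integral => x _ do rewrite hE.
have bE : limn_einf (fun n => (b_ n)%:E) = b%:E.
  by apply: lE; apply: cvg_EFin; [exact: nearW|exact: bb].
rewrite -bE; apply: le_trans (fatou _ _ _ _) _ => //.
- by move=> n; apply/measurable_EFinP; exact: mh.
- by move=> n x _; rewrite lee_fin.
rewrite !limn_einf_lim; apply: lee_lim; [exact: is_cvg_einfs|exact: is_cvg_einfs|].
apply: nearW => n; apply: le_ereal_inf_tmp => _ [k nk <-].
by apply: le_trans (hb k); apply: ereal_inf_lbound; exists k.
Qed.

(* For every [e > 0] the functions [e f^2 + 1/(4e) +- f] are nonnegative, and
   Fatou's lemma applied to them bounds [+- \int f] by [+- c + e C]. *)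
Lemma integral_lim_of_L2 (f_ : nat -> T -> R) (f : T -> R) (c C : R) (c_ : nat -> R) :
    (forall n, measurable_fun setT (f_ n)) ->
    (forall x, f_ n x @[n --> \oo] --> f x) ->
    (forall n, (\int[P]_x (f_ n x ^+ 2)%:E <= C%:E)%E) ->
    (forall n, P.-integrable setT (EFin \o f_ n)) ->
    (forall n, (\int[P]_x (f_ n x)%:E = (c_ n)%:E)%E) -> c_ n @[n --> \oo] --> c ->
  P.-integrable setT (EFin \o f) /\ (\int[P]_x (f x)%:E = c%:E)%E.
Proof.
move=> mf ff fC fint fc cc.
have mlim : measurable_fun setT f.
  by apply: (measurable_fun_cvg mf) => x _; exact: ff.
have mf2 : measurable_fun setT (fun x => f x ^+ 2) by exact: measurable_funX.
have f2 : (\int[P]_x (f x ^+ 2)%:E <= C%:E)%E.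
  apply: (@fatou_cvg (fun n x => f_ n x ^+ 2) _ (fun=> C)) => //.
  - by move=> n; exact: measurable_funX.
  - by move=> n x; exact: sqr_ge0.
  - by move=> x; rewrite expr2; under eq_fun do rewrite expr2; apply: cvgM; exact: ff.
  - exact: cvg_cst.
have int2 (g : T -> R) : measurable_fun setT g -> (\int[P]_x (g x ^+ 2)%:E <= C%:E)%E ->
    P.-integrable setT (fun x => (g x ^+ 2)%:E).
  move=> mg g2; apply/integrableP; split.
    by apply/measurable_EFinP; exact: measurable_funX.
  under eq_integral => x _ do rewrite gee0_abs ?lee_fin ?sqr_ge0//.
  exact: le_lt_trans g2 (ltry _).
have cst_int (r : R) : P.-integrable setT (EFin \o cst r).
  exact: finite_measure_integrable_cst.
have fI : P.-integrable setT (EFin \o f).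
  apply: (le_integrable measurableT _ _ (integrableD measurableT (cst_int 1) (int2 f mlim f2))).
    exact/measurable_EFinP.
  move=> x _ /=; rewrite lee_fin [leRHS]ger0_norm ?addr_ge0 ?sqr_ge0//.
  by rewrite -[f x ^+ 2]real_normK ?num_real//; have := normr_ge0 (f x); nra.
split=> //; set I := (\int[P]_x (f x)%:E)%E.
have Ifin : I \is a fin_num by exact: integrable_fin_num.
pose h (e sg : R) (g : T -> R) x := e * g x ^+ 2 + (4 * e)^-1 + sg * g x.
have hI e sg (g : T -> R) : measurable_fun setT g ->
    (\int[P]_x (g x ^+ 2)%:E <= C%:E)%E -> P.-integrable setT (EFin \o g) ->
    (\int[P]_x (h e sg g x)%:E = e%:E * \int[P]_x (g x ^+ 2)%:E + (4 * e)^-1%:E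
       + sg%:E * \int[P]_x (g x)%:E)%E.
  move=> mg g2 gI.
  have i1 := integrableZl measurableT e (int2 g mg g2).
  have i2 := cst_int (4 * e)^-1.
  have i3 := integrableZl measurableT sg gI.
  under eq_integral => x _ do rewrite /h EFinD [X in (X + _)%E]EFinD !EFinM.
  rewrite (integralD measurableT (integrableD measurableT i1 i2) i3).
  rewrite (integralD measurableT i1 i2) !integralZl//; last exact: int2.
  have -> : (\int[P]_x (4 * e)^-1%:E = (4 * e)^-1%:E)%E.
    rewrite -[LHS]/(\int[P]_x (cst (4 * e)^-1%:E x))%E.
    by rewrite integral_cst//= probability_setT mule1.
  by [].
have key e sg : 0 < e -> sg ^+ 2 = 1 -> sg * fine I <= sg * c + e * C.
  move=> e0 sg1.
  have h0 g x : 0 <= h e sg g x.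
    (* Completing the square uses that the square of [sg] is 1. *)
    rewrite (_ : h _ _ _ _ = e * (g x + sg / (2 * e)) ^+ 2).
      by rewrite mulr_ge0 ?sqr_ge0// ltW.
    have e4 : (4 * e)^-1 = sg ^+ 2 * (4 * e)^-1 by rewrite sg1 mul1r.
    by rewrite /h e4; field; rewrite gt_eqF.
  have mh (g : T -> R) : measurable_fun setT g -> measurable_fun setT (h e sg g).
    move=> mg; apply: measurable_funD; last exact: measurable_funM.
    apply: measurable_funD => //; apply: measurable_funM => //.
    exact: measurable_funX.
  have : (\int[P]_x (h e sg f x)%:E <= (e * C + (4 * e)^-1 + sg * c)%:E)%E.
    apply: (@fatou_cvg (fun n => h e sg (f_ n)) _
      (fun n => e * C + (4 * e)^-1 + sg * c_ n)).
    - by move=> n; exact: mh.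
    - by move=> n x; exact: h0.
    - move=> x; rewrite /h; apply: cvgD; last by apply: cvgMl_tmp; exact: ff.
      apply: cvgD; last exact: cvg_cst.
      by apply: cvgMl_tmp; under eq_fun do rewrite expr2; rewrite expr2;
        apply: cvgM; exact: ff.
    - move=> n; rewrite hI// fc EFinD EFinD !EFinM leeD2r// leeD2r//.
      by apply: lee_wpmul2l => //; rewrite lee_fin ltW.
    - by apply: cvgD; [exact: cvg_cst|apply: cvgMl_tmp].
  rewrite hI// -/I -(fineK Ifin) -EFinM => le1.
  have : (((4 * e)^-1 + sg * fine I)%:E <= (e * C + (4 * e)^-1 + sg * c)%:E)%E.
    apply: le_trans le1; rewrite EFinD leeD2r// leeDr// mule_ge0//; first by rewrite lee_fin ltW.
    by apply: integral_ge0 => x _; rewrite lee_fin sqr_ge0.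
  by rewrite lee_fin; lra.
have C0 : 0 <= C.
  rewrite -lee_fin; apply: le_trans f2; apply: integral_ge0 => x _.
  by rewrite lee_fin sqr_ge0.
have le_sg sg : sg ^+ 2 = 1 -> sg * fine I <= sg * c.
  move=> sg1; apply/ler_addgt0Pr => e e0.
  have := key (e / (C + 1)) sg _ sg1; rewrite divr_gt0 ?ltr_wpDl// => /(_ isT) h1.
  apply: le_trans h1 _; rewrite lerD2l -mulrAC ler_pdivrMr ?ltr_wpDl//.
  by rewrite ler_wpM2l ?lerDl// ltW.
rewrite -(fineK Ifin); congr EFin; apply/eqP; rewrite eq_le.
have := le_sg 1; rewrite expr1n !mul1r => ->//=.
by have := le_sg (-1); rewrite sqrrN expr1n !mulN1r lerN2 => ->.
Qed.

End FatouLimits.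

Section UltraLimits.
Context (R : realType) (U : set_system nat) {FU : UltraFilter U}.
Hypothesis Uoo : forall i, U [set n | (i <= n)%N].

(** Compactness gives a cluster point of the image filter, and an ultrafilter converges to each of
    its cluster points. *)
Lemma ultra_bounded_cvg (x : nat -> R) (B : R) : (forall n, `|x n| <= B) ->
  exists l, forall e, 0 < e -> U [set n | `|x n - l| < e].
Proof.
move=> xB; have FP : ProperFilter U by exact: ultra_proper.
have [l [_ cl]] : `[- B, B]%classic `&` cluster (x @ U) !=set0.
  apply: (segment_compact (a := - B) (b := B)).
  have UB : U (x @^-1` `[- B, B]%classic).
    by apply: filterE => n /=; rewrite in_itv/= -ler_norml; exact: xB.
  exact: UB.
exists l => e e0; have [//|Un] := in_ultra_setVsetC [set n | `|x n - l| < e] FU.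
have [_ [[n /= nle <-] le]] : [set x n | n in ~` [set n | `|x n - l| < e]] `&`
    ball l e !=set0.
  apply: cl; last exact: nbhsx_ballx.
  have Ux : U (x @^-1` [set x n | n in ~` [set n | `|x n - l| < e]]).
    by apply: filterS Un => n nle; exists n.
  exact: Ux.
by case: nle; move: le; rewrite /ball/= distrC.
Qed.

(* The ultrafilter gives a limit at every rational at once; a subsequence
   realizing countably many of these limits is then extracted. *)
Lemma ultra_subsequence (Q : nat -> nat -> R) (l : nat -> R) :
    (forall j e, 0 < e -> U [set n | `|Q n j - l j| < e]) ->
  exists phi : nat -> nat, (forall i, (i <= phi i)%N) /\
    forall j, Q (phi i) j @[i --> \oo] --> l j.
Proof.
move=> Ql; have FP : ProperFilter U by exact: ultra_proper.
have all_j i m : U [set n | forall j, (j < m)%N -> `|Q n j - l j| < i.+1%:R^-1].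
  elim: m => [|m IHm]; first by apply: filterE.
  have i0 : 0 < i.+1%:R^-1 :> R by rewrite invr_gt0 ltr0Sn.
  apply: filterS (filterI IHm (Ql m _ i0)) => n [h1 h2] j; rewrite ltnS leq_eqVlt => /orP[/eqP ->//|].
  exact: h1.
have ex i : exists n, (i <= n)%N /\ forall j, (j < i)%N -> `|Q n j - l j| < i.+1%:R^-1.
  have Ui : U ([set n | (i <= n)%N]
      `&` [set n | forall j, (j < i)%N -> `|Q n j - l j| < i.+1%:R^-1]).
    exact: filterI (Uoo i) (all_j i i).
  by have [n [h1 h2]] := filter_ex Ui; exists n.
have [phi phiP] := choice ex.
exists phi; split=> [i|j]; first by have [] := phiP i.
apply/cvgrPdist_lt => e e0; near=> i.
rewrite distrC; apply: lt_trans (_ : i.+1%:R^-1 < e).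
  by have [_] := phiP i; apply; near: i; exact: nbhs_infty_gt.
by near: i; exact: (near_infty_natSinv_lt (PosNum e0)).
Unshelve. all: by end_near. Qed.

End UltraLimits.

Lemma ultra_nat : exists2 U : set_system nat, UltraFilter U &
  forall i, U [set n | (i <= n)%N].
Proof.
have [U [UU sU]] := @ultraFilterLemma _ (nbhs \oo) _.
by exists U => // i; apply: sU; exact: nbhs_infty_ge.
Qed.

Section MonotoneCountable.
Context (R : realType).

(* Convergence can fail only where L has a jump; disjoint gaps are separated by
   distinct rationals. *)
Lemma countable_jumps (Q : nat -> R -> R) (L : R -> R) :
    (forall n u v, 0 < u -> u <= v -> v < 1 -> Q n u <= Q n v) ->
    (forall u v, 0 < u -> u <= v -> v < 1 -> L u <= L v) ->
    (forall q : rat, 0 < (ratr q : R) < 1 ->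
      Q n (ratr q) @[n --> \oo] --> L (ratr q)) ->
  countable [set u | 0 < u < 1 /\ ~ (Q n u @[n --> \oo] --> L u)].
Proof.
move=> ndQ ndL Qq; set D := (X in countable X).
(* Otherwise rationals on both sides of [u] with nearly equal values of L would squeeze [Q n u] to
   [L u]. *)
have gap u : D u -> exists2 e, 0 < e & forall v w, 0 < v -> v < u -> u < w -> w < 1 ->
    L v + e <= L w.
  move=> [/andP[u0 u1]] nc; apply: contrapT => ng; apply: nc.
  apply/cvgrPdist_lt => e e0.
  have [v [w [v0 vu uw w1 lt]]] : exists v w, [/\ 0 < v, v < u, u < w, w < 1 & L w < L v + e / 2].
    apply: contrapT => nvw; apply: ng; exists (e / 2); first by rewrite divr_gt0.
    move=> v w v0 vu uw w1; rewrite leNgt; apply/negP => lt.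
    by apply: nvw; exists v, w.
  have [q] := rat_in_itvoo vu; rewrite in_itv/= => /andP[vq qu].
  have [r] := rat_in_itvoo uw; rewrite in_itv/= => /andP[ur rw].
  have q01 : 0 < (ratr q : R) < 1 by rewrite (lt_trans v0 vq) (lt_trans qu u1).
  have r01 : 0 < (ratr r : R) < 1 by rewrite (lt_trans u0 ur) (lt_trans rw w1).
  have e2 : 0 < e / 2 by rewrite divr_gt0.
  have /cvgrPdist_lt/(_ _ e2) cq := Qq q q01.
  have /cvgrPdist_lt/(_ _ e2) cr := Qq r r01.
  have Lqu := ndL _ _ (lt_trans v0 vq) (ltW qu) u1.
  have Lur := ndL _ _ u0 (ltW ur) (lt_trans rw w1).
  have Lvq := ndL _ _ v0 (ltW vq) (lt_trans qu u1).
  have Lrw := ndL _ _ (lt_trans u0 ur) (ltW rw) w1.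
  near=> n.
  have h1 : `|L (ratr q) - Q n (ratr q)| < e / 2 by near: n.
  have h2 : `|L (ratr r) - Q n (ratr r)| < e / 2 by near: n.
  have Qqu := ndQ n _ _ (lt_trans v0 vq) (ltW qu) u1.
  have Qur := ndQ n _ _ u0 (ltW ur) (lt_trans rw w1).
  by move: h1 h2; rewrite !ltr_norml => /andP[? ?] /andP[? ?]; apply/andP; split; lra.
(* The rational lies just above the supremum of L to the left of [u], inside the gap. *)
have sep u : D u -> exists r : rat, forall v, 0 < v -> v < 1 ->
    (v < u -> L v < ratr r) /\ (u < v -> ratr r < L v).
  move=> Du; have [e e0 he] := gap u Du; have [/andP[u0 u1] _] := Du.
  pose A := [set L v | v in [set v | 0 < v < u]].
  pose w0 := (u + 1) / 2.
  have uw0 : u < w0 by rewrite /w0; lra.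
  have w01 : w0 < 1 by rewrite /w0; lra.
  have A0 : A !=set0.
    by exists (L (u / 2)), (u / 2) => //=; rewrite divr_gt0//=; lra.
  have Aub w : u < w -> w < 1 -> ubound A (L w - e).
    move=> uw w1 _ [v /= /andP[v0 vu] <-].
    by have := he v w v0 vu uw w1; lra.
  have hA : has_sup A by split=> //; exists (L w0 - e); exact: Aub.
  have lt : sup A < sup A + e by rewrite ltrDl.
  have [r] := rat_in_itvoo lt; rewrite in_itv/= => /andP[r1 r2].
  exists r => v v0 v1; split=> [vu|uv].
    by apply: le_lt_trans r1; apply: ub_le_sup; [case: hA|exists v => //=; rewrite v0].
  have := ge_sup A0 (Aub v uv v1); lra.
have [rho rhoP] : exists rho : R -> rat, forall u, D u -> forall v, 0 < v -> v < 1 ->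
    (v < u -> L v < ratr (rho u)) /\ (u < v -> ratr (rho u) < L v).
  have ex u : exists r : rat, D u -> forall v, 0 < v -> v < 1 ->
      (v < u -> L v < ratr r) /\ (u < v -> ratr r < L v).
    have [Du|nDu] := pselect (D u); last by exists 0.
    by have [r rP] := sep u Du; exists r.
  by have [rho rhoP] := choice ex; exists rho.
apply/countable_injP; exists (choice.pickle \o rho) => u v /set_mem Du /set_mem Dv.
move=> /= /(pcan_inj choice.pickleK) e.
(* Two jumps with the same rational are refuted at their midpoint, where L would be both above and
   below it. *)
wlog uv : u v Du Dv e / u < v => [h|].
  by case: (ltgtP u v) => // [/h|/h vu]; [exact|apply/esym; exact: vu].
have [/andP[u0 u1] _] := Du; have [/andP[v0 v1] _] := Dv.
pose w := (u + v) / 2.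
have w0 : 0 < w by rewrite /w; lra.
have w1 : w < 1 by rewrite /w; lra.
have [_ h1] := rhoP u Du w w0 w1; have [h2 _] := rhoP v Dv w w0 w1.
have := h1 _; have := h2 _; rewrite e => lt1 lt2.
have : L w < L w by apply: lt_trans (lt1 _) (lt2 _); rewrite /w; lra.
by rewrite ltxx.
Unshelve. all: by end_near. Qed.

End MonotoneCountable.

Lemma law_of_moments d (T : measurableType d) (R : realType) (P : probability T R)
    (X : T -> R) (c : nat -> R) :
    measurable_fun setT X ->
    (forall k, P.-integrable setT (EFin \o (fun u => X u ^+ k)) /\
      (\int[P]_u (X u ^+ k)%:E = (c k)%:E)%E) ->
  exists mu : probability (measurableTypeR R) R,
    finite_moments mu /\ forall k, moment mu k = (c k)%:E.
Proof.
move=> mX Xc; pose X' : {RV P >-> measurableTypeR R} :=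
  @mfun_Sub _ _ T (measurableTypeR R) X (mem_set mX).
exists (distribution P X').
have mk k : measurable_fun [set: measurableTypeR R] (fun x : R => (x ^+ k)%:E).
  by apply/measurable_EFinP; exact: measurable_funX.
have dint k : (distribution P X').-integrable setT (fun x : R => (x ^+ k)%:E).
  by apply: integrable_pushforward => //; have [] := Xc k.
split=> // k; rewrite /moment integral_distribution//.
  by have [_ <-] := Xc k.
by have [] := Xc k.
Qed.

Section QuantileLimits.
Context (R : realType).
Local Notation U01 := (uniform_prob (@ltr01 R)).

Lemma uniform_prob_sub (A : set R) : measurable A -> A `<=` `[0, 1] ->
  U01 A = lebesgue_measure A.
Proof.
move=> mA A01; rewrite /uniform_prob (eq_integral (fun=> 1%E)); last first.
  move=> x /set_mem/A01 /=; rewrite in_itv/= /uniform_pdf => ->.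
  by rewrite subr0 invr1.
by rewrite integral_cst// mul1e.
Qed.

(** A Chebyshev argument: by monotonicity the square of [Q] is at least its value at [u] on [u, 1[
    if [Q u] is nonnegative, and on ]0, u] otherwise. *)
Lemma quantile_bound (Q : R -> R) (C u : R) : 
    measurable_fun setT Q ->
    (forall u v, 0 < u -> u <= v -> v < 1 -> Q u <= Q v) ->
    (\int[U01]_u (Q u ^+ 2)%:E <= C%:E)%E -> 0 < u < 1 ->
  Num.min u (1 - u) * Q u ^+ 2 <= C.
Proof.
move=> mQ ndQ QC /andP[u0 u1].
have on (A : set R) a : measurable A -> A `<=` `[0, 1] -> lebesgue_measure A = a%:E ->
    Num.min u (1 - u) <= a -> (forall v, A v -> Q u ^+ 2 <= Q v ^+ 2) ->
    Num.min u (1 - u) * Q u ^+ 2 <= C.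
  move=> mA A01 Aa ma QA; rewrite -lee_fin; apply: le_trans QC.
  have mQ2 : measurable_fun setT (fun u => (Q u ^+ 2)%:E).
    by apply/measurable_EFinP; exact: measurable_funX.
  apply: le_trans (_ : \int[U01]_(v in A) (Q v ^+ 2)%:E <= _)%E; last first.
    by apply: ge0_subset_integral => // v _; rewrite lee_fin sqr_ge0.
  apply: le_trans (_ : \int[U01]_(v in A) (cst (Q u ^+ 2)%:E v) <= _)%E.
    rewrite integral_cst//= uniform_prob_sub// Aa -EFinM lee_fin mulrC.
    by rewrite ler_wpM2l ?sqr_ge0.
  apply: ge0_le_integral => //.
  - by move=> v _; rewrite lee_fin sqr_ge0.
  - by apply/measurable_funTS.
have [Qu|Qu] := leP 0 (Q u).
  apply: (on `[u, 1[%classic (1 - u)); first exact: measurable_itv.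
  - move=> v /=; rewrite !in_itv/= => /andP[uv v1].
    by rewrite (le_trans (ltW u0) uv) ltW.
  - by rewrite lebesgue_measure_itv/= lte_fin u1 -EFinB.
  - by rewrite ge_min lexx orbT.
  - move=> v /=; rewrite in_itv/= => /andP[uv v1].
    by have := ndQ u v u0 uv v1; nra.
apply: (on `]0, u]%classic u); first exact: measurable_itv.
- move=> v /=; rewrite !in_itv/= => /andP[v0 vu].
  by rewrite ltW//= (le_trans vu (ltW u1)).
- by rewrite lebesgue_measure_itv/= lte_fin u0 -EFinB subr0.
- by rewrite ge_min lexx.
- move=> v /=; rewrite in_itv/= => /andP[v0 vu].
  by have := ndQ v u v0 vu u1; nra.
Qed.

(* Helly selection applied to quantile functions; convergence of moments
   passes to the pointwise limit because the next even moment is bounded. *)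
Lemma quantile_limit (Q : nat -> R -> R) (c_ : nat -> nat -> R) (c : nat -> R) :
    (forall n, measurable_fun setT (Q n)) ->
    (forall n u v, 0 < u -> u <= v -> v < 1 -> Q n u <= Q n v) ->
    (forall n k, U01.-integrable setT (fun u => (Q n u ^+ k)%:E)) ->
    (forall n k, (\int[U01]_u (Q n u ^+ k)%:E = (c_ n k)%:E)%E) ->
    (forall k, c_ n k @[n --> \oo] --> c k) ->
  exists mu : probability (measurableTypeR R) R,
    finite_moments mu /\ forall k, moment mu k = (c k)%:E.
Proof.
move=> mQ ndQ Qint Qc cc.
have bnd k : exists C, forall n, c_ n k <= C.
  have /cvg_seq_bounded[M [_ MM]] : cvgn (c_ ^~ k) by apply/cvg_ex; exists (c k).
  exists (M + 1) => n; apply: le_trans (ler_norm _) _.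
  by apply: MM => //; rewrite ltrDl.
have [K KP] := choice bnd.
have [U UU Uoo] := ultra_nat.
have exL u : exists l, 0 < u < 1 -> forall e, 0 < e -> U [set n | `|Q n u - l| < e].
  have [u01|nu] := boolP (0 < u < 1); last by exists 0.
  have m0 : 0 < Num.min u (1 - u).
    by have /andP[u0 u1] := u01; rewrite lt_min u0 subr_gt0.
  have QB n : `|Q n u| <= K 2%N / Num.min u (1 - u) + 1.
    have := @quantile_bound (Q n) (K 2%N) u (mQ n) (ndQ n) _ u01.
    rewrite Qc lee_fin KP mulrC -ler_pdivlMr// => /(_ isT).
    rewrite -real_normK ?num_real// => h.
    by have := normr_ge0 (Q n u); nra.
  by have [l lP] := @ultra_bounded_cvg R U UU _ _ QB; exists l => _.
have [L LP] := choice exL.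
have FU : ProperFilter U by exact: ultra_proper.
have ndL u v : 0 < u -> u <= v -> v < 1 -> L u <= L v.
  move=> u0 uv v1; apply/ler_addgt0Pr => e e0.
  have e2 : 0 < e / 2 by rewrite divr_gt0.
  have u01 : 0 < u < 1 by rewrite u0 (le_lt_trans uv).
  have v01 : 0 < v < 1 by rewrite v1 (lt_le_trans u0).
  have Ui : U ([set n | `|Q n u - L u| < e / 2] `&` [set n | `|Q n v - L v| < e / 2]).
    exact: filterI (LP u u01 _ e2) (LP v v01 _ e2).
  have [n [/=]] := filter_ex Ui; have := ndQ n u v u0 uv v1.
  by rewrite !ltr_norml => ? /andP[? ?] /andP[? ?]; lra.
pose rq j : rat := odflt 0 (choice.unpickle j).
(* Enumerates the rationals of ]0, 1[; every other code is sent to 1/2, so that the limit exists at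
   every index. *)
pose point (j : nat) : R := if 0 < (ratr (rq j) : R) < 1 then ratr (rq j) else 2^-1.
have point01 j : 0 < point j < 1.
  by rewrite /point; case: ifP => // _; rewrite invr_gt0 ltr0n/= invf_lt1 ?ltr1n.
have [phi [phioo Lphi]] := @ultra_subsequence R U UU Uoo (fun n j => Q n (point j))
  (fun j => L (point j)) (fun j => LP _ (point01 j)).
pose D := [set u | 0 < u < 1 /\ ~ (Q (phi i) u @[i --> \oo] --> L u)].
have cD : countable D.
  apply: (@countable_jumps R (fun i => Q (phi i)) L) => // [i|q q01]; first exact: ndQ.
  have := Lphi (choice.pickle q); rewrite /point /rq choice.pickleK/= q01.
  exact.
pose N := ~` `]0, 1[%classic `|` D.
have mD : measurable D by exact: countable_measurable.
have mN : measurable N by apply: measurableU => //; exact: measurableC.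
have N0 : U01 N = 0%E.
  have UD : U01 D = 0%E.
    by rewrite uniform_prob_sub ?countable_lebesgue_measure0// => u [/andP[u0 u1] _];
      rewrite /= in_itv/= !ltW.
  have UC : U01 (~` `]0, 1[%classic) = 0%E.
    rewrite probability_setC// [X in (1 - X)%E](_ : _ = 1%E) ?subee//.
    rewrite -[LHS]/(U01 _) uniform_prob_sub//; last first.
      by move=> u /=; rewrite !in_itv/= => /andP[u0 u1]; rewrite !ltW.
    by rewrite lebesgue_measure_itv/= lte_fin ltr01 -EFinB subr0.
  by apply: null_set_setU => //; exact: measurableC.
(* Set to 0 on the null set [N], so that convergence holds everywhere and the integrals are
   unchanged. *)
pose Y i u := Q (phi i) u * \1_(~` N) u.
pose X u := if u \in N then 0 else L u.
have YX u : Y i u @[i --> \oo] --> X u.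
  rewrite /Y /X indicE in_setC; case: ifP => uN /=.
    by under eq_fun do rewrite mulr0; exact: cvg_cst.
  under eq_fun do rewrite mulr1.
  apply: contrapT => nc; move/negbT/negP: uN; apply; rewrite inE.
  have [u01|nu] := boolP (0 < u < 1); [by right|left].
  by rewrite /= in_itv/=; exact/negP.
have mY i : measurable_fun setT (Y i).
  by apply: measurable_funM => //; apply: measurable_indic; exact: measurableC.
have mX : measurable_fun setT X by apply: (measurable_fun_cvg mY) => u _; exact: YX.
have mYk i k : measurable_fun setT (fun u => Y i u ^+ k) by exact: measurable_funX.
have aeY i k : ae_eq U01 setT (fun u => (Q (phi i) u ^+ k)%:E) (fun u => (Y i u ^+ k)%:E).
  exists N; split => // u /= /not_implyP[_]; apply: contra_notP => uN.
  by rewrite /Y indicE in_setC memNset// mulr1.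
have Yc i k : (\int[U01]_u (Y i u ^+ k)%:E = (c_ (phi i) k)%:E)%E.
  have m1 : measurable_fun setT (fun u => (Y i u ^+ k)%:E) by apply/measurable_EFinP; exact: mYk.
  have m2 : measurable_fun setT (fun u => (Q (phi i) u ^+ k)%:E).
    by apply/measurable_EFinP; exact: measurable_funX.
  rewrite -Qc; apply: ae_eq_integral; [exact: measurableT|exact: m1|exact: m2|].
  exact/ae_eq_sym/aeY.
have Yint i k : U01.-integrable setT (EFin \o (fun u => Y i u ^+ k)).
  apply: (le_integrable measurableT _ _ (Qint (phi i) k)).
    by apply/measurable_EFinP; exact: mYk.
  move=> u _ /=; rewrite lee_fin /Y indicE; case: (_ \in _); rewrite ?mulr1 ?mulr0//.
  by case: k => [|k]; rewrite ?expr0// exprS mul0r normr0.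
have Xk u k : Y i u ^+ k @[i --> \oo] --> X u ^+ k.
  elim: k => [|k IHk]; first by under eq_fun do rewrite expr0; exact: cvg_cst.
  by under eq_fun do rewrite exprS; rewrite exprS; exact: cvgM.
have main k : U01.-integrable setT (EFin \o (fun u => X u ^+ k)) /\
    (\int[U01]_u (X u ^+ k)%:E = (c k)%:E)%E.
  (* The square of the k-th power is the power 2k, whose integrals are bounded by [K (k + k)]. *)
  apply: (@integral_lim_of_L2 _ _ R U01 (fun i u => Y i u ^+ k) (fun u => X u ^+ k) (c k) (K (k + k)%N)
    (fun i => c_ (phi i) k)) => //.
  - by move=> i; exact: mYk.
  - move=> i; under eq_integral do rewrite expr2 -exprD.
    by rewrite Yc lee_fin KP.
  - move: (cc k); apply: cvg_comp; apply/cvgnyPge => A.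
    by near=> i; apply: leq_trans (phioo i); near: i; exact: nbhs_infty_ge.
by apply: (@law_of_moments _ _ R U01 X c); [exact: mX|exact: main].
Unshelve. all: by end_near. Qed.

End QuantileLimits.

Section AtomicQuantiles.
Context (R : realType).
Local Notation U01 := (uniform_prob (@ltr01 R)).

Let cell (M : nat) (i : nat) : set R := `[i%:R / M.+1%:R, i.+1%:R / M.+1%:R[%classic.

Let mem_cell M i u : (u \in cell M i) = (i%:R <= u * M.+1%:R < i.+1%:R).
Proof.
by apply/idP/idP; rewrite inE /cell/= in_itv/= ler_pdivrMr// ltr_pdivlMr.
Qed.

Let cell_inj M i j u : u \in cell M i -> u \in cell M j -> i = j.
Proof.
rewrite !mem_cell => /andP[i1 i2] /andP[j1 j2].
have := le_lt_trans i1 j2; have := le_lt_trans j1 i2.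
by rewrite !ltr_nat; lia.
Qed.

Let step (M : nat) (a : nat -> R) (u : R) : R := \sum_(i < M.+1) a i * \1_(cell M i) u.

Let stepE M a i u : (i < M.+1)%N -> u \in cell M i -> step M a u = a i.
Proof.
move=> iM ui; rewrite /step (bigD1 (Ordinal iM))//= indicE ui mulr1 big1 ?addr0//.
move=> j ji; rewrite indicE; case: (boolP (u \in cell M j)) => [uj|_]; last by rewrite mulr0.
by case/eqP: ji; apply/val_inj => /=; exact: cell_inj uj ui.
Qed.

(** Restricted to positive exponents: off the cells the step function is 0, while its power 0 is
    1. *)
Let step_exp M a k u : step M a u ^+ k.+1 = step M (fun i => a i ^+ k.+1) u.
Proof.
have [[i ui]|nu] := pselect (exists i : 'I_M.+1, u \in cell M i).
  by rewrite !(stepE _ (ltn_ord i) ui).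
by rewrite /step !big1 ?exprS ?mul0r// => i _; rewrite indicE; case: (boolP (u \in _)) => [ui|];
  rewrite ?mulr0//; case: nu; exists i.
Qed.

Let measurable_step M a : measurable_fun setT (step M a).
Proof.
apply: measurable_sum => i; apply: measurable_funM; first exact: measurable_cst.
by apply: measurable_indic; exact: measurable_itv.
Qed.

Let step_integral M a : U01.-integrable setT (fun u => (step M a u)%:E) /\
  (\int[U01]_u (step M a u)%:E = ((M.+1)%:R^-1 * \sum_(i < M.+1) a i)%:E)%E.
Proof.
have cellP (i : 'I_M.+1) : U01 (cell M i) = (M.+1%:R^-1)%:E.
  have mc : measurable (cell M i) by exact: measurable_itv.
  rewrite (uniform_prob_sub mc); last first.
    move=> u /mem_set; rewrite mem_cell => /andP[h1 h2]; rewrite /= in_itv/=.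
    have M0 : 0 < M.+1%:R :> R by rewrite ltr0Sn.
    have i0 : 0 <= i%:R :> R by rewrite ler0n.
    have iM : i.+1%:R <= M.+1%:R :> R by rewrite ler_nat ltn_ord.
    by apply/andP; split; nra.
  rewrite /cell lebesgue_measure_itv/= lte_fin ltr_pM2r ?invr_gt0// ltr_nat ltnSn.
  by rewrite -EFinB -mulrBl -natrB// subSnn mul1r.
have ind (i : 'I_M.+1) : U01.-integrable setT (fun u => (\1_(cell M i) u)%:E).
  by apply: integrable_indic; exact: measurable_itv.
have indZ (i : 'I_M.+1) :
    U01.-integrable setT (fun u => (a i * \1_(cell M i) u)%:E).
  under eq_fun do rewrite EFinM; exact: (integrableZl measurableT (a i) (ind i)).
rewrite /step; under eq_fun do rewrite -sumEFin.
split; first by apply: (integrable_sum measurableT) => i _.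
rewrite (integral_sum measurableT); last by move=> i; exact: indZ.
  rewrite mulr_sumr -sumEFin; apply: eq_bigr => i _.
under eq_integral do rewrite EFinM.
rewrite (integralZl measurableT (ind i)) (integral_indic _ measurableT); last exact: measurable_itv.
by rewrite setIT -[X in (_ * X)%E]/(U01 (cell M i)) cellP -EFinM mulrC.
Qed.

(** The quantile function of the uniform law on [s]: a step function on equal cells, monotone
    because [s] is sorted first. *)
Lemma seq_quantile (s : seq R) : s != [::] -> exists Q : R -> R,
  [/\ measurable_fun setT Q,
      (forall u v, 0 < u -> u <= v -> v < 1 -> Q u <= Q v)
    & forall k, U01.-integrable setT (fun u => (Q u ^+ k)%:E) /\
      (\int[U01]_u (Q u ^+ k)%:E = ((size s)%:R^-1 * \sum_(x <- s) x ^+ k)%:E)%E].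
Proof.
move=> s0; set t := sort <=%R s.
have [M sM] : exists M, size s = M.+1 by case: s s0 {t} => // x s _; exists (size s).
have tM : size t = M.+1 by rewrite size_sort.
exists (step M (nth 0 t)); split; first exact: measurable_step.
  move=> u v u0 uv v1.
  have M0 : 0 < M.+1%:R :> R by rewrite ltr0Sn.
  have ix w : 0 < w -> w < 1 -> (Num.truncn (w * M.+1%:R) < M.+1)%N /\
      w \in cell M (Num.truncn (w * M.+1%:R)).
    move=> w0 w1; have w0' : 0 <= w * M.+1%:R by rewrite mulr_ge0// ltW.
    rewrite mem_cell truncn_itv//; split => //.
    by rewrite ltnS truncn_le_nat; nra.
  have v0 := lt_le_trans u0 uv; have u1 := le_lt_trans uv v1.
  have [iu cu] := ix u u0 u1; have [iv cv] := ix v v0 v1.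
  rewrite (stepE _ iu cu) (stepE _ iv cv).
  apply: (sorted_leq_nth le_trans le_refl); rewrite ?inE ?tM//.
    by apply: sort_sorted; exact: le_total.
  by apply: le_truncn; rewrite ler_pM2r.
have sumE k : \sum_(x <- s) x ^+ k = \sum_(i < M.+1) nth 0 t i ^+ k.
  have st := permEl (perm_sort <=%R s).
  by rewrite -(perm_big _ st) (big_nth 0) big_mkord tM.
case=> [|k].
  under eq_fun do rewrite expr0.
  split; first exact: finite_measure_integrable_cst.
  rewrite -[LHS]/(\int[U01]_u (cst 1%:E u))%E integral_cst//= probability_setT mule1.
  rewrite (eq_bigr (fun=> 1)); last by move=> x _; rewrite expr0.
  by rewrite big_const_seq count_predT iter_addr_0 sM mulVf.
under eq_fun do rewrite step_exp.
by rewrite sumE sM; exact: step_integral.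
Qed.

End AtomicQuantiles.

(** The index [m + n * m.+1] is the predecessor of (n+1)(m+1), so the matrix size runs through the
    positive multiples of the period. *)
Lemma walk_moment_cvg (R : realType) (al : nat -> R) m nu (P : m.+1.-tuple 'I_nu) k :
    al 0%N = 1 -> al 1%N = 0 -> al 2%N = 1 ->
  walk_sum al P k (m + n * m.+1) /
    ((m + n * m.+1).+1%:R * Num.sqrt (m + n * m.+1).+1%:R ^+ k) @[n --> \oo]
    --> limit_moment P R k.
Proof.
move=> al0 al1 al2; have [C C0 h] := walk_sum_limit al0 al1 al2 P k.
apply/cvgrPdist_lt => e e0; near=> n.
set N := (m + n * m.+1)%N; have dN : (m.+1 %| N.+1)%N.
  have -> : N.+1 = (n.+1 * m.+1)%N by rewrite mulSn.
  exact: dvdn_mull.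
rewrite distrC; apply: le_lt_trans (h _ dN) _.
have N0 : 0 < N.+1%:R :> R by rewrite ltr0Sn.
have s0 : 0 < Num.sqrt N.+1%:R :> R by rewrite sqrtr_gt0.
rewrite ltr_pdivrMr//.
have : C ^+ 2 / e ^+ 2 < N.+1%:R.
  apply: lt_le_trans (_ : n%:R <= _); first by near: n; exact: nbhs_infty_gtr.
  by rewrite ler_nat /N mulnS; lia.
rewrite ltr_pdivrMr ?exprn_gt0// -[N.+1%:R in X in X -> _]sqr_sqrtr ?ltW//.
by rewrite -exprMn [_ * e]mulrC ltr_sqr// nnegrE ltW// mulr_gt0.
Unshelve. all: by end_near. Qed.

Section RademacherModel.
Context (R : realType) (m nu n : nat) (P : m.+1.-tuple 'I_nu).
Local Notation V := ('I_(n.+1./2).+1 * 'I_nu)%type.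

Let pattern_mx_sym (f : V -> R) : (pattern_mx P f)^T = pattern_mx P f.
Proof.
by apply/matrixP => i j; rewrite !mxE /edge_var delta_sym// slot_sym.
Qed.

(* The spectrum of all sign matrices together: averaging over the signs kills the
   monomials with an odd exponent, that is, the moments of a sign are 1, 0, 1, 0. *)
Lemma rademacher_spectrum : exists2 s : seq R, s != [::] &
  forall k, (size s)%:R^-1 * \sum_(x <- s) x ^+ k =
    walk_sum (fun j => (~~ odd j)%:R) P k n / (n.+1%:R * Num.sqrt n.+1%:R ^+ k).
Proof.
pose sgn (w : {ffun V -> bool}) x : R := (-1) ^+ w x.
pose A w := pattern_mx P (sgn w).
pose s := [seq l / Num.sqrt n.+1%:R | w <- enum {ffun V -> bool}, l <- eigenvalues (A w)].
have V0 : (0 < #|{ffun V -> bool}|)%N by apply/card_gt0P; exists [ffun=> true].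
have size_s : size s = (#|{ffun V -> bool}| * n.+1)%N.
  rewrite /s size_allpairs_dep (eq_map (g := fun=> n.+1)).
    by rewrite sumnE big_map big_const_seq count_predT iter_addn_0 -cardE mulnC.
  by move=> w; rewrite size_eigenvalues//; exact: pattern_mx_sym.
exists s => [|k]; first by rewrite -size_eq0 -lt0n size_s muln_gt0 V0.
have sE : \sum_(x <- s) x ^+ k =
    (\sum_(w : {ffun V -> bool}) \tr (A w ^+ k)) / Num.sqrt n.+1%:R ^+ k.
  rewrite /s big_allpairs_dep mulr_suml big_enum; apply: eq_bigr => w _.
  rewrite -(sum_eigenvalues_exp _ (pattern_mx_sym _)) mulr_suml.
  by apply: eq_bigr => l _; rewrite expr_div_n.
have trE : \sum_(w : {ffun V -> bool}) \tr (A w ^+ k) =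
    #|{ffun V -> bool}|%:R * walk_sum (fun j => (~~ odd j)%:R) P k n.
  under eq_bigr do rewrite trace_pattern_mx.
  rewrite exchange_big walk_sumE mulr_sumr; apply: eq_bigr => w0 _.
  (* The sum over all sign assignments factors over the variables, and each factor is 2 or 0
     according to the parity of the exponent. *)
  rewrite -(bigA_distr_bigA (fun x (b : bool) => ((-1) ^+ b) ^+ mult _ x)).
  rewrite card_ffun card_bool natrX -prodr_const -big_split; apply: eq_bigr => x _ /=.
  rewrite big_bool /= expr0 expr1 expr1n -signr_odd.
  by case: (odd _) => /=; rewrite ?expr1 ?expr0; ring.
rewrite size_s sE trE natrM.
have c0 : #|{ffun V -> bool}|%:R != 0 :> R by rewrite pnatr_eq0 -lt0n.
field.
by rewrite c0 expf_neq0 ?gt_eqF ?sqrtr_gt0 ?ltr0Sn.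
Qed.

End RademacherModel.

Lemma limit_moment_law (R : realType) m nu (P : m.+1.-tuple 'I_nu) :
  exists mu : probability (measurableTypeR R) R,
    finite_moments mu /\ forall k, moment mu k = (limit_moment P R k)%:E.
Proof.
have ex n : exists Q : R -> R,
    [/\ measurable_fun setT Q,
      (forall u v, 0 < u -> u <= v -> v < 1 -> Q u <= Q v)
    & forall k, (uniform_prob (@ltr01 R)).-integrable setT (fun u => (Q u ^+ k)%:E) /\
      (\int[uniform_prob (@ltr01 R)]_u (Q u ^+ k)%:E =
       (walk_sum (fun j => (~~ odd j)%:R) P k (m + n * m.+1) /
    ((m + n * m.+1).+1%:R * Num.sqrt (m + n * m.+1).+1%:R ^+ k))%:E)%E].
  have [s s0 sE] := rademacher_spectrum R (m + n * m.+1) P.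
  have [Q [mQ ndQ QE]] := seq_quantile s0.
  by exists Q; split=> // k; rewrite -sE; exact: QE.
have [Q QP] := choice ex.
apply: (quantile_limit (Q := Q)).
- by move=> n; case: (QP n).
- by move=> n; case: (QP n).
- by move=> n k; case: (QP n) => _ _ /(_ k)[].
- by move=> n k; case: (QP n) => _ _ /(_ k)[_]; exact.
- by move=> k; exact: walk_moment_cvg.
Qed.

(** * The limiting spectral measure *)

Local Open Scope ring_scope.

Lemma limiting_spectral_measure_of_law (R : realType) (p : R -> R) (hp : standard_density p)
    m nu (P : m.+1.-tuple 'I_nu) (mu : probability (measurableTypeR R) R) :
    finite_moments mu -> (forall k, moment mu k = (limit_moment P R k)%:E) ->
  limiting_spectral_measure p P mu.
Proof.
move=> fmu mom; split => //.
  apply: (@determined_of_growth R mu 32%:R) => //.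
  move=> q; rewrite mom lee_fin; apply: le_trans (limit_moment_le _ _ _) _.
  by rewrite -natrX -natrM ler_nat card_pairings_double.
(* The shift drops the index 0, where the matrix is empty. *)
move=> x k; rewrite mom -(cvg_shiftS (fun n => expected_moment P (x (n * m.+1)%N) k)).
under eq_fun do rewrite mulSn.
rewrite (_ : (fun n => _) = (fun n => (walk_sum (density_moment p) P k (m + n * m.+1) /
    ((m + n * m.+1).+1%:R * Num.sqrt (m + n * m.+1).+1%:R ^+ k))%:E)); last first.
  by apply/funext => n; exact: (expected_momentE hp P (x _)).
apply: cvg_EFin; first exact: nearW.
apply: walk_moment_cvg; [exact: density_moment0|exact: density_moment1|exact: density_moment2].
Qed.

Lemma neq_moment_neq_measure (R : realType) (mu mu' : probability (measurableTypeR R) R) k :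
  moment mu k <> moment mu' k ->
  ~ (forall B : set (measurableTypeR R), measurable B -> mu B = mu' B).
Proof.
move=> ne e; apply: ne; apply: eq_measure_integral => B mB _; exact: e.
Qed.

Theorem theorem1p5 (R : realType) (p : R -> R) (hp : standard_density p) :
  exists mu : forall m nu : nat,
      m.+1.-tuple 'I_nu -> probability (measurableTypeR R) R,
  [/\ forall (m nu : nat) (P : m.+1.-tuple 'I_nu),
        limiting_spectral_measure p P (mu m nu P),
      exists (m nu : nat) (P P' : m.+1.-tuple 'I_nu),
        frequencies P = frequencies P' /\
        ~ (forall B : set (measurableTypeR R), measurable B ->
             mu m nu P B = mu m nu P' B),
      forall (m nu : nat) (P P' : m.+1.-tuple 'I_nu),
        perm_eq (frequencies P) (frequencies P') ->
        moment (mu m nu P) 4 = moment (mu m nu P') 4,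
      moment (mu 3%N 2%N pattern1212) 4 = moment (mu 3%N 2%N pattern1122) 4
    & moment (mu 3%N 2%N pattern1212) 6 <> moment (mu 3%N 2%N pattern1122) 6].
Proof.
pose mu m nu P := sval (cid (@limit_moment_law R m nu P)).
have muP m nu P : finite_moments (mu m nu P) /\
    forall k, moment (mu m nu P) k = (limit_moment P R k)%:E := svalP (cid (@limit_moment_law R m nu P)).
have mom m nu P := (muP m nu P).2.
have freq : frequencies pattern1212 = frequencies pattern1122.
  by rewrite /frequencies !enum_ordSl enum_ord0.
have ne6 : moment (mu 3%N 2%N pattern1212) 6 <> moment (mu 3%N 2%N pattern1122) 6.
  by rewrite !mom => -[]; exact/eqP/limit_moment6_neq.
have eq4 m nu (P P' : m.+1.-tuple 'I_nu) : perm_eq (frequencies P) (frequencies P') ->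
    moment (mu m nu P) 4 = moment (mu m nu P') 4.
  by move=> ff; rewrite !mom (limit_moment4_perm _ ff).
exists mu; split=> //.
- by move=> m nu P; have [fm mE] := muP m nu P; exact: limiting_spectral_measure_of_law.
- by exists 3%N, 2%N, pattern1212, pattern1122; split=> //; exact: neq_moment_neq_measure ne6.
- by apply: eq4; rewrite freq.
Qed.
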